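(* Let $a>0$ be fixed. The test which rejects the hypothesis $H_0:\mathbb{P}^X\in\mathcal{N}_d$ for large values of $U_{n,a}$ is consistent against each fixed alternative satisfying $\mathbb{E}\|X\|^4<\infty$. That is: if $X,X_1,X_2,\ldots$ are i.i.d. $d$-dimensional random vectors with distribution $\mathbb{P}^X$ absolutely continuous with respect to Lebesgue measure, $\mathbb{P}^X\notin\mathcal{N}_d$ and $\mathbb{E}\|X\|^4<\infty$, then for each $\alpha\in(0,1)$, $$\lim_{n\to\infty}\mathbb{P}\big(U_{n,a}>c_n(\alpha)\big)=1 ,$$ where $c_n(\alpha)$ denotes the $(1-\alpha)$-quantile of the distribution of $U_{n,a}$ under $H_0$.
   Context: $\mathbb{P}^X$ is the distribution of $X$, and $\mathcal{N}_d$ is the class of all nondegenerate $d$-variate normal distributions $\mathrm{N}_d(\mu,\Sigma)$, $\mu\in\mathbb{R}^d$, $\Sigma\in\mathbb{R}^{d\times d}$ positive definite. $\|\cdot\|$ is the Euclidean norm, $\Delta$ the Laplace operator, and $w_a(t)=\exp(-a\|t\|^2)$. For $n\ge d+1$ put $\overline X_n=n^{-1}\sum_{j=1}^nX_j$, $S_n=n^{-1}\sum_{j=1}^n(X_j-\overline X_n)(X_j-\overline X_n)^\top$ (almost surely invertible), and $Y_{n,j}=S_n^{-1/2}(X_j-\overline X_n)$, where $S_n^{-1/2}$ is the unique symmetric positive definite square root of $S_n^{-1}$. Let $\psi_n(t)=n^{-1}\sum_{j=1}^n\exp(\mathrm{i}t^\top Y_{n,j})$ and $$U_{n,a}=n\int_{\mathbb{R}^d}\left|\Delta\psi_n(t)-\left(\|t\|^2-d\right)\psi_n(t)\right|^2w_a(t)\,\mathrm{d}t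 .$$ The statistic $U_{n,a}$ is invariant under full-rank affine transformations of $X_1,\ldots,X_n$, so that its distribution under $H_0$ (and hence $c_n(\alpha)$) does not depend on the particular element of $\mathcal{N}_d$. *)

(* Defs.v *)
From HB Require Import structures.
From mathcomp Require Import all_boot all_order all_algebra finmap.
From mathcomp Require Import all_classical all_reals all_analysis.
From mathcomp Require Import complex.

Set Implicit Arguments.
Unset Strict Implicit.
Unset Printing Implicit Defensive.

Import Order.TTheory GRing.Theory Num.Theory.
Import numFieldNormedType.Exports.

Local Open Scope classical_set_scope.
Local Open Scope ring_scope.

(* Matrices carry the sigma-algebra generated by their entries; on 'cV[R]_d
   this is the Borel sigma-algebra. *)
Definition measure_matrix_display : measure_display -> measure_display.
Proof. exact. Qed.

Section measurable_matrix.
Context {disp : measure_display} {T : measurableType disp} (m n : nat).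

Definition entry_preimages : set (set 'M[T]_(m, n)) :=
  [set A | exists i j, exists2 B : set T,
     measurable B & A = [set M : 'M[T]_(m, n) | B (M i j)]].

Let mx_set0 : <<s entry_preimages >> set0.
Proof. exact: sigma_algebra0. Qed.

Let mx_setC A : <<s entry_preimages >> A -> <<s entry_preimages >> (~` A).
Proof. exact: sigma_algebraC. Qed.

Let mx_bigcup (F : (set 'M[T]_(m, n))^nat) :
  (forall i, <<s entry_preimages >> (F i)) ->
  <<s entry_preimages >> (\bigcup_i F i).
Proof. exact: sigma_algebra_bigcup. Qed.

HB.instance Definition _ := @isMeasurable.Build (measure_matrix_display disp)
  'M[T]_(m, n) <<s entry_preimages >> mx_set0 mx_setC mx_bigcup.

Lemma measurable_entry (i : 'I_m) (j : 'I_n) :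
  measurable_fun [set: 'M[T]_(m, n)] (fun M : 'M[T]_(m, n) => M i j).
Proof.
move=> _ B mB; rewrite setTI; apply: sub_sigma_algebra.
by exists i, j, B.
Qed.

Lemma measurable_fun_mx disp' (T' : measurableType disp')
    (f : T' -> 'M[T]_(m, n)) :
  (forall i j, measurable_fun setT (fun x => f x i j)) ->
  measurable_fun setT f.
Proof.
move=> mf; apply: (@measurability _ _ _ _ setT f entry_preimages) => //.
by move=> _ [_ [i [j [B mB ->]]] <-]; exact: mf.
Qed.

End measurable_matrix.

Section lebesgue_cV.
Context {R : realType}.
Local Open Scope ereal_scope.

Definition cV_cons d (p : R * 'cV[R]_d) : 'cV[R]_d.+1 :=
  col_mx (p.1%:M)%R p.2.

Lemma measurable_cV_cons d : measurable_fun setT (@cV_cons d).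
Proof.
apply: measurable_fun_mx => i j; rewrite /cV_cons.
case: (@split_ordP 1 d i) => k ->.
  under eq_fun do rewrite (@col_mxEu _ 1 d) mxE (ord1 k) (ord1 j) eqxx mulr1n.
  exact: measurable_fst.
under eq_fun do rewrite (@col_mxEd _ 1 d).
apply: (measurableT_comp (f := fun M : 'cV[R]_d => M k j)) => //.
exact: measurable_entry.
Qed.

(* The d-fold product of the Lebesgue measure of the line. *)
Fixpoint lebesgue_cV d : set 'cV[R]_d -> \bar R :=
  match d with
  | 0%N => \d_(0%R : 'cV[R]_0)
  | d'.+1 => pushforward (lebesgue_measure \x @lebesgue_cV d') (@cV_cons d')
  end.

Let is_sfm d (m : set 'cV[R]_d -> \bar R) :=
  [/\ m set0 = 0, forall A, 0 <= m A, semi_sigma_additive m &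
      sigma_finite setT m].

Let sfmE d (m : set 'cV[R]_d -> \bar R) : is_sfm m ->
  exists m' : {sigma_finite_measure set 'cV[R]_d -> \bar R},
    m = m' :> (set 'cV[R]_d -> \bar R).
Proof.
move=> [m0 m_ge0 m_sa m_sf].
pose mm := isMeasure.Build _ _ _ m m0 m_ge0 m_sa.
pose M : {measure set _ -> \bar R} := HB.pack m mm.
pose ms := Measure_isSigmaFinite.Build _ _ _ M m_sf.
pose M' : {sigma_finite_measure set _ -> \bar R} := HB.pack m mm ms.
by exists M'.
Qed.

Let lebesgue_cV_sfm d : is_sfm (@lebesgue_cV d).
Proof.
elim: d => [|d /sfmE[m' mE]] /=.
  split=> //; [exact: measure_semi_sigma_additive|].
  apply: fin_num_fun_sigma_finite; first by rewrite measure0.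
  by move=> A mA; exact: fin_num_measure.
rewrite mE; have mc := @measurable_cV_cons d.
split.
- by rewrite /pushforward preimage_set0 measure0.
- by move=> A; rewrite /pushforward measure_ge0.
- move=> F mF tF mUF; rewrite /pushforward preimage_bigcup.
  apply: measure_semi_sigma_additive.
  + by move=> n; rewrite -[X in measurable X]setTI; exact: mc.
  + apply/trivIsetP => /= i j _ _ ij; rewrite -preimage_setI.
    by move/trivIsetP : tF => /(_ _ _ _ _ ij) ->//; rewrite preimage_set0.
  + by rewrite -preimage_bigcup -[X in measurable X]setTI; exact: mc.
have /sigma_finiteP[F [TF ndF Foo]] := sigma_finiteT (@lebesgue_measure R).
have /sigma_finiteP[G [TG ndG Goo]] := sigma_finiteT m'.
pose g (v : 'cV[R]_d.+1) : R * 'cV[R]_d :=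
  (v ord0 ord0, @dsubmx R 1 d 1 v).
have mg : measurable_fun setT g.
  apply/measurable_fun_pairP; split; first exact: measurable_entry.
  apply: measurable_fun_mx => i j; under eq_fun do rewrite mxE.
  exact: measurable_entry.
have gK : cancel (@cV_cons d) g.
  case=> x v; rewrite /g /cV_cons /=; congr pair; last exact: col_mxKd.
  have -> : ord0 = lshift d (ord0 : 'I_1) by exact: val_inj.
  by rewrite (@col_mxEu _ 1 d) mxE eqxx mulr1n.
exists (fun n => g @^-1` (F n `*` G n)).
  apply/esym/seteqP; split => // v _.
  have [n _ Fn] : (\bigcup_n F n) (g v).1 by rewrite -TF.
  have [k _ Gk] : (\bigcup_n G n) (g v).2 by rewrite -TG.
  exists (maxn n k) => //; split.
  - by move: Fn; apply/subsetPset/ndF/leq_maxl.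
  - by move: Gk; apply/subsetPset/ndG/leq_maxr.
move=> n; have [mFn Fn] := Foo n; have [mGn Gn] := Goo n; split.
  by rewrite -[X in measurable X]setTI; apply: mg => //; exact: measurableX.
rewrite /pushforward (_ : _ @^-1` _ = F n `*` G n); last first.
  rewrite -comp_preimage (_ : g \o _ = id) ?preimage_id//.
  by apply/funext => x /=; exact: gK.
by rewrite product_measure1E// lte_mul_pinfty// ge0_fin_numE.
Qed.

Let lebesgue_cV0 d : @lebesgue_cV d set0 = 0.
Proof. by have [] := @lebesgue_cV_sfm d. Qed.

Let lebesgue_cV_ge0 d A : 0 <= @lebesgue_cV d A.
Proof. by have [] := @lebesgue_cV_sfm d. Qed.

Let lebesgue_cV_sigma_additive d : semi_sigma_additive (@lebesgue_cV d).
Proof. by have [] := @lebesgue_cV_sfm d. Qed.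

Let lebesgue_cV_sigma_finite d : sigma_finite setT (@lebesgue_cV d).
Proof. by have [] := @lebesgue_cV_sfm d. Qed.

HB.instance Definition _ d := isMeasure.Build _ _ _ (@lebesgue_cV d)
  (@lebesgue_cV0 d) (@lebesgue_cV_ge0 d) (@lebesgue_cV_sigma_additive d).

HB.instance Definition _ d := Measure_isSigmaFinite.Build _ _ _ (@lebesgue_cV d)
  (@lebesgue_cV_sigma_finite d).

Lemma lebesgue_cV_box d (A : 'I_d -> set R) : (forall i, measurable (A i)) ->
  lebesgue_cV [set v : 'cV[R]_d | forall i, A i (v i ord0)] =
  \prod_(i < d) lebesgue_measure (A i).
Proof.
elim: d A => [|d IH] A mA.
  by rewrite big_ord0 /= diracE mem_set// => -[].
rewrite big_ord_recl -(IH (fun i => A (lift ord0 i)))//.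
rewrite -product_measure1E; [|exact: mA|]; last first.
  rewrite (_ : [set _ | _] = \bigcap_(i in [set: 'I_d])
      [set v : 'cV[R]_d | A (lift ord0 i) (v i ord0)]); last first.
    by apply/seteqP; split => v /= h i; [move=> _; exact: h|exact: h].
  apply: fin_bigcap_measurable => // i _.
  by rewrite -[X in measurable X]setTI; apply: measurable_entry.
have e0 : (ord0 : 'I_d.+1) = lshift d (ord0 : 'I_1) by exact: val_inj.
have eS i : lift ord0 i = @rshift 1 d i by exact: val_inj.
have c0 x v : @cV_cons d (x, v) ord0 ord0 = x.
  by rewrite /cV_cons e0 (@col_mxEu _ 1 d) mxE eqxx mulr1n.
have cS x v i : @cV_cons d (x, v) (lift ord0 i) ord0 = v i ord0.
  by rewrite /cV_cons eS (@col_mxEd _ 1 d).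
rewrite /= /pushforward; congr (product_measure1 _ _ _).
apply/seteqP; split => -[x v]/=.
  move=> h; split => [|i]; first by have := h ord0; rewrite c0.
  by have := h (lift ord0 i); rewrite cS.
move=> [h0 hS] i; have [->|[j ->]] : i = ord0 \/ exists j, i = lift ord0 j.
- by case: (unliftP ord0 i) => [j ->|->]; [right; exists j|left].
- by rewrite c0.
- by rewrite cS.
Qed.

End lebesgue_cV.

Section linear_algebra.
Context {R : realType} {d : nat}.
Implicit Types (u v x : 'cV[R]_d) (S B : 'M[R]_d).

Definition dotv u v : R := (u^T *m v) ord0 ord0.

(* The library norm `|v| on matrices is the sup norm, hence this one. *)
Definition enorm v : R := Num.sqrt (\sum_(i < d) v i ord0 ^+ 2).

Definition posdefmx S : Prop :=
  S^T = S /\ forall v, v != 0 -> 0 < dotv v (S *m v).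

(* The positive definite square root of the inverse of S; it is 0 when S is not
   positive definite, as no B then satisfies the defining property (for a
   singular S, invmx S is S). *)
Definition inv_sqrtmx S : 'M[R]_d :=
  xget 0 [set B | posdefmx B /\ B *m B = invmx S].

End linear_algebra.

Section normal_distribution.
Context {R : realType} {d : nat}.

Definition mvnormal_pdf (mu : 'cV[R]_d) (Sigma : 'M[R]_d) (x : 'cV[R]_d) : R :=
  (Num.sqrt ((2 * pi) ^+ d * \det Sigma))^-1 *
  expR (- (dotv (x - mu) (invmx Sigma *m (x - mu)) / 2)).

Definition mvnormal (mu : 'cV[R]_d) (Sigma : 'M[R]_d) (A : set 'cV[R]_d) :
    \bar R :=
  (\int[@lebesgue_cV R d]_(x in A) (mvnormal_pdf mu Sigma x)%:E)%E.

Definition nondegenerate_normal (Q : set 'cV[R]_d -> \bar R) : Prop :=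
  exists mu : 'cV[R]_d, exists2 Sigma : 'M[R]_d, posdefmx Sigma &
    forall A, measurable A -> Q A = mvnormal mu Sigma A.

End normal_distribution.

Section iid.
Context {R : realType} {disp disp' : measure_display} {T : measurableType disp}
  {T' : measurableType disp'} (P : probability T R).

Definition mutually_independent (Xs : nat -> {RV P >-> T'}) : Prop :=
  forall (J : {fset nat}) (A : nat -> set T'), (forall j, measurable (A j)) ->
    P (\bigcap_(j in [set` J]) (Xs j @^-1` A j)) =
    (\prod_(j <- J) P (Xs j @^-1` A j))%E.

Definition iid_copies (X : {RV P >-> T'}) (Xs : nat -> {RV P >-> T'}) : Prop :=
  mutually_independent Xs /\
  forall j A, measurable A -> distribution P (Xs j) A = distribution P X A.

End iid.

Arguments mutually_independent {R disp disp' T T'} P Xs.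
Arguments iid_copies {R disp disp' T T'} P X Xs.

Section statistic.
Context {R : realType} {d n : nat}.
Implicit Types (x : 'I_n -> 'cV[R]_d) (t : 'cV[R]_d) (j : 'I_n).

Definition sample_mean x : 'cV[R]_d := n%:R^-1 *: \sum_(j < n) x j.

Definition sample_cov x : 'M[R]_d :=
  n%:R^-1 *: \sum_(j < n) (x j - sample_mean x) *m (x j - sample_mean x)^T.

Definition scaled_residual x j : 'cV[R]_d :=
  inv_sqrtmx (sample_cov x) *m (x j - sample_mean x).

Definition expi (s : R) : R[i] := Complex (cos s) (sin s).

Definition ecf x t : R[i] :=
  n%:R^-1 * \sum_(j < n) expi (dotv t (scaled_residual x j)).

Definition laplacian (f : 'cV[R]_d -> R) t : R :=
  \sum_(k < d) 'D_(delta_mx k ord0) (fun s => 'D_(delta_mx k ord0) f s) t.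

Definition claplacian (f : 'cV[R]_d -> R[i]) t : R[i] :=
  Complex (laplacian (fun s => complex.Re (f s)) t)
          (laplacian (fun s => complex.Im (f s)) t).

Definition weight (a : R) t : R := expR (- (a * enorm t ^+ 2)).

Definition U_stat (a : R) x : R :=
  n%:R * \int[@lebesgue_cV R d]_t
    (Normc.normc (claplacian (ecf x) t -
                  real_complex R (enorm t ^+ 2 - d%:R) * ecf x t) ^+ 2 *
     weight a t).

End statistic.

Section test.
Context {R : realType} {d : nat} {disp : measure_display}
  {T : measurableType disp}.

(* The sample of size n consists of Xs 0, ..., Xs n.-1. *)
Definition U_sample (P : probability T R) (Xs : nat -> {RV P >-> 'cV[R]_d})
    (n : nat) (a : R) (w : T) : R :=
  U_stat a (fun j : 'I_n => Xs j w).

(* Left-continuous inverse of the distribution function of Q. *)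
Definition quantile (Q : set R -> \bar R) (p : R) : R :=
  inf [set y | (p%:E <= Q `]-oo, y]%classic)%E].

(* Meant for an i.i.d. sequence Zs with a nondegenerate normal distribution. By
   affine invariance of U_stat, the value does not depend on P0 and Zs then. *)
Definition critical_value (P0 : probability T R)
    (Zs : nat -> {RV P0 >-> 'cV[R]_d}) (n : nat) (a alpha : R) : R :=
  quantile (pushforward P0 (@U_sample P0 Zs n a)) (1 - alpha).

End test.

Arguments U_sample {R d disp T} P Xs n a w.
Arguments critical_value {R d disp T} P0 Zs n a alpha.

(* Main.v *)
Require Import Defs.
From HB Require Import structures.
From mathcomp Require Import all_boot all_order all_algebra finmap.
From mathcomp Require Import all_classical all_reals all_analysis.
From mathcomp Require Import complex.
From mathcomp Require Import measurable_realfun ring lra.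

Set Implicit Arguments.
Unset Strict Implicit.
Unset Printing Implicit Defensive.

Import Order.TTheory GRing.Theory Num.Theory.
Import numFieldNormedType.Exports.

Local Open Scope classical_set_scope.
Local Open Scope ring_scope.

(** By affine invariance X may be standardized to mean 0 and covariance I. Then
    U_n / n is the energy (the weighted L^2 norm) of the empirical mean of
    t |-> (|r_j|^2 + |t|^2 - d) exp(i t.r_j) over the scaled residuals r_j. As the
    sample mean and covariance converge, a law of large numbers in mean square,
    needing only fourth moments, makes this empirical mean converge in energy to
    t |-> E (|X|^2 + |t|^2 - d) exp(i t.X). The limit energy D vanishes for the
    standard normal law, so that c_n(alpha) <= n D / 8 eventually when D > 0.

    It remains to see that D = 0 forces X to be normal. If D = 0, then the
    characteristic function of X is almost everywhere annihilated by the harmonic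
    oscillator. Integrating it against Gaussians, the expectation F(k, u) of
    Mehler's kernel at X solves a linear first-order equation in u which depends
    neither on k nor on the law of X, while F(k, 1) is proportional to
    exp(- |k|^2 / 2). So F is the same as for the standard normal law up to a
    constant, and as u goes to infinity it recovers the law of X on orthants. *)

(** * Euclidean space and positive definite matrices *)

(** The residuals involve a matrix square root obtained by choice, from which neither measurability
    nor invariance can be read off. Expanding the energy into Gaussian integrals removes it: the
    statistic depends on the residuals only through their inner products, which are rational
    functions of the sample.

    No limit law under the hypothesis is needed. Since c_n only has to stay below a small multiple
    of n, one convergence statement serves both sides: applied to normal data it bounds c_n, applied
    to X it bounds U_n from below. From g^2 <= 2 f^2 + 2 (f - g)^2, an error D/4 leaves an energy of
    at least D/4, and D/8 is a smaller level kept for c_n.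

    The identity behind D = 0 is usually exploited spectrally: the tempered functions killed by the
    oscillator are the multiples of its ground state exp(- |t|^2 / 2). Testing it against Gaussians
    replaces this by scalar identities between expectations. In Mehler's kernel, completing the
    square in y leaves such a Gaussian, so each identity becomes an ordinary differential equation
    in u, whose solutions are compared with those of the normal law by taking a quotient. *)

Section euclidean.
Context {R : realType} {d : nat}.
Implicit Types (u v w x : 'cV[R]_d) (A B S : 'M[R]_d).

Lemma dotvE u v : dotv u v = \sum_i u i ord0 * v i ord0.
Proof. by rewrite /dotv mxE; apply: eq_bigr => i _; rewrite mxE. Qed.

Lemma dotvC u v : dotv u v = dotv v u.
Proof. by rewrite !dotvE; apply: eq_bigr => i _; rewrite mulrC. Qed.

Lemma dotvDl u v w : dotv (u + v) w = dotv u w + dotv v w.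
Proof. by rewrite /dotv linearD mulmxDl mxE. Qed.

Lemma dotvDr u v w : dotv w (u + v) = dotv w u + dotv w v.
Proof. by rewrite /dotv mulmxDr mxE. Qed.

Lemma dotvNl u v : dotv (- u) v = - dotv u v.
Proof. by rewrite /dotv linearN mulNmx mxE. Qed.

Lemma dotvNr u v : dotv u (- v) = - dotv u v.
Proof. by rewrite /dotv mulmxN mxE. Qed.

Lemma dotvBr u v w : dotv w (u - v) = dotv w u - dotv w v.
Proof. by rewrite dotvDr dotvNr. Qed.

Lemma dotvZl c u v : dotv (c *: u) v = c * dotv u v.
Proof. by rewrite /dotv linearZ -scalemxAl mxE. Qed.

Lemma dotvZr c u v : dotv u (c *: v) = c * dotv u v.
Proof. by rewrite /dotv -scalemxAr mxE. Qed.

Lemma dotv0l u : dotv 0 u = 0.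
Proof. by rewrite /dotv trmx0 mul0mx mxE. Qed.

Lemma dotv0r u : dotv u 0 = 0.
Proof. by rewrite /dotv mulmx0 mxE. Qed.

Definition dotvL := (dotvDl, dotvDr, dotvNl, dotvNr, dotvZl, dotvZr, dotv0l,
  dotv0r).

Lemma dotv_sumr n (F : 'I_n -> 'cV[R]_d) u :
  dotv u (\sum_j F j) = \sum_j dotv u (F j).
Proof. by elim/big_ind2: _ => [|? ? ? ? <- <-|//]; rewrite ?dotv0r ?dotvDr. Qed.

Lemma dotv_mulmx A u v : dotv (A *m u) v = dotv u (A^T *m v).
Proof. by rewrite /dotv trmx_mul mulmxA. Qed.

Lemma dotv_deltar u i : dotv u (delta_mx i ord0) = u i ord0.
Proof.
rewrite dotvE (bigD1 i)//= big1 ?addr0 ?mxE ?eqxx ?mulr1// => j ji.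
by rewrite mxE (negbTE ji) mulr0.
Qed.

Lemma dotv_deltal u i : dotv (delta_mx i ord0) u = u i ord0.
Proof. by rewrite dotvC dotv_deltar. Qed.

Lemma dotvv_ge0 u : 0 <= dotv u u.
Proof. by rewrite dotvE sumr_ge0// => i _; rewrite -expr2 sqr_ge0. Qed.

Lemma enorm_sqr u : enorm u ^+ 2 = dotv u u.
Proof.
rewrite sqr_sqrtr; last by apply: sumr_ge0 => i _; exact: sqr_ge0.
by rewrite dotvE; apply: eq_bigr => i _; rewrite expr2.
Qed.

Lemma enorm_ge0 u : 0 <= enorm u.
Proof. exact: sqrtr_ge0. Qed.

Lemma dotvv_eq0 u : dotv u u = 0 -> u = 0.
Proof.
move=> /eqP; rewrite dotvE psumr_eq0 => [/allP h|i _]; last first.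
  by rewrite -expr2 sqr_ge0.
apply/matrixP => i j; rewrite (ord1 j) mxE.
by have := h i (mem_index_enum _) => /=; rewrite mulf_eq0 orbb => /eqP.
Qed.

Lemma dotvv_gt0 u : u != 0 -> 0 < dotv u u.
Proof.
move=> u0; rewrite lt_neqAle dotvv_ge0 andbT eq_sym.
by apply: contra u0 => /eqP/dotvv_eq0 ->.
Qed.

Lemma dotv_cauchy_schwarz u v : `|dotv u v| <= enorm u * enorm v.
Proof.
rewrite -(@ler_pXn2r _ 2)// ?nnegrE ?mulr_ge0 ?enorm_ge0//.
rewrite real_normK ?num_real// exprMn !enorm_sqr.
have [->|v0] := eqVneq v 0; first by rewrite !dotvL expr0n mulr0.
have vv := dotvv_gt0 v0.
have := dotvv_ge0 (dotv v v *: u - dotv u v *: v).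
rewrite !dotvL (dotvC v u) => h.
have : 0 <= dotv v v * (dotv u u * dotv v v - dotv u v ^+ 2).
  apply: le_trans h _; rewrite le_eqVlt; apply/orP; left; apply/eqP; ring.
by rewrite pmulr_rge0// subr_ge0.
Qed.

Lemma enorm_dotv u v : dotv u v <= enorm u * enorm v.
Proof. exact: le_trans (ler_norm _) (dotv_cauchy_schwarz u v). Qed.

Lemma enorm_le u (c : R) : 0 <= c -> dotv u u <= c ^+ 2 -> enorm u <= c.
Proof.
by move=> c0; rewrite -enorm_sqr ler_pXn2r// ?nnegrE ?enorm_ge0.
Qed.

Lemma enormD u v : enorm (u + v) <= enorm u + enorm v.
Proof.
apply: enorm_le; first by rewrite addr_ge0 ?enorm_ge0.
rewrite !dotvL (dotvC v u) sqrrD !enorm_sqr.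
have := enorm_dotv u v; lra.
Qed.

Lemma enormN u : enorm (- u) = enorm u.
Proof.
by apply/eqP; rewrite -(@eqrXn2 _ 2)// ?enorm_ge0// !enorm_sqr !dotvL opprK.
Qed.

Lemma enormB u v : enorm (u - v) <= enorm u + enorm v.
Proof. by rewrite -[X in _ <= _ + X]enormN enormD. Qed.

Lemma enormZ c u : enorm (c *: u) = `|c| * enorm u.
Proof.
apply/eqP; rewrite -(@eqrXn2 _ 2)// ?enorm_ge0// ?mulr_ge0 ?enorm_ge0//.
by rewrite exprMn real_normK ?num_real// !enorm_sqr !dotvL mulrA expr2.
Qed.

Lemma normr_coord_le u i : `|u i ord0| <= enorm u.
Proof.
rewrite -dotv_deltar (le_trans (dotv_cauchy_schwarz _ _))// ler_piMr ?enorm_ge0//.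
by apply: enorm_le => //; rewrite dotv_deltar mxE !eqxx expr1n.
Qed.

Lemma enorm_le_sum u : enorm u <= \sum_i `|u i ord0|.
Proof.
apply: enorm_le; first exact: sumr_ge0.
rewrite dotvE expr2 mulr_suml; apply: ler_sum => i _.
rewrite (le_trans (ler_norm _))// normrM ler_wpM2l//.
by rewrite (bigD1 i)//= lerDl sumr_ge0.
Qed.

End euclidean.

(** * Positive definite matrices and their triangular factors *)

Section positive_definite.
Context {R : realType}.

Lemma posdefmx_unit d (S : 'M[R]_d) : posdefmx S -> S \in unitmx.
Proof.
case=> _ Spos; rewrite -unitmx_tr -row_free_unit -kermx_eq0.
apply/negPn/negP => /rowV0Pn[v /sub_kermxP vS v0].
have /Spos : v^T != 0 by rewrite -(inj_eq trmx_inj) trmxK trmx0.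
by rewrite -(trmxK (S *m v^T)) trmx_mul trmxK vS trmx0 dotv0r ltxx.
Qed.

Lemma posdefmx_inv d (S : 'M[R]_d) : posdefmx S -> posdefmx (invmx S).
Proof.
move=> Sp; have Su := posdefmx_unit Sp; have [St Spos] := Sp; split.
  by rewrite trmx_inv St.
move=> v v0; have : invmx S *m v != 0.
  by apply: contra v0 => /eqP Sv; rewrite -[v](mulKVmx Su) Sv mulmx0.
by move/Spos; rewrite mulKVmx// dotvC.
Qed.

(* [(Q + I)(Q - I) = Q^2 - I], and [Q + I] increases norms. *)
Lemma posdefmx_sqrt_near1 d (Q : 'M[R]_d) v : posdefmx Q ->
  enorm (Q *m v - v) <= enorm ((Q *m Q) *m v - v).
Proof.
move=> [Qt Qpos]; set z := Q *m v - v.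
have -> : (Q *m Q) *m v - v = Q *m z + z.
  by rewrite /z mulmxBr -mulmxA addrA subrK.
clearbody z; have Qz : 0 <= dotv z (Q *m z).
  by have [->|/Qpos/ltW//] := eqVneq z 0; rewrite dotv0l.
apply: enorm_le; first exact: enorm_ge0.
rewrite enorm_sqr !dotvL (dotvC (Q *m z) z).
have := dotvv_ge0 (Q *m z); lra.
Qed.

(** Induction on the dimension through the Schur complement of the top left entry. The triangular
    factor, rather than the symmetric root, is used for standardization because a triangular change
    of variables reduces to one coordinate at a time. *)
Lemma cholesky d (S : 'M[R]_d) : posdefmx S ->
  exists L : 'M[R]_d, [/\ is_trig_mx L, 0 < \det L & L *m L^T = S].
Proof.
elim: d S => [|d IH] S Spd.
  exists 0; rewrite det_mx00 ltr01; split=> //; last by rewrite !thinmx0.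
  by apply/is_trig_mxP => -[].
pose S' : 'M[R]_(1 + d) := S; rewrite -[S]/S'.
have {Spd} : posdefmx S' by [].
rewrite -[S']submxK; set s := ulsubmx S'; set b := ursubmx S'.
set b' := dlsubmx S'; set C := drsubmx S'; move=> [/= St Spos].
move: St; rewrite tr_block_mx => /eq_block_mx[_ b'E _ Ct].
have sE : s = (s ord0 ord0)%:M by exact: mx11_scalar.
set r := s ord0 ord0 in sE.
have r0 : 0 < r.
  have e0 : (col_mx (1%:M : 'cV[R]_1) (0 : 'cV[R]_d)) != 0 :> 'cV[R]_(1 + d).
    apply/eqP => /matrixP/(_ (lshift d ord0) ord0)/eqP.
    by rewrite col_mxEu !mxE eqxx oner_eq0.
  have := Spos _ e0; rewrite /dotv mul_block_col tr_col_mx mul_row_col.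
  by rewrite !mulmx0 !addr0 trmx0 mul0mx addr0 trmx1 mul1mx mulmx1.
set l := Num.sqrt r; have l0 : 0 < l by rewrite sqrtr_gt0.
have ll : l * l = r by rewrite -expr2 sqr_sqrtr// ltW.
pose v : 'cV[R]_d := l^-1 *: b'.
have CP : posdefmx (C - v *m v^T).
  split; first by rewrite linearB/= Ct trmx_mul trmxK.
  move=> x x0.
  (* This y cancels the first block of S (y, x), so that the quadratic form of S at (y, x) is that
     of the Schur complement at x. *)
  pose y : 'cV[R]_1 := (- r^-1) *: (b *m x).
  have z0 : col_mx y x != 0.
    apply: contra x0 => /eqP/(congr1 (@dsubmx _ 1 d 1)).
    by rewrite col_mxKd linear0 => ->.
  have := Spos _ z0; rewrite /dotv mul_block_col tr_col_mx mul_row_col.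
  have -> : s *m y + b *m x = 0.
    rewrite sE mul_scalar_mx /y scalerA mulrN divff ?gt_eqF//.
    by rewrite scaleN1r addNr.
  rewrite mulmx0 add0r; congr (0 < (_ *m _) _ _).
  rewrite mulmxBl addrC; congr (_ + _).
  rewrite /y -scalemxAr /v linearZ/= -scalemxAl -scalemxAr scalerA -invfM ll.
  by rewrite b'E -!scalemxAl scaleNr mulmxA.
have [L [Lt Ld LL]] := IH _ CP.
exists (block_mx l%:M 0 v L : 'M[R]_(1 + d)); split.
- apply: (etrans (@is_trig_block_mx R 1 d 1 d l%:M 0 v L erefl)).
  rewrite eqxx Lt andbT /=.
  by apply/is_trig_mxP => i j; rewrite !ord1 ltnn.
- by rewrite (@det_lblock _ 1 d) det_scalar1 mulr_gt0.
- rewrite (@tr_block_mx _ 1 d 1 d) (@mulmx_block _ 1 d 1 d 1 d) tr_scalar_mx !trmx0 !mulmx0 !mul0mx !addr0.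
  rewrite LL addrCA subrr addr0 -scalar_mxM ll -sE.
  rewrite mul_scalar_mx mul_mx_scalar /v linearZ/= !scalerA divff ?gt_eqF//.
  by rewrite !scale1r b'E.
Qed.

End positive_definite.

(** * Existence of the positive definite square root *)

Section positive_square_root.

(** Newton's scheme: a new node is corrected by a multiple of the polynomial that vanishes at the
    old ones. *)
Lemma poly_interpolation (F : fieldType) (s : seq F) (f : F -> F) :
  exists p : {poly F}, {in s, forall x, p.[x] = f x}.
Proof.
elim: s => [|x s [p pE]]; first by exists 0.
have [xs|xs] := boolP (x \in s).
  by exists p => y; rewrite inE => /orP[/eqP ->|]; exact: pE.
pose q := \prod_(z <- s) ('X - z%:P).
have qx : q.[x] != 0.
  by rewrite /q -[_ == 0]/(root _ _) root_prod_XsubC.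
exists (p + ((f x - p.[x]) / q.[x]) *: q) => y.
rewrite inE !hornerE => /orP[/eqP ->|ys]; first by rewrite divfK// addrC subrK.
have /eqP -> : q.[y] == 0 by rewrite -[_ == 0]/(root _ _) root_prod_XsubC.
by rewrite mulr0 addr0 pE.
Qed.

Local Notation C := (real_complex _).

Lemma map_Re_mulmx (R : rcfType) m n p (v : 'M[R[i]]_(m, n)) (S : 'M[R]_(n, p)) :
  map_mx (@complex.Re R) (v *m map_mx C S) = map_mx (@complex.Re R) v *m S.
Proof.
apply/matrixP => i j; rewrite !mxE raddf_sum; apply: eq_bigr => k _.
by rewrite !mxE; case: (v i k) => a b /=; rewrite mulr0 subr0.
Qed.

Lemma map_Im_mulmx (R : rcfType) m n p (v : 'M[R[i]]_(m, n)) (S : 'M[R]_(n, p)) :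
  map_mx (@complex.Im R) (v *m map_mx C S) = map_mx (@complex.Im R) v *m S.
Proof.
apply/matrixP => i j; rewrite !mxE raddf_sum; apply: eq_bigr => k _.
by rewrite !mxE; case: (v i k) => a b /=; rewrite mulr0 add0r mulrC.
Qed.

Lemma trmx_horner_mx (R : comNzRingType) n (A : 'M[R]_n.+1) (p : {poly R}) :
  (horner_mx A p)^T = horner_mx A^T p.
Proof.
elim/poly_ind: p => [|p c IH]; first by rewrite !rmorph0 trmx0.
rewrite !rmorphD !rmorphM /= !horner_mx_X !horner_mx_C linearD /= tr_scalar_mx.
by rewrite -mulmxE trmx_mul IH; congr (_ + _); exact/esym/comm_horner_mx.
Qed.

(* The fourth root of S is a real polynomial in S interpolating the fourth root
   at the eigenvalues, hence it is real and symmetric; its square is the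
   positive definite square root. *)
Lemma posdefmx_sqrt (R : realType) d (S : 'M[R]_d) : posdefmx S ->
  exists2 B : 'M[R]_d, posdefmx B & B *m B = S.
Proof.
case: d S => [|n] S Spd.
  exists 0; last by apply/matrixP => -[].
  by split=> [|v]; [apply/matrixP => -[]|rewrite [v]flatmx0 eqxx].
have [St Spos] := Spd.
pose SC := map_mx C S.
have SCh : SC \is hermsymmx.
  apply: realsym_hermsym.
    apply/is_hermitianmxP; rewrite expr0 scale1r map_mx_id//.
    by rewrite /SC map_trmx St.
  apply/mxOverP => i j; rewrite mxE; apply/CrealP.
  by rewrite /= /Num.conj/= oppr0.
set D := spectral_diag SC; set P := spectralmx SC.
have SCE : SC = invmx P *m diag_mx D *m P.
  exact/orthomx_spectralP/hermitian_normalmx.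
have Pu : P \in unitmx by exact: spectral_unit.
pose x i := complex.Re (D ord0 i).
have DE i : D ord0 i = C (x i).
  have /mxOverP/(_ ord0 i) := hermitian_spectral_diag_real SCh.
  rewrite -/D /x realE !lecE /=; case: (D ord0 i) => a b /=.
  by case/orP => /andP[/eqP bE _]; [rewrite bE|rewrite -bE].
have x_gt0 i : 0 < x i.
  have rowE : row i P *m SC = C (x i) *: row i P.
    rewrite SCE mulmxA mulmxA -row_mul mulmxV// -row_mul mul1mx.
    by rewrite row_diag_mx -scalemxAl -rowE DE.
  have real_eigen (w : 'rV[R]_n.+1) : w *m S = x i *: w -> w != 0 -> 0 < x i.
    move=> wS w0; have wT0 : w^T != 0 by rewrite -(inj_eq trmx_inj) trmxK trmx0.
    have := Spos _ wT0; rewrite -{1}(trmxK S) -trmx_mul St wS linearZ dotvZr.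
    by rewrite pmulr_lgt0// dotvv_gt0.
  (* The rows of P are complex. Their real and imaginary parts are eigenvectors of S for the same
     real eigenvalue, and they cannot both vanish since P is invertible; so positivity of S can be
     applied to one of them. *)
  have ReS : map_mx (@complex.Re R) (row i P) *m S =
      x i *: map_mx (@complex.Re R) (row i P).
    rewrite -map_Re_mulmx rowE; apply/matrixP => a b; rewrite !mxE.
    by case: (P i b) => ? ? /=; rewrite mul0r subr0.
  have ImS : map_mx (@complex.Im R) (row i P) *m S =
      x i *: map_mx (@complex.Im R) (row i P).
    rewrite -map_Im_mulmx rowE; apply/matrixP => a b; rewrite !mxE.
    by case: (P i b) => ? ? /=; rewrite mul0r addr0.
  have [Re0|/(real_eigen _ ReS)//] := eqVneq (map_mx (@complex.Re R) (row i P)) 0.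
  have [Im0|/(real_eigen _ ImS)//] := eqVneq (map_mx (@complex.Im R) (row i P)) 0.
  have row0 : row i P = 0.
    apply/matrixP => a b.
    move/matrixP : Re0 => /(_ a b); move/matrixP : Im0 => /(_ a b).
    by rewrite !mxE; case: (P i b) => ? ? /= -> ->.
  have /matrixP/(_ ord0 i) : row i P *m invmx P = delta_mx ord0 i.
    by rewrite -row_mul mulmxV// row1.
  by rewrite row0 mul0mx !mxE !eqxx => /eqP; rewrite eq_sym oner_eq0.
have [r rE] := poly_interpolation [seq x i | i <- enum 'I_n.+1]
  (fun y => Num.sqrt (Num.sqrt y)).
have rx i : r.[x i] ^+ 4 = x i.
  rewrite rE; last by apply: map_f; rewrite mem_enum.
  rewrite (exprM _ 2 2) sqr_sqrtr ?sqrtr_ge0// sqr_sqrtr// ltW//.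
pose Q := horner_mx S r.
have Q4 : Q ^+ 4 = S.
  suff : map_mx C (Q ^+ 4) = SC.
    move=> h; apply/matrixP => i j; move/matrixP : h => /(_ i j).
    by rewrite !mxE => -[].
  rewrite /Q -rmorphXn /= map_horner_mx -/SC SCE.
  rewrite horner_mx_uconjC; last exact: Pu.
  apply: (congr1 (fun M => invmx P *m M *m P)).
  rewrite horner_mx_diag; apply: (congr1 diag_mx); apply/matrixP => i j.
  rewrite (ord1 i) !mxE DE horner_map/=; congr C.
  by rewrite horner_exp rx.
exists (Q *m Q); last first.
  by rewrite -[RHS]Q4 exprSr !exprS expr0 mulr1 -!mulmxE !mulmxA.
have Qt : Q^T = Q.
  by rewrite trmx_horner_mx St.
split; first by rewrite trmx_mul Qt.
move=> v v0; rewrite -mulmxA -{1}Qt -dotv_mulmx dotvv_gt0//.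
apply: contra v0 => /eqP Qv; move: (posdefmx_unit Spd) => Su.
rewrite -[v](mulKmx Su) -{2}Q4 exprSr -mulmxE -mulmxA Qv !mulmx0//.
Qed.

End positive_square_root.

(** * Integration with respect to the Lebesgue measure on column vectors *)

Section measurable_vector.
Context {R : realType} {d : nat}.

Lemma measurable_coord (i : 'I_d) :
  measurable_fun setT (fun v : 'cV[R]_d => v i ord0).
Proof. exact: measurable_entry. Qed.

Context {disp : measure_display} {T : measurableType disp}.
Implicit Types (f g : T -> 'cV[R]_d).

Lemma measurable_fun_coord f i : measurable_fun setT f ->
  measurable_fun setT (fun w => f w i ord0).
Proof.
by move=> mf; apply: (measurableT_comp (f := fun v : 'cV[R]_d => v i ord0)) => //;
  exact: measurable_coord.
Qed.

Lemma measurable_fun_dotv f g : measurable_fun setT f ->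
  measurable_fun setT g -> measurable_fun setT (fun w => dotv (f w) (g w)).
Proof.
move=> mf mg; under eq_fun do rewrite dotvE.
apply: measurable_sum => i.
by apply: measurable_funM; exact: measurable_fun_coord.
Qed.

Lemma measurable_fun_cV f :
  (forall i, measurable_fun setT (fun w => f w i ord0)) ->
  measurable_fun setT f.
Proof. by move=> mf; apply: measurable_fun_mx => i j; rewrite (ord1 j). Qed.

Lemma measurable_fun_addv f g : measurable_fun setT f ->
  measurable_fun setT g -> measurable_fun setT (fun w => f w + g w).
Proof.
move=> mf mg; apply: measurable_fun_cV => i; under eq_fun do rewrite mxE.
by apply: measurable_funD; exact: measurable_fun_coord.
Qed.

Lemma measurable_fun_scalev (k : T -> R) f : measurable_fun setT k ->
  measurable_fun setT f -> measurable_fun setT (fun w => k w *: f w).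
Proof.
move=> mk mf; apply: measurable_fun_cV => i; under eq_fun do rewrite mxE.
by apply: measurable_funM => //; exact: measurable_fun_coord.
Qed.

Lemma measurable_fun_subv f g : measurable_fun setT f ->
  measurable_fun setT g -> measurable_fun setT (fun w => f w - g w).
Proof.
move=> mf mg; apply: measurable_fun_addv => //.
under eq_fun do rewrite -scaleN1r.
exact: measurable_fun_scalev.
Qed.

Lemma measurable_fun_enorm f : measurable_fun setT f ->
  measurable_fun setT (fun w => enorm (f w)).
Proof.
move=> mf; rewrite /enorm.
apply: (measurableT_comp (f := @Num.sqrt R)) => //.
  by apply: continuous_measurable_fun; exact: sqrt_continuous.
apply: measurable_sum => i; apply: measurable_funX.
exact: measurable_fun_coord.
Qed.

End measurable_vector.

Lemma measurable_fun_mulmxv {R : realType} d k (A : 'M[R]_(k, d))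
    {disp : measure_display} {T : measurableType disp} (f : T -> 'cV[R]_d) :
  measurable_fun setT f -> measurable_fun setT (fun w => A *m f w).
Proof.
move=> mf; apply: measurable_fun_cV => i; under eq_fun do rewrite mxE.
apply: measurable_sum => j; apply: measurable_funM => //.
exact: measurable_fun_coord.
Qed.

Definition pushforward_measure {d d'} {T1 : measurableType d}
    {T2 : measurableType d'} {R : realType} (m : {measure set T1 -> \bar R})
    (f : T1 -> T2) (mf : measurable_fun setT f) :
  {measure set T2 -> \bar R}.
Proof. by refine [the measure _ _ of pushforward m f]; exact: mf. Defined.

(** * Affine changes of variables on the line *)

Section change_of_variables.
Context {R : realType}.
Local Notation mu := (@lebesgue_measure R).
Local Open Scope ereal_scope.

Lemma measurable_affine (l c : R) :
  measurable_fun setT (fun x : measurableTypeR R => (l * x + c)%R : measurableTypeR R).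
Proof. by apply: measurable_funD => //; apply: measurable_funM. Qed.

(** Both sides are measures in A that agree on the intervals []a, b]]. For negative l the preimage
    is half-open on the other side, with the same length. *)
Lemma lebesgue_measure_affine (l c : R) (A : set R) : (l != 0)%R ->
  measurable A ->
  mu A = `|l|%:E * mu ((fun x => l * x + c)%R @^-1` A).
Proof.
move=> l0 mA.
pose phi := fun x : measurableTypeR R => (l * x + c)%R : measurableTypeR R.
have mphi : measurable_fun setT phi by exact: measurable_affine.
rewrite -[RHS]/(mscale (NngNum (normr_ge0 l)) (pushforward_measure mu mphi) A).
apply: lebesgue_measure_unique => // _ [[a b]] _ <-.
change (mu `]a, b]%classic = `|l|%:E * mu (phi @^-1` `]a, b]%classic)).
have [l_lt0|l_gt0|l0'] := ltgtP l 0%R; last first.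
- by rewrite l0' eqxx in l0.
- rewrite (_ : phi @^-1` _ = `]((a - c) / l)%R, ((b - c) / l)%R]%classic); last first.
    apply/seteqP; split => x /=; rewrite !in_itv/= ltr_pdivrMr// ler_pdivlMr//;
      by rewrite ltrBlDr lerBrDr mulrC.
  rewrite !lebesgue_measure_itv/= !lte_fin ltr_pM2r ?invr_gt0// ltrD2r.
  case: ifP => ab; last by rewrite mule0.
  by rewrite -!EFinB -EFinM gtr0_norm//; congr EFin; field; rewrite gt_eqF.
- rewrite (_ : phi @^-1` _ = `[((b - c) / l)%R, ((a - c) / l)%R[%classic); last first.
    apply/seteqP; split => x /=; rewrite !in_itv/= ltr_ndivlMr// ler_ndivrMr//;
      by rewrite ltrBlDr lerBrDr (mulrC x) andbC.
  rewrite !lebesgue_measure_itv/= !lte_fin ltr_nM2r ?invr_lt0// ltrD2r.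
  case: ifP => ab; last by rewrite mule0.
  by rewrite -!EFinB -EFinM ltr0_norm//; congr EFin; field; rewrite lt_eqF.
Qed.

Lemma ge0_integral_affine (l c : R) (f : R -> \bar R) : (l != 0)%R ->
  measurable_fun setT f -> (forall x, 0 <= f x) ->
  \int[mu]_x f x = `|l|%:E * \int[mu]_x f (l * x + c)%R.
Proof.
move=> l0 mf f0.
pose phi := fun x : measurableTypeR R => (l * x + c)%R : measurableTypeR R.
have mphi : measurable_fun setT phi by exact: measurable_affine.
transitivity (\int[mscale (NngNum (normr_ge0 l)) (pushforward_measure mu mphi)]_x f x).
  by apply: eq_measure_integral => A mA _; exact: lebesgue_measure_affine.
rewrite ge0_integral_mscale//=.
by rewrite ge0_integral_pushforward//= => y _.
Qed.

End change_of_variables.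

(** * Tonelli's theorem and triangular changes of variables on column vectors *)

Section lebesgue_cV_change_of_variables.
Context {R : realType}.
Local Notation mu := (@lebesgue_measure R).
Local Notation lambda := (@lebesgue_cV R).
Local Open Scope ereal_scope.

Lemma ge0_integral_cVS d (f : 'cV[R]_d.+1 -> \bar R) :
  measurable_fun setT f -> (forall x, 0 <= f x) ->
  \int[@lambda d.+1]_x f x = \int[mu]_x \int[@lambda d]_v f (cV_cons (x, v)).
Proof.
move=> mf f0.
rewrite -[RHS]/(\int[mu]_x fubini_F (@lambda d) (f \o @cV_cons R d) x).
rewrite -fubini_tonelli1//=; last first.
  by apply: measurableT_comp => //; exact: measurable_cV_cons.
transitivity (\int[pushforward (mu \x @lambda d) (@cV_cons R d)]_x f x) => //.
by rewrite ge0_integral_pushforward//; exact: measurable_cV_cons.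
Qed.

Lemma integral_cV0 (f : 'cV[R]_0 -> \bar R) :
  measurable_fun setT f -> \int[@lambda 0]_x f x = f 0%R.
Proof.
move=> mf; transitivity (\int[\d_(0%R : 'cV[R]_0)]_x f x) => //.
by rewrite integral_dirac// diracT mul1e.
Qed.

(** Once the first coordinate x is fixed, the others undergo the affine map with matrix B and shift
    [x *: v + dsubmx c']. Since this shift depends on x, the induction hypothesis is needed for all
    shifts. *)
Lemma ge0_integral_trig_mx d (A : 'M[R]_d) (c : 'cV[R]_d)
    (f : 'cV[R]_d -> \bar R) :
  is_trig_mx A -> (\det A != 0)%R ->
  measurable_fun setT f -> (forall x, 0 <= f x) ->
  \int[@lambda d]_x f x = `|\det A|%:E * \int[@lambda d]_x f (A *m x + c)%R.
Proof.
elim: d A c f => [|d IH] A c f Atrig Adet mf f0.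
  rewrite det_mx00 normr1 mul1e; apply: eq_integral => x _; congr f.
  by apply/matrixP => -[].
have mA e (B : 'M[R]_e) b : measurable_fun setT (fun x : 'cV[R]_e => (B *m x + b)%R).
  by apply: measurable_fun_addv => //; apply: measurable_fun_mulmxv.
pose A' : 'M[R]_(1 + d) := A; pose c' : 'cV[R]_(1 + d) := c.
set a := ulsubmx A' ord0 ord0; set v := dlsubmx A'; set B := drsubmx A'.
have aE : ulsubmx A' = a%:M by exact: mx11_scalar.
have /and4P[_ /eqP urE _ Btrig] : [&& (ursubmx A' == 0)%R, (ursubmx A' == 0)%R,
    is_trig_mx (ulsubmx A') & is_trig_mx B].
  have : is_trig_mx A' by [].
  by rewrite -[A' in is_trig_mx A']submxK is_trig_block_mx// => /and3P[-> -> ->].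
have AE : A' = block_mx a%:M 0 v B by rewrite -[LHS]submxK urE aE.
have detE : (\det A = a * \det B)%R.
  by rewrite -[A]/A' AE (@det_lblock _ 1 d) det_scalar1.
have [a0 detB] : (a != 0)%R /\ (\det B != 0)%R.
  by apply/andP; rewrite -negb_or -mulf_eq0 -detE.
have cE : c' = col_mx (usubmx c') (dsubmx c') by rewrite vsubmxK.
pose c0 := usubmx c' ord0 ord0.
rewrite ge0_integral_cVS// ge0_integral_cVS//; last first.
  by apply: (measurableT_comp mf); exact: mA.
pose g x := \int[@lambda d]_u f (cV_cons (x, u)).
have mg : measurable_fun setT g.
  apply: (@measurable_fun_fubini_tonelli_F _ _ _ _ _ (@lambda d)
    (f \o @cV_cons R d)) => [|x]; last exact: f0.
  by apply: measurableT_comp => //; exact: measurable_cV_cons.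
have g0 x : 0 <= g x by exact: integral_ge0.
rewrite -[LHS]/(\int[mu]_x g x) (ge0_integral_affine c0 a0)//.
rewrite detE normrM EFinM -muleA; congr (_ * _).
have mga : measurable_fun setT (fun x : R => g (a * x + c0)%R).
  by apply: (measurableT_comp mg); exact: measurable_affine.
pose h (x : R) u := f (A *m cV_cons (x, u) + c)%R.
have hE x u : h x u = f (cV_cons (a * x + c0, B *m u + (x *: v + dsubmx c')))%R.
  have key : (A' *m col_mx (x%:M : 'cV_1) u + c' =
      col_mx ((a * x + c0)%:M : 'cV_1) (B *m u + (x *: v + dsubmx c')))%R.
    rewrite AE cE mul_block_col add_col_mx col_mxKd; congr col_mx.
      rewrite mul0mx addr0 -scalar_mxM [usubmx c']mx11_scalar -/c0.
      by rewrite raddfD.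
    by rewrite mul_mx_scalar addrCA addrA.
  by rewrite /h; congr f; exact: key.
transitivity (\int[mu]_x (`|\det B|%:E * \int[@lambda d]_u h x u)).
  apply: eq_integral => x _; rewrite /g (IH B (x *: v + dsubmx c'))%R//.
    by congr (_ * _); apply: eq_integral => u _; rewrite hE.
  apply: (measurableT_comp mf).
  apply: (measurableT_comp (@measurable_cV_cons R d)).
  by apply: (@measurable_fun_pair _ _ _ _ _ _ (cst (a * x + c0)%R) id).
rewrite ge0_integralZl//.
- apply: (@measurable_fun_fubini_tonelli_F _ _ _ _ _ (@lambda d)
    (fun p => h p.1 p.2)) => [|x]; last exact: f0.
  apply: (measurableT_comp mf); apply: (measurableT_comp (mA _ _ _)).
  rewrite [X in measurable_fun _ X](_ : _ = @cV_cons R d).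
    exact: measurable_cV_cons.
  by apply/funext => -[].
- by move=> x _; apply: integral_ge0 => u _; exact: f0.
Qed.

(** The function may change sign and need not be integrable: its integral is formed from the
    positive and negative parts, and each is translated separately. *)
Lemma integral_cV_translation d (c : 'cV[R]_d) (f : 'cV[R]_d -> \bar R) :
  measurable_fun setT f ->
  \int[@lambda d]_x f (x + c)%R = \int[@lambda d]_x f x.
Proof.
move=> mf.
have tr (g : 'cV[R]_d -> \bar R) : measurable_fun setT g -> (forall x, 0 <= g x) ->
    \int[@lambda d]_x g (x + c)%R = \int[@lambda d]_x g x.
  move=> mg g0; rewrite [RHS](@ge0_integral_trig_mx _ 1%:M c)//.
  - rewrite det1 normr1 mul1e; apply: eq_integral => x _.
    by rewrite mul1mx.
  - by rewrite det1 oner_eq0.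
rewrite integralE [RHS]integralE -(tr f^\+)//; last exact: measurable_funepos.
rewrite -(tr f^\-)//; last exact: measurable_funeneg.
by congr (_ - _); apply: eq_integral => x _; rewrite (funepos_comp, funeneg_comp).
Qed.

Lemma ge0_integral_cV_scale d (l : R) (c : 'cV[R]_d) (f : 'cV[R]_d -> \bar R) :
  (0 < l)%R -> measurable_fun setT f -> (forall x, 0 <= f x) ->
  \int[@lambda d]_x f x =
    (l ^+ d)%:E * \int[@lambda d]_x f (c + l *: x)%R.
Proof.
move=> l0 mf f0; rewrite (@ge0_integral_trig_mx _ l%:M c)//.
- rewrite det_scalar ger0_norm ?exprn_ge0 ?ltW//; congr (_ * _).
  by apply: eq_integral => x _; rewrite mul_scalar_mx addrC.
- by rewrite det_scalar expf_neq0// gt_eqF.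
Qed.

End lebesgue_cV_change_of_variables.

(** * Gaussian integrals *)

Section real_derivatives.
Context {R : realType}.
Implicit Types (f g : R -> R) (x a b c : R).

Lemma rderiv_cst x c : is_derive x 1 (fun _ : R => c) 0.
Proof. exact: is_derive_cst. Qed.

Lemma rderiv_id x : is_derive x 1 (fun y : R => y) 1.
Proof. exact: is_derive_id. Qed.

Lemma rderivD f g x a b : is_derive x 1 f a -> is_derive x 1 g b ->
  is_derive x 1 (fun y => f y + g y) (a + b).
Proof. by move=> df dg; exact: is_deriveD. Qed.

Lemma rderivN f x a : is_derive x 1 f a -> is_derive x 1 (fun y => - f y) (- a).
Proof. by move=> df; exact: is_deriveN. Qed.

Lemma rderivB f g x a b : is_derive x 1 f a -> is_derive x 1 g b ->
  is_derive x 1 (fun y => f y - g y) (a - b).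
Proof. by move=> df dg; apply: rderivD => //; exact: rderivN. Qed.

Lemma rderivM f g x a b : is_derive x 1 f a -> is_derive x 1 g b ->
  is_derive x 1 (fun y => f y * g y) (f x * b + a * g x).
Proof.
by move=> df dg; apply: is_derive_eq; rewrite /GRing.scale/= [X in _ + X]mulrC.
Qed.

Lemma rderivZ f x c a : is_derive x 1 f a -> is_derive x 1 (fun y => c * f y) (c * a).
Proof.
by move=> df; have := rderivM (rderiv_cst x c) df; rewrite mul0r addr0.
Qed.

Lemma rderiv_expR f x a : is_derive x 1 f a ->
  is_derive x 1 (fun y => expR (f y)) (expR (f x) * a).
Proof. by move=> df; exact: is_derive1_comp. Qed.

Lemma rderiv_cos f x a : is_derive x 1 f a ->
  is_derive x 1 (fun y => cos (f y)) (- sin (f x) * a).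
Proof. by move=> df; exact: is_derive1_comp. Qed.

Lemma rderiv_sin f x a : is_derive x 1 f a ->
  is_derive x 1 (fun y => sin (f y)) (cos (f x) * a).
Proof. by move=> df; exact: is_derive1_comp. Qed.

Lemma rderiv_inv f x a : f x != 0 -> is_derive x 1 f a ->
  is_derive x 1 (fun y => (f y)^-1) (- (f x) ^- 2 * a).
Proof. by move=> fx df; exact: (is_deriveV fx). Qed.

Lemma rderiv_affine x a b : is_derive x 1 (fun y => a + y * b) b.
Proof.
have h := rderivD (rderiv_cst x a) (rderivM (rderiv_id x) (rderiv_cst x b)).
by apply: (is_derive_eq h); ring.
Qed.

Lemma rderiv_shift f x h a : is_derive (0 : R) 1 (fun y => f (x + y + h)) a ->
  is_derive x 1 (fun y => f (y + h)) a.
Proof.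
move=> df; have -> : (fun y => f (y + h)) = (fun y => f (x + y + h)) \o (fun y => y - x).
  by apply/funext => y /=; rewrite (addrC x) subrK.
have dg := rderivB (rderiv_id x) (rderiv_cst x x).
have df' : is_derive (x - x) 1 (fun y => f (x + y + h)) a by rewrite subrr.
have := @is_derive1_comp R (fun y => f (x + y + h)) (fun y => y - x) x _ _ df' dg.
by rewrite subr0 mulr1.
Qed.

Lemma rderiv0_constant f (u v : R) : u <= v -> {within `[u, v], continuous f} ->
  (forall x, x \in `]u, v[ -> is_derive x 1 f 0) -> f u = f v.
Proof.
rewrite le_eqVlt => /orP[/eqP -> //|uv] cf df.
have [c _] := @MVT _ f (cst 0) _ _ uv df cf.
by rewrite mul0r => /eqP; rewrite subr_eq0 => /eqP.
Qed.

End real_derivatives.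

Lemma is_derive_under_Rintegral {R : realType} {d} {Y : measurableType d}
    (mu : {measure set Y -> \bar R}) (f f' : R -> Y -> R) (a u v : R) (G : Y -> R) :
  a \in `]u, v[ ->
  (forall x, x \in `]u, v[ -> mu.-integrable setT (EFin \o f x)) ->
  (forall x y, x \in `]u, v[ -> is_derive x 1 (f ^~ y) (f' x y)) ->
  mu.-integrable setT (EFin \o G) ->
  (forall x y, x \in `]u, v[ -> `|f' x y| <= G y) ->
  is_derive a 1 (fun x => \int[mu]_y f x y) (\int[mu]_y f' a y).
Proof.
move=> auv intf df intG Gub.
have G0 y : 0 <= G y by exact: le_trans (Gub a y auv).
have fE x y : x \in `]u, v[ -> partial1of2 f x y = f' x y.
  by move=> xuv; rewrite partial1of2E; have [_ ->] := df x y xuv.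
apply: DeriveDef.
  apply: (@derivable_under_integral _ _ _ mu f setT measurableT a u v _ _ _ G) => //.
  - by move=> x y xuv _; have [] := df x y xuv.
  - by move=> x y xuv _; rewrite fE// Gub.
rewrite -derive1E.
rewrite (@differentiation_under_integral _ _ _ mu f setT measurableT a u v _ _ _ G) => //.
- by apply: eq_Rintegral => y _; rewrite fE.
- by move=> x y xuv _; have [] := df x y xuv.
- by move=> x y xuv _; rewrite fE// Gub.
Qed.

(** * The Gaussian weight and its integrability *)

Section gaussian_weight.
Context {R : realType}.
Local Notation lambda d := (@lebesgue_cV R d).

Definition gauss {d} (b : R) (t : 'cV[R]_d) : R := expR (- (b * dotv t t)).

Lemma gauss_gt0 d b (t : 'cV[R]_d) : 0 < gauss b t.
Proof. exact: expR_gt0. Qed.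

Lemma weightE d a (t : 'cV[R]_d) : weight a t = gauss a t.
Proof. by rewrite /weight enorm_sqr. Qed.

Lemma measurable_dotvv d : measurable_fun setT (fun t : 'cV[R]_d => dotv t t).
Proof. exact: measurable_fun_dotv. Qed.

Lemma measurable_gauss d b : measurable_fun setT (@gauss d b).
Proof.
apply: measurableT_comp => //; apply: measurable_funN; apply: measurable_funM => //.
exact: measurable_dotvv.
Qed.

(** The weight is a product over the coordinates, so finiteness follows by induction on d. The
    factor for one coordinate is the Gaussian function of the line rescaled by the square root of
    b. *)
Lemma integrable_gauss d (b : R) : 0 < b ->
  (lambda d).-integrable setT (EFin \o gauss b).
Proof.
move=> b0; apply/integrableP; split.
  by apply/measurable_EFinP; exact: measurable_gauss.
rewrite [ltLHS](_ : _ = \int[lambda d]_t (gauss b t)%:E)%E; last first.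
  by apply: eq_integral => t _; rewrite /= ger0_norm// ltW// gauss_gt0.
elim: d => [|d IH].
  rewrite integral_cV0 ?ltry//.
  by apply/measurable_EFinP; exact: measurable_gauss.
rewrite ge0_integral_cVS; last 2 first.
- by apply/measurable_EFinP; exact: measurable_gauss.
- by move=> x; rewrite lee_fin ltW// gauss_gt0.
have gE x (v : 'cV[R]_d) : gauss b (cV_cons (x, v)) = expR (- (b * x ^+ 2)) * gauss b v.
  rewrite /gauss -expRD; congr expR.
  rewrite {1}/dotv /cV_cons /= (tr_col_mx (x%:M : 'cV_1) v) (@mul_row_col _ 1 1 d 1) mxE.
  by rewrite -[X in _ + X]/(dotv v v) tr_scalar_mx -scalar_mxM mxE eqxx mulr1n; ring.
set I := (\int[lambda d]_t (gauss b t)%:E)%E in IH *.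
rewrite [ltLHS](_ : _ = \int[lebesgue_measure]_x
    (I * (expR (- (b * x ^+ 2)))%:E))%E; last first.
  apply: eq_integral => x _; under eq_integral do rewrite gE EFinM.
  rewrite ge0_integralZl//; first by rewrite muleC.
  - by apply/measurable_EFinP; exact: measurable_gauss.
  - by move=> t _; rewrite lee_fin ltW// gauss_gt0.
have I0 : (0 <= I)%E by apply: integral_ge0 => t _; rewrite lee_fin ltW// gauss_gt0.
have mE : measurable_fun setT (fun x : R => expR (- (b * x ^+ 2))).
  apply: measurableT_comp => //; apply: measurable_funN; apply: measurable_funM => //.
rewrite ge0_integralZl//; last exact/measurable_EFinP.
apply: lte_mul_pinfty => //; first by rewrite ge0_fin_numE.
have s0 : Num.sqrt b != 0 by rewrite gt_eqF// sqrtr_gt0.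
have := @integrableT_gauss R; move=> /integrableP[mg].
rewrite (ge0_integral_affine 0 s0); last 2 first.
- exact: measurableT_comp.
- by move=> x; exact: abse_ge0.
rewrite (_ : \int[_]_x _ = \int[lebesgue_measure]_x (expR (- (b * x ^+ 2)))%:E)%E; last first.
  apply: eq_integral => x _; rewrite /= /gauss_fun ger0_norm ?expR_ge0//.
  by rewrite addr0 exprMn sqr_sqrtr// ltW.
move=> h; rewrite ltNge leye_eq; apply/negP => /eqP hy.
by move: h; rewrite hy gt0_muley// lte_fin normr_gt0.
Qed.

(** First (1 + r)^k <= 2^k (1 + r^2)^(k+1), then x^(k+1) / (k+1)! <= exp x at x = b (1 + r^2). The
    factor exp b comes from the 1 in 1 + r^2. *)
Lemma poly_le_expR (k : nat) (b : R) : 0 < b ->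
  exists2 C : R, 0 <= C & forall r, 0 <= r -> (1 + r) ^+ k <= C * expR (b * r ^+ 2).
Proof.
move=> b0; exists (2 ^+ k * (k.+1)`!%:R * expR b / b ^+ k.+1).
  by rewrite divr_ge0 ?mulr_ge0 ?exprn_ge0 ?expR_ge0 ?ltW.
move=> r r0.
have h1 : (1 + r) ^+ k <= 2 ^+ k * (1 + r ^+ 2) ^+ k.+1.
  apply: (@le_trans _ _ ((2 * (1 + r ^+ 2)) ^+ k)).
    apply: lerXn2r; rewrite ?nnegrE ?addr_ge0 ?mulr_ge0 ?addr_ge0 ?sqr_ge0//.
    by have := sqr_ge0 (r - 1); nra.
  rewrite exprMn ler_wpM2l ?exprn_ge0//; apply: ler_weXn2l => //.
  by rewrite lerDl sqr_ge0.
have h2 : (b * (1 + r ^+ 2)) ^+ k.+1 / (k.+1)`!%:R <= expR (b * (1 + r ^+ 2)).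
  apply: le_trans (expR_ge1Dxn k _); first by rewrite lerDr ler01.
  by rewrite mulr_ge0 ?addr_ge0 ?sqr_ge0// ltW.
rewrite ler_pdivrMr ?ltr0n ?fact_gt0// exprMn mulrDr mulr1 expRD in h2.
apply: (le_trans h1).
rewrite -!mulrA ler_pM2l ?exprn_gt0//.
have bk : 0 < b ^+ k.+1 by rewrite exprn_gt0.
rewrite -(ler_pM2l bk); apply: (le_trans h2).
rewrite le_eqVlt; apply/orP; left; apply/eqP; field.
by rewrite gt_eqF.
Qed.

Lemma integrable_dominated d (f : 'cV[R]_d -> R) (C b : R) (k : nat) :
  0 < b -> measurable_fun setT f ->
  (forall t, `|f t| <= C * (1 + enorm t) ^+ k * gauss b t) ->
  (lambda d).-integrable setT (EFin \o f).
Proof.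
move=> b0 mf fC.
(* Half of the Gaussian absorbs the polynomial; the other half is the integrable majorant. *)
have [K K0 hK] := @poly_le_expR k (b / 2) (divr_gt0 b0 (ltr0Sn _ 1)).
have := integrable_gauss d (divr_gt0 b0 (ltr0Sn R 1)).
move/(integrableZl measurableT (`|C| * K)); apply: le_integrable => //.
  exact/measurable_EFinP.
move=> t _ /=; rewrite lee_fin; apply: (le_trans (fC t)).
apply: le_trans (ler_norm _); rewrite /gauss.
apply: (@le_trans _ _ (`|C| * (1 + enorm t) ^+ k * expR (- (b * dotv t t)))).
  rewrite ler_wpM2r ?expR_ge0// ler_wpM2r ?exprn_ge0 ?addr_ge0 ?enorm_ge0//.
  exact: ler_norm.
rewrite -!mulrA ler_wpM2l//.
apply: (@le_trans _ _ (K * expR (b / 2 * enorm t ^+ 2) * expR (- (b * dotv t t)))).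
  by rewrite ler_wpM2r ?expR_ge0// hK// enorm_ge0.
rewrite -mulrA ler_wpM2l// -expRD ler_expR enorm_sqr.
by rewrite le_eqVlt; apply/orP; left; apply/eqP; field.
Qed.

End gaussian_weight.

(** * Functions of polynomial growth *)

Section polynomial_growth.
Context {R : realType} {d : nat}.
Implicit Types (p q : 'cV[R]_d -> R) (t z : 'cV[R]_d).
Local Notation lambda := (@lebesgue_cV R d).

Definition poly_growth p := exists C (k : nat), 0 <= C /\
  forall t, `|p t| <= C * (1 + enorm t) ^+ k.

Lemma enorm1_ge1 t : 1 <= 1 + enorm t.
Proof. by rewrite lerDl enorm_ge0. Qed.

Lemma poly_growth_cst c : poly_growth (fun _ => c).
Proof. by exists `|c|, 0%N; split=> // t; rewrite expr0 mulr1. Qed.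

Lemma poly_growth_bounded p : (forall t, `|p t| <= 1) -> poly_growth p.
Proof. by move=> p1; exists 1, 0%N; split=> // t; rewrite expr0 mulr1. Qed.

Lemma poly_growth_dotv z : poly_growth (fun t => dotv t z).
Proof.
exists (enorm z), 1%N; split=> [|t]; first exact: enorm_ge0.
rewrite (le_trans (dotv_cauchy_schwarz _ _))// mulrC ler_wpM2l ?enorm_ge0//.
by rewrite expr1 lerDr.
Qed.

Lemma poly_growthM p q : poly_growth p -> poly_growth q ->
  poly_growth (fun t => p t * q t).
Proof.
move=> [C [k [C0 pC]]] [D [l [D0 qD]]]; exists (C * D), (k + l)%N.
split=> [|t]; first exact: mulr_ge0.
by rewrite normrM exprD mulrACA ler_pM.
Qed.

Lemma poly_growthD p q : poly_growth p -> poly_growth q ->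
  poly_growth (fun t => p t + q t).
Proof.
move=> [C [k [C0 pC]]] [D [l [D0 qD]]]; exists (C + D), (k + l)%N.
split=> [|t]; first exact: addr_ge0.
rewrite (le_trans (ler_normD _ _))// mulrDl lerD//.
  rewrite (le_trans (pC t))// ler_wpM2l// ler_weXn2l ?leq_addr//.
  exact: enorm1_ge1.
rewrite (le_trans (qD t))// ler_wpM2l// ler_weXn2l ?leq_addl//.
exact: enorm1_ge1.
Qed.

Lemma poly_growthN p : poly_growth p -> poly_growth (fun t => - p t).
Proof.
by move=> [C [k [C0 pC]]]; exists C, k; split=> // t; rewrite normrN.
Qed.

Lemma poly_growthB p q : poly_growth p -> poly_growth q ->
  poly_growth (fun t => p t - q t).
Proof. by move=> gp gq; apply: poly_growthD => //; exact: poly_growthN. Qed.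

Lemma poly_growthX p n : poly_growth p -> poly_growth (fun t => p t ^+ n).
Proof.
move=> gp; elim: n => [|n IH]; first exact: poly_growth_cst.
by under eq_fun do rewrite exprS; exact: poly_growthM.
Qed.

Lemma poly_growth_enorm : poly_growth (@enorm R d).
Proof.
exists 1, 1%N; split=> // t.
by rewrite mul1r expr1 ger0_norm ?enorm_ge0// lerDr.
Qed.

Lemma poly_growth_dotvv : poly_growth (fun t => dotv t t).
Proof. by under eq_fun do rewrite -enorm_sqr; exact/poly_growthX/poly_growth_enorm. Qed.

Lemma poly_growth_coord i : poly_growth (fun t => t i ord0).
Proof. by under eq_fun do rewrite -dotv_deltar; exact: poly_growth_dotv. Qed.

Lemma poly_growth_cos p : poly_growth (fun t => cos (p t)).
Proof. by apply: poly_growth_bounded => t; rewrite ler_norml cos_geN1 cos_le1. Qed.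

Lemma poly_growth_sin p : poly_growth (fun t => sin (p t)).
Proof. by apply: poly_growth_bounded => t; rewrite ler_norml sin_geN1 sin_le1. Qed.

Lemma integrable_poly_gauss p b : 0 < b -> measurable_fun setT p ->
  poly_growth p -> lambda.-integrable setT (EFin \o (fun t => p t * gauss b t)).
Proof.
move=> b0 mp [C [k [C0 pC]]]; apply: (@integrable_dominated _ _ _ C b k) => //.
  by apply: measurable_funM => //; exact: measurable_gauss.
move=> t; rewrite normrM [X in _ * X]ger0_norm ?(ltW (gauss_gt0 _ _))//.
by rewrite ler_wpM2r// ltW// gauss_gt0.
Qed.

End polynomial_growth.

(** * Integration by parts against the Gaussian weight *)

Section gaussian_integrals.
Context {R : realType} {d : nat}.
Implicit Types (p q : 'cV[R]_d -> R) (t z : 'cV[R]_d).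
Local Notation lambda := (@lebesgue_cV R d).

Lemma is_derive_gauss b t z :
  is_derive (0 : R) 1 (fun h : R => gauss b (t + h *: z))
    (- (2 * b * dotv t z) * gauss b t).
Proof.
have -> : (fun h : R => gauss b (t + h *: z)) = (fun h : R =>
    expR (- b * ((dotv t t + h * (2 * dotv t z)) + dotv z z * (h * h)))).
  apply/funext => h; rewrite /gauss; congr expR; rewrite !dotvL (dotvC z t); ring.
have h := rderiv_expR (rderivZ (- b) (rderivD (rderiv_affine 0 (dotv t t) (2 * dotv t z))
  (rderivZ (dotv z z) (rderivM (rderiv_id 0) (rderiv_id 0))))).
apply: (is_derive_eq h).
rewrite mul0r !mulr0 !mul0r !addr0 /gauss mulNr; ring.
Qed.

(* By translation invariance, the integral of a translate has derivative 0. *)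
Lemma integral_gauss_by_parts p p' z b : 0 < b ->
  measurable_fun setT p -> measurable_fun setT p' ->
  poly_growth p -> poly_growth p' ->
  (forall t, is_derive (0 : R) 1 (fun h : R => p (t + h *: z)) (p' t)) ->
  \int[lambda]_t ((p' t - 2 * b * dotv t z * p t) * gauss b t) = 0.
Proof.
move=> b0 mp mp' gp gp' dp.
pose q t := p' t - 2 * b * dotv t z * p t.
have mq : measurable_fun setT q.
  apply: measurable_funB => //; apply: measurable_funM => //.
  by apply: measurable_funM => //; exact: measurable_fun_dotv.
have gq : poly_growth q.
  apply: poly_growthB => //; apply: poly_growthM => //; apply: poly_growthM.
    exact: poly_growth_cst.
  exact: poly_growth_dotv.
have mg := @measurable_gauss R d b.
have mtr (h : R) : measurable_fun setT (fun t : 'cV[R]_d => t + h *: z).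
  by apply: measurable_fun_addv => //; exact: measurable_cst.
pose f h t := p (t + h *: z) * gauss b (t + h *: z).
pose f' h t := q (t + h *: z) * gauss b (t + h *: z).
have [C [k [C0 qC]]] := gq.
(* A majorant of the derivative uniform over shifts |h| <= 1: there |t + h z|^2 >= |t|^2 / 2 -
   |z|^2, hence the factor exp(b |z|^2) and the halved exponent. *)
pose G t := (C * (1 + enorm z) ^+ k * expR (b * dotv z z)) *
  ((1 + enorm t) ^+ k * gauss (b / 2) t).
have intf h : lambda.-integrable setT (EFin \o f h).
  have /integrableP[mpg lty] := integrable_poly_gauss b0 mp gp.
  apply/integrableP; split.
    apply/measurable_EFinP; apply: measurable_funM; exact: measurableT_comp.
  move: lty; rewrite -(integral_cV_translation (h *: z))//.
  exact: measurableT_comp.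
have df (h : R) t : is_derive h 1 (f ^~ t) (f' h t).
  pose F y := p (t + y *: z) * gauss b (t + y *: z).
  have -> : (fun y => f y t) = fun y => F (y + 0) by apply/funext => y; rewrite addr0.
  apply: rderiv_shift.
  rewrite (_ : (fun y => F (h + y + 0)) = fun y : R =>
      p (t + h *: z + y *: z) * gauss b (t + h *: z + y *: z)); last first.
    by apply/funext => y; rewrite /F addr0 scalerDl addrA.
  have hd := rderivM (dp (t + h *: z)) (is_derive_gauss b (t + h *: z) z).
  apply: (is_derive_eq hd).
  rewrite scale0r addr0 /f' /q; ring.
have := @is_derive_under_Rintegral R _ _ lambda f f' 0 (-1) 1 G.
have -> : (fun x => \int[lambda]_y f x y) = cst (\int[lambda]_y f 0 y).
  apply/funext => h; rewrite /f /Rintegral /cst; apply: (congr1 fine).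
  rewrite (integral_cV_translation (h *: z) (f := fun t => (p t * gauss b t)%:E)).
    by under [in RHS]eq_integral do rewrite scale0r addr0.
  by apply/measurable_EFinP/measurable_funM.
have -> : \int[lambda]_y f' 0 y = \int[lambda]_t (q t * gauss b t).
  by apply: eq_Rintegral => t _; rewrite /f' scale0r addr0.
move=> h; have {}h : is_derive (0 : R) 1 (cst (\int[lambda]_y f 0 y))
    (\int[lambda]_t (q t * gauss b t)).
  apply: h => //.
  - by rewrite in_itv/= ltr01 oppr_lt0 ltr01.
  - have := integrable_poly_gauss (divr_gt0 b0 (ltr0Sn R 1)) (p := fun t => (1 + enorm t) ^+ k).
    move=> /(_ _ _)/(integrableZl measurableT (C * (1 + enorm z) ^+ k * expR (b * dotv z z))).
    apply.
      by apply: measurable_funX; apply: measurable_funD => //; exact: measurable_fun_enorm.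
    apply: poly_growthX; apply: poly_growthD; last exact: poly_growth_enorm.
    exact: poly_growth_cst.
  move=> x t; rewrite in_itv/= => /andP[x1 x2].
  have x1' : `|x| <= 1 by rewrite ler_norml !ltW.
  rewrite /f' normrM [X in _ * X]ger0_norm ?(ltW (gauss_gt0 _ _))//.
  apply: (@le_trans _ _ (C * ((1 + enorm z) * (1 + enorm t)) ^+ k *
      (expR (b * dotv z z) * gauss (b / 2) t))); last first.
    by rewrite exprMn /G le_eqVlt; apply/orP; left; apply/eqP; ring.
  apply: ler_pM => //; first exact/ltW/gauss_gt0.
    rewrite (le_trans (qC _))// ler_wpM2l// lerXn2r ?nnegrE ?addr_ge0 ?mulr_ge0 ?addr_ge0 ?enorm_ge0//.
    have h1 := enormD t (x *: z); rewrite enormZ in h1.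
    have := enorm_ge0 t; have := enorm_ge0 z; nra.
  rewrite /gauss -expRD ler_expR.
  (* Half of |t + 2 x z|^2 >= 0, together with x^2 <= 1, gives the lower bound for |t + x z|^2. *)
  have h1 := mulr_ge0 (ltW b0) (dotvv_ge0 (t + (2 * x) *: z)).
  have x21 : 0 <= 1 - x ^+ 2 by rewrite subr_ge0 -real_normK ?num_real// expr_le1.
  have h2 := mulr_ge0 (ltW b0) (mulr_ge0 (dotvv_ge0 z) x21).
  move: h1 h2; rewrite !dotvL (dotvC z t); nra.
by move: h => [_]; rewrite derive_cst => <-.
Qed.

End gaussian_integrals.

(** * The linear functional [gint b] on tempered functions *)

Section gaussian_functional.
Context {R : realType} {d : nat}.
Implicit Types (p q : 'cV[R]_d -> R) (t z : 'cV[R]_d) (b s c : R).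
Local Notation lambda := (@lebesgue_cV R d).

(** Stable under the operations used below, and integrable against every Gaussian weight, so that
    [gint b] is linear on this class. *)
Definition tempered p := measurable_fun setT p /\ poly_growth p.

Lemma tempered_cst c : tempered (fun _ => c).
Proof. by split; [exact: measurable_cst|exact: poly_growth_cst]. Qed.

Lemma tempered_dotv z : tempered (fun t => dotv t z).
Proof. by split; [exact: measurable_fun_dotv|exact: poly_growth_dotv]. Qed.

Lemma tempered_dotvv : tempered (fun t => dotv t t).
Proof. by split; [exact: measurable_dotvv|exact: poly_growth_dotvv]. Qed.

Lemma tempered_coord i : tempered (fun t => t i ord0).
Proof. by split; [exact: measurable_coord|exact: poly_growth_coord]. Qed.

Lemma temperedM p q : tempered p -> tempered q -> tempered (fun t => p t * q t).
Proof. by move=> [? ?] [? ?]; split; [exact: measurable_funM|exact: poly_growthM]. Qed.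

Lemma temperedD p q : tempered p -> tempered q -> tempered (fun t => p t + q t).
Proof. by move=> [? ?] [? ?]; split; [exact: measurable_funD|exact: poly_growthD]. Qed.

Lemma temperedN p : tempered p -> tempered (fun t => - p t).
Proof. by move=> [? ?]; split; [exact: measurable_funN|exact: poly_growthN]. Qed.

Lemma temperedB p q : tempered p -> tempered q -> tempered (fun t => p t - q t).
Proof. by move=> ? ?; apply: temperedD => //; exact: temperedN. Qed.

Lemma temperedX p n : tempered p -> tempered (fun t => p t ^+ n).
Proof. by move=> [? ?]; split; [exact: measurable_funX|exact: poly_growthX]. Qed.

Lemma tempered_cos p : tempered p -> tempered (fun t => cos (p t)).
Proof.
move=> [mp _]; split; last exact: poly_growth_cos.
by apply: measurableT_comp => //; apply: continuous_measurable_fun; exact: continuous_cos.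
Qed.

Lemma tempered_sin p : tempered p -> tempered (fun t => sin (p t)).
Proof.
move=> [mp _]; split; last exact: poly_growth_sin.
by apply: measurableT_comp => //; apply: continuous_measurable_fun; exact: continuous_sin.
Qed.

Definition gint b p : R := \int[lambda]_t (p t * gauss b t).

Lemma integrable_gint b p : 0 < b -> tempered p ->
  lambda.-integrable setT (EFin \o (fun t => p t * gauss b t)).
Proof. by move=> b0 [? ?]; exact: integrable_poly_gauss. Qed.

Lemma eq_gint b p q : (forall t, p t = q t) -> gint b p = gint b q.
Proof. by move=> pq; apply: eq_Rintegral => t _; rewrite pq. Qed.

Lemma gintD b p q : 0 < b -> tempered p -> tempered q ->
  gint b (fun t => p t + q t) = gint b p + gint b q.
Proof.
move=> b0 tp tq; rewrite /gint -RintegralD//; last 2 first.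
  exact: integrable_gint. exact: integrable_gint.
by apply: eq_Rintegral => t _; rewrite mulrDl.
Qed.

Lemma gintZ b c p : 0 < b -> tempered p ->
  gint b (fun t => c * p t) = c * gint b p.
Proof.
move=> b0 tp; rewrite /gint -RintegralZl//; last exact: integrable_gint.
by apply: eq_Rintegral => t _; rewrite mulrA.
Qed.

Lemma gintB b p q : 0 < b -> tempered p -> tempered q ->
  gint b (fun t => p t - q t) = gint b p - gint b q.
Proof.
move=> b0 tp tq; rewrite gintD//; last exact: temperedN.
congr (_ + _); rewrite -mulN1r -gintZ//; apply: eq_gint => t.
by rewrite mulN1r.
Qed.

Lemma gint0 b : gint b (fun _ => 0) = 0.
Proof.
rewrite /gint /Rintegral integral0_eq ?fine0// => t _.
by rewrite mul0r.
Qed.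

Lemma gint_sum b I (s : seq I) (p : I -> 'cV[R]_d -> R) : 0 < b ->
  (forall i, tempered (p i)) ->
  gint b (fun t => \sum_(i <- s) p i t) = \sum_(i <- s) gint b (p i).
Proof.
move=> b0 tp; suff: tempered (fun t => \sum_(i <- s) p i t) /\
  gint b (fun t => \sum_(i <- s) p i t) = \sum_(i <- s) gint b (p i) by case.
elim: s => [|i s [ts IH]].
  rewrite big_nil (eq_gint b (q := fun _ => 0)) ?gint0; last by move=> t; rewrite big_nil.
  by split=> //; under eq_fun do rewrite big_nil; exact: tempered_cst.
split; first by under eq_fun do rewrite big_cons; exact: temperedD.
by rewrite big_cons -IH -gintD//; apply: eq_gint => t; rewrite big_cons.
Qed.

(** Stein's identity: under the Gaussian weight a linear factor is traded for a directional
    derivative. *)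
Lemma gint_by_parts p p' z b : 0 < b -> tempered p -> tempered p' ->
  (forall t, is_derive (0 : R) 1 (fun h : R => p (t + h *: z)) (p' t)) ->
  gint b (fun t => dotv t z * p t) = (2 * b)^-1 * gint b p'.
Proof.
move=> b0 tp tp' dp.
have tzp : tempered (fun t => dotv t z * p t) by apply: temperedM => //; exact: tempered_dotv.
have := integral_gauss_by_parts b0 tp.1 tp'.1 tp.2 tp'.2 dp.
rewrite -/(gint b (fun t => p' t - 2 * b * dotv t z * p t)).
rewrite (eq_gint b (q := fun t => p' t - (2 * b) * (dotv t z * p t))); last first.
  by move=> t; rewrite mulrA.
rewrite gintB//; last by apply: temperedM => //; exact: tempered_cst.
rewrite gintZ// => /eqP; rewrite subr_eq0 => /eqP ->.
by rewrite mulKf// mulf_neq0// gt_eqF.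
Qed.

(** Differentiating in b brings down the factor - |t|^2, which raises the degree of the computable
    moments without further integration by parts. On x > b / 2 the weight of exponent b / 2
    dominates. *)
Lemma is_derive_gint b p : 0 < b -> tempered p ->
  is_derive b 1 (fun b => gint b p) (- gint b (fun t => dotv t t * p t)).
Proof.
move=> b0 tp.
have tq : tempered (fun t => dotv t t * p t) by apply: temperedM => //; exact: tempered_dotvv.
have b20 : 0 < b / 2 by rewrite divr_gt0.
have := @is_derive_under_Rintegral R _ _ lambda (fun b t => p t * gauss b t)
  (fun b t => - (dotv t t * p t * gauss b t)) b (b / 2) (2 * b)
  (fun t => `|dotv t t * p t| * gauss (b / 2) t).
have -> : \int[lambda]_y (- (dotv y y * p y * gauss b y)) =
    - gint b (fun t => dotv t t * p t).
  rewrite -mulN1r -gintZ//; apply: eq_Rintegral => t _.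
  by rewrite mulN1r mulNr.
apply.
- by rewrite in_itv/=; apply/andP; split; lra.
- move=> x; rewrite in_itv/= => /andP[x0 _]; apply: integrable_gint => //.
  by rewrite (lt_trans b20).
- move=> x t _.
  have h := rderivZ (p t) (rderiv_expR (rderivN (rderivM (rderiv_id x)
    (rderiv_cst x (dotv t t))))).
  by apply: (is_derive_eq h); rewrite /gauss; ring.
- have [mq [C [k [C0 qC]]]] := tq; apply: integrable_gint => //; split.
    exact: measurableT_comp.
  by exists C, k; split=> // t; rewrite normr_id.
- move=> x t; rewrite in_itv/= => /andP[x0 _].
  rewrite normrN normrM [X in _ * X]ger0_norm ?(ltW (gauss_gt0 _ _))//.
  rewrite ler_wpM2l// ler_expR lerN2 ler_wpM2r ?dotvv_ge0//.
  exact: ltW.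
Qed.

(** * Fourier transforms of the Gaussian weight and of its products with |t|^2 and |t|^4 *)

Section fourier.
Variables (z : 'cV[R]_d) (theta : R).
(** The scale s is the variable of a differential equation; the phase theta treats cosines and sines
    at once. *)
Local Notation phase s := (fun t => s * dotv t z + theta).

Lemma tempered_phase s : tempered (phase s).
Proof.
apply: temperedD; last exact: tempered_cst.
by apply: temperedM; [exact: tempered_cst|exact: tempered_dotv].
Qed.

Lemma gint_dotv_sin b s : 0 < b ->
  gint b (fun t => dotv t z * sin (phase s t)) =
  s * dotv z z / (2 * b) * gint b (fun t => cos (phase s t)).
Proof.
move=> b0; have tc := tempered_cos (tempered_phase s).
have tc' : tempered (fun t => (s * dotv z z) * cos (phase s t)).
  by apply: temperedM => //; exact: tempered_cst.
have dp t : is_derive (0 : R) 1 (fun h : R => sin (phase s (t + h *: z)))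
    ((s * dotv z z) * cos (phase s t)).
  have -> : (fun h : R => sin (phase s (t + h *: z))) =
      (fun h => sin (phase s t + h * (s * dotv z z))).
    by apply/funext => h; congr sin; rewrite !dotvL; ring.
  have h := rderiv_sin (rderiv_affine 0 (phase s t) (s * dotv z z)).
  by apply: (is_derive_eq h); rewrite mul0r addr0 mulrC.
rewrite (gint_by_parts b0 (tempered_sin (tempered_phase s)) tc' dp) gintZ//.
ring.
Qed.

Lemma is_derive_gint_cos b s : 0 < b ->
  is_derive s 1 (fun s => gint b (fun t => cos (phase s t)))
    (- (s * dotv z z / (2 * b)) * gint b (fun t => cos (phase s t))).
Proof.
move=> b0; rewrite mulNr -gint_dotv_sin//.
have tzs s' : tempered (fun t => dotv t z * sin (phase s' t)).
  by apply: temperedM; [exact: tempered_dotv|exact/tempered_sin/tempered_phase].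
have := @is_derive_under_Rintegral R _ _ lambda (fun s t => cos (phase s t) * gauss b t)
  (fun s t => - (dotv t z * sin (phase s t) * gauss b t)) s (s - 1) (s + 1)
  (fun t => `|dotv t z| * gauss b t).
have -> : \int[lambda]_t (- (dotv t z * sin (phase s t) * gauss b t)) =
    - gint b (fun t => dotv t z * sin (phase s t)).
  rewrite -mulN1r -gintZ//; apply: eq_Rintegral => t _.
  by rewrite mulN1r mulNr.
apply.
- by rewrite in_itv/=; apply/andP; split; lra.
- by move=> x _; apply: integrable_gint => //; exact/tempered_cos/tempered_phase.
- move=> x t _.
  have -> : (fun s => cos (phase s t) * gauss b t) =
      (fun s => gauss b t * cos (theta + s * dotv t z)).
    by apply/funext => y; rewrite mulrC (addrC theta).
  have h := rderivZ (gauss b t) (rderiv_cos (rderiv_affine x theta (dotv t z))).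
  by apply: (is_derive_eq h); rewrite (addrC theta); ring.
- have [mq [C [k [C0 qC]]]] := tempered_dotv z; apply: integrable_gint => //; split.
    exact: measurableT_comp.
  by exists C, k; split=> // t; rewrite normr_id.
- move=> x t _; rewrite normrN !normrM [X in _ * X]ger0_norm ?(ltW (gauss_gt0 _ _))//.
  rewrite ler_wpM2r ?(ltW (gauss_gt0 _ _))// ler_piMr// ler_norml.
  by rewrite sin_geN1 sin_le1.
Qed.

(** As a function of the scale s, the integral satisfies y' = - s |z|^2 / (2 b) y. Multiplied by the
    integrating factor it is constant, and s = 0 is compared with s = 1. *)
Lemma gint_cos b : 0 < b ->
  gint b (fun t => cos (dotv t z + theta)) =
  cos theta * gint b (fun _ => 1) * expR (- (dotv z z / (4 * b))).
Proof.
move=> b0; pose F s := gint b (fun t => cos (phase s t)) * expR (s * s * (dotv z z / (4 * b))).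
have dF s : is_derive s 1 F 0.
  have h := rderivM (is_derive_gint_cos s b0)
    (rderiv_expR (rderivM (rderivM (rderiv_id s) (rderiv_id s)) (rderiv_cst s (dotv z z / (4 * b))))).
  apply: (is_derive_eq h); field.
  by rewrite gt_eqF.
have : F 0 = F 1.
  apply: rderiv0_constant => //; apply: continuous_subspaceT => s.
  by apply: differentiable_continuous; apply/derivable1_diffP; have [] := dF s.
rewrite /F !mul1r !mul0r expR0 mulr1.
rewrite (eq_gint b (q := fun t => cos theta * 1)); last by move=> t; rewrite mul0r add0r mulr1.
rewrite gintZ//; last exact: tempered_cst.
move=> ->; rewrite -mulrA -expRD subrr expR0 mulr1.
by apply: eq_gint => t; rewrite mul1r.
Qed.

(** One integration by parts in each coordinate, with one of the two factors t_i as the linear one.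
    The derivatives add up to d cos - (t.z) sin, whose sine term is known from [gint_dotv_sin]. *)
Lemma gint_dotvv_cos b : 0 < b ->
  gint b (fun t => dotv t t * cos (dotv t z + theta)) =
  (d%:R / (2 * b) - dotv z z / (4 * b ^+ 2)) * gint b (fun t => cos (dotv t z + theta)).
Proof.
move=> b0.
have tph : tempered (fun t => dotv t z + theta).
  by apply: temperedD; [exact: tempered_dotv|exact: tempered_cst].
have tc := tempered_cos tph; have ts := tempered_sin tph.
pose q i t := cos (dotv t z + theta) - z i ord0 * (t i ord0 * sin (dotv t z + theta)).
have tis i : tempered (fun t => t i ord0 * sin (dotv t z + theta)).
  by apply: temperedM => //; exact: tempered_coord.
have tq i : tempered (q i).
  by apply: temperedB => //; apply: temperedM => //; exact: tempered_cst.
have tic i : tempered (fun t => t i ord0 * cos (dotv t z + theta)).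
  by apply: temperedM => //; exact: tempered_coord.
have dq i t : is_derive (0 : R) 1 (fun h : R => (t + h *: delta_mx i ord0) i ord0 *
    cos (dotv (t + h *: delta_mx i ord0) z + theta)) (q i t).
  have -> : (fun h : R => (t + h *: delta_mx i ord0) i ord0 *
      cos (dotv (t + h *: delta_mx i ord0) z + theta)) =
     (fun h => (t i ord0 + h * 1) * cos ((dotv t z + theta) + h * z i ord0)).
    apply/funext => h; rewrite !mxE !eqxx !dotvL dotv_deltal; congr (_ * cos _); ring.
  have h := rderivM (rderiv_affine 0 (t i ord0) 1)
    (rderiv_cos (rderiv_affine 0 (dotv t z + theta) (z i ord0))).
  apply: (is_derive_eq h); rewrite !mul0r !addr0 /q; ring.
have E i := @gint_by_parts _ _ (delta_mx i ord0) b b0 (tic i) (tq i) (dq i).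
rewrite (eq_gint b (q := fun t => \sum_i dotv t (delta_mx i ord0) *
   (t i ord0 * cos (dotv t z + theta)))); last first.
  by move=> t; rewrite dotvE mulr_suml; apply: eq_bigr => i _; rewrite dotv_deltar mulrA.
rewrite gint_sum//; last first.
  by move=> i; apply: temperedM => //; exact: tempered_dotv.
under eq_bigr do rewrite E; rewrite -mulr_sumr -gint_sum//.
rewrite (eq_gint b (q := fun t => d%:R * cos (dotv t z + theta) -
    (dotv t z * sin (1 * dotv t z + theta)))); last first.
  move=> t; rewrite /q sumrB sumr_const card_ord mulr_natl; congr (_ - _).
  by rewrite mul1r dotvE mulr_suml; apply: eq_bigr => i _; ring.
rewrite gintB//; last 2 first.
- by apply: temperedM => //; exact: tempered_cst.
- by apply: temperedM; [exact: tempered_dotv|exact/tempered_sin/tempered_phase].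
rewrite gintZ// gint_dotv_sin// (eq_gint b (q := fun t => cos (dotv t z + theta))); last first.
  by move=> t; rewrite mul1r.
by field; rewrite gt_eqF.
Qed.

(** Obtained by differentiating [gint_dotvv_cos] in b. If G is the integral of the cosine and m its
    factor there, then G' = - m G, so that - (m G)' = (m^2 - m') G. *)
Lemma gint_dotvv2_cos b : 0 < b ->
  gint b (fun t => dotv t t ^+ 2 * cos (dotv t z + theta)) =
  ((d%:R / (2 * b) - dotv z z / (4 * b ^+ 2)) ^+ 2 +
   (d%:R / (2 * b ^+ 2) - dotv z z / (2 * b ^+ 3))) *
  gint b (fun t => cos (dotv t z + theta)).
Proof.
move=> b0.
have tph : tempered (fun t => dotv t z + theta).
  by apply: temperedD; [exact: tempered_dotv|exact: tempered_cst].
have tc := tempered_cos tph.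
have t2 : tempered (fun t => dotv t t * cos (dotv t z + theta)).
  by apply: temperedM => //; exact: tempered_dotvv.
have d1 := is_derive_gint b0 t2.
have d2 := is_derive_gint b0 tc.
have bn : b != 0 by rewrite gt_eqF.
have dI := rderiv_inv bn (rderiv_id b).
have d3 := rderivM (rderivB (rderivZ (d%:R / 2) dI)
  (rderivZ (dotv z z / 4) (rderivM dI dI))) d2.
have e1 : - gint b (fun t => dotv t t * (dotv t t * cos (dotv t z + theta))) =
    'D_1 (fun b => gint b (fun t => dotv t t * cos (dotv t z + theta))) b.
  by have [_ ->] := d1.
rewrite (eq_gint b (q := fun t => dotv t t * (dotv t t * cos (dotv t z + theta)))); last first.
  by move=> t; rewrite expr2 mulrA.
apply: oppr_inj; rewrite e1.
set F := (X in is_derive _ _ X _) in d3.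
(* The formula for the second moment is available for positive b only, so the two functions of b
   agree near b rather than everywhere. *)
have -> : 'D_1 (fun b => gint b (fun t => dotv t t * cos (dotv t z + theta))) b = 'D_1 F b.
  apply: near_eq_derive; near=> x.
  have x0 : 0 < x.
    by rewrite -oppr_lt0; near: x; apply: Nlt_nbhsl; rewrite oppr_lt0.
  rewrite gint_dotvv_cos// /F; congr (_ * _).
  by field; rewrite gt_eqF.
have [_ ->] := d3.
rewrite gint_dotvv_cos//; field.
exact: bn.
Unshelve. all: by end_near. Qed.

End fourier.

End gaussian_functional.

(** * The statistic as an energy, and its affine invariance *)

Section statistic_formula.
Context {R : realType} {d : nat}.
Implicit Types (t y z : 'cV[R]_d) (a theta : R).

Lemma rderiv_sum (I : Type) (r : seq I) (g : I -> R -> R) (g' : I -> R) (x : R) :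
  (forall i, is_derive x 1 (g i) (g' i)) ->
  is_derive x 1 (fun h => \sum_(i <- r) g i h) (\sum_(i <- r) g' i).
Proof.
move=> dg; elim: r => [|i r IH].
  by rewrite big_nil; under eq_fun do rewrite big_nil; exact: rderiv_cst.
by rewrite big_cons; under eq_fun do rewrite big_cons; exact: rderivD.
Qed.

(** Turns a directional derivative on vectors into a derivative on the line, where the rules above
    apply. *)
Lemma derive_along (f : 'cV[R]_d -> R) t v :
  'D_v f t = 'D_1 (fun h : R => f (t + h *: v)) (0 : R).
Proof.
have E : (fun h : R => h^-1 *: ((f \o shift t) (h *: v) - f t)) =
    (fun h => h^-1 *: (((fun h : R => f (t + h *: v)) \o shift 0) (h *: 1) -
                       f (t + 0 *: v))).
  apply/funext => h /=; rewrite scale0r !addr0 [h *: 1]mulr1.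
  by rewrite (addrC t).
by rewrite /derive E.
Qed.

(* For theta = 0 and theta = - pi / 2, these are the real and the imaginary part
   of minus the harmonic oscillator Delta - |t|^2 + d applied to exp(i t.y). *)
Definition osc theta y t : R :=
  (dotv y y + dotv t t - d%:R) * cos (dotv t y + theta).

Definition osc_mean n theta (r : 'I_n -> 'cV[R]_d) t : R :=
  n%:R^-1 * \sum_(j < n) osc theta (r j) t.

Lemma laplacian_cos n theta (r : 'I_n -> 'cV[R]_d) t :
  laplacian (fun s : 'cV[R]_d => n%:R^-1 * \sum_(j < n) cos (dotv s (r j) + theta)) t =
  - (n%:R^-1 * \sum_(j < n) dotv (r j) (r j) * cos (dotv t (r j) + theta)).
Proof.
have D1 k s : 'D_(delta_mx k ord0)
    (fun s : 'cV[R]_d => n%:R^-1 * \sum_(j < n) cos (dotv s (r j) + theta)) s =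
    n%:R^-1 * \sum_(j < n) (- sin (dotv s (r j) + theta) * r j k ord0).
  rewrite derive_along.
  have -> : (fun h : R => n%:R^-1 *
      \sum_(j < n) cos (dotv (s + h *: delta_mx k ord0) (r j) + theta)) =
      (fun h : R => n%:R^-1 *
      \sum_(j < n) cos ((dotv s (r j) + theta) + h * r j k ord0)).
    apply/funext => h; congr (_ * _); apply: eq_bigr => j _; congr cos.
    by rewrite !dotvL dotv_deltal; ring.
  have h j := rderiv_cos (rderiv_affine 0 (dotv s (r j) + theta) (r j k ord0)).
  have [_ ->] := rderivZ n%:R^-1 (rderiv_sum (index_enum _) h).
  by congr (_ * _); apply: eq_bigr => j _; rewrite mul0r addr0.
have D2 k : 'D_(delta_mx k ord0) (fun s : 'cV[R]_d => 'D_(delta_mx k ord0)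
    (fun s : 'cV[R]_d => n%:R^-1 * \sum_(j < n) cos (dotv s (r j) + theta)) s) t =
    n%:R^-1 * \sum_(j < n) (- (cos (dotv t (r j) + theta) * r j k ord0) * r j k ord0).
  under [X in 'D_(delta_mx k ord0) X t]eq_fun do rewrite D1.
  rewrite derive_along.
  have -> : (fun h : R => n%:R^-1 * \sum_(j < n)
      (- sin (dotv (t + h *: delta_mx k ord0) (r j) + theta) * r j k ord0)) =
      (fun h : R => n%:R^-1 *
      \sum_(j < n) (- r j k ord0 * sin ((dotv t (r j) + theta) + h * r j k ord0))).
    apply/funext => h; congr (_ * _); apply: eq_bigr => j _.
    rewrite mulNr mulrC mulNr; congr (- (_ * sin _)).
    by rewrite !dotvL dotv_deltal; ring.
  have h j := rderivZ (- r j k ord0)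
    (rderiv_sin (rderiv_affine 0 (dotv t (r j) + theta) (r j k ord0))).
  have [_ ->] := rderivZ n%:R^-1 (rderiv_sum (index_enum _) h).
  by congr (_ * _); apply: eq_bigr => j _; rewrite mul0r addr0; ring.
rewrite /laplacian; under eq_bigr do rewrite D2.
rewrite -mulr_sumr exchange_big/= -mulrN -sumrN; congr (_ * _).
apply: eq_bigr => j _; rewrite (dotvE (r j)) mulr_suml -sumrN; apply: eq_bigr => k _.
ring.
Qed.

Lemma ReIm_sum (n : nat) (f : 'I_n -> R[i]) :
  complex.Re (\sum_j f j) = \sum_j complex.Re (f j) /\
  complex.Im (\sum_j f j) = \sum_j complex.Im (f j).
Proof. by split; rewrite raddf_sum. Qed.

Lemma ecf_Re n (x : 'I_n -> 'cV[R]_d) t : complex.Re (ecf x t) =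
  n%:R^-1 * \sum_(j < n) cos (dotv t (scaled_residual x j) + 0).
Proof.
rewrite /ecf -[n%:R : R[i]](rmorph_nat (real_complex R)) -fmorphV.
have [reE imE] := ReIm_sum (fun j : 'I_n => expi (dotv t (scaled_residual x j))).
case: (\sum_(j < n) _) reE imE => u v /= -> _.
by rewrite mul0r subr0; congr (_ * _); apply: eq_bigr => j _; rewrite addr0.
Qed.

Lemma ecf_Im n (x : 'I_n -> 'cV[R]_d) t : complex.Im (ecf x t) =
  n%:R^-1 * \sum_(j < n) cos (dotv t (scaled_residual x j) - pi / 2).
Proof.
rewrite /ecf -[n%:R : R[i]](rmorph_nat (real_complex R)) -fmorphV.
have [reE imE] := ReIm_sum (fun j : 'I_n => expi (dotv t (scaled_residual x j))).
case: (\sum_(j < n) _) reE imE => u v /= _ ->.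
by rewrite mul0r addr0; congr (_ * _); apply: eq_bigr => j _; rewrite cosBpihalf.
Qed.

Definition osc_energy n a (r : 'I_n -> 'cV[R]_d) : R :=
  gint a (fun t => osc_mean 0 r t ^+ 2 + osc_mean (- (pi / 2)) r t ^+ 2).

(** The operator in the statistic produces minus the mean of [osc], with phase 0 for the real part
    and - pi / 2 for the imaginary part; the sign disappears in the squared modulus. *)
Lemma U_statE n a (x : 'I_n -> 'cV[R]_d) :
  U_stat a x = n%:R * osc_energy a (scaled_residual x).
Proof.
rewrite /U_stat; congr (_ * _); apply: eq_Rintegral => t _.
rewrite weightE; congr (_ * _).
pose r := scaled_residual x.
have lapE theta : laplacian
    (fun s : 'cV[R]_d => n%:R^-1 * \sum_(j < n) cos (dotv s (r j) + theta)) t -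
    (enorm t ^+ 2 - d%:R) * (n%:R^-1 * \sum_(j < n) cos (dotv t (r j) + theta)) =
    - osc_mean theta r t.
  rewrite laplacian_cos /osc_mean mulrCA -opprD -mulrDr mulr_sumr -big_split/=.
  congr (- (_ * _)); apply: eq_bigr => j _; rewrite /osc enorm_sqr; ring.
have -> : claplacian (ecf x) t - real_complex R (enorm t ^+ 2 - d%:R) * ecf x t =
    Complex (- osc_mean 0 r t) (- osc_mean (- (pi / 2)) r t).
  rewrite -!lapE /claplacian.
  have -> : (fun s => complex.Re (ecf x s)) =
      (fun s => n%:R^-1 * \sum_(j < n) cos (dotv s (r j) + 0)).
    by apply/funext => s; rewrite ecf_Re.
  have -> : (fun s => complex.Im (ecf x s)) =
      (fun s => n%:R^-1 * \sum_(j < n) cos (dotv s (r j) - pi / 2)).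
    by apply/funext => s; rewrite ecf_Im.
  rewrite -/r; move: (ecf_Re x t) (ecf_Im x t); rewrite -/r.
  case: (ecf x t) => u v /= -> ->; apply/eqP; rewrite eq_complex/=.
  by rewrite !mul0r subr0 addr0 !eqxx.
rewrite /Normc.normc !sqrrN sqr_sqrtr// addr_ge0 ?sqr_ge0//.
Qed.

Lemma tempered_sum (I : Type) (s : seq I) (p : I -> 'cV[R]_d -> R) :
  (forall i, tempered (p i)) -> tempered (fun t => \sum_(i <- s) p i t).
Proof.
move=> tp; elim: s => [|i s IH].
  by under eq_fun do rewrite big_nil; exact: tempered_cst.
by under eq_fun do rewrite big_cons; exact: temperedD.
Qed.

Lemma tempered_osc theta y : tempered (osc theta y).
Proof.
apply: temperedM.
  apply: temperedB; last exact: tempered_cst.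
  by apply: temperedD; [exact: tempered_cst|exact: tempered_dotvv].
apply: tempered_cos; apply: temperedD; last exact: tempered_cst.
exact: tempered_dotv.
Qed.

Lemma tempered_osc_mean n theta (r : 'I_n -> 'cV[R]_d) : tempered (osc_mean theta r).
Proof.
apply: temperedM; first exact: tempered_cst.
by apply: tempered_sum => j; exact: tempered_osc.
Qed.

(** The weighted inner product of the oscillator functions at y and z, for A = |y|^2, B = |z|^2 and
    s = |y - z|^2. Here m and m^2 + v are the factors by which |t|^2 and |t|^4 multiply the Fourier
    transform of the weight. Only inner products of y and z enter, which makes the statistic a
    function of the Gram matrix of the residuals. *)
Definition kernel_formula (a A B s : R) : R :=
  let m := d%:R / (2 * a) - s / (4 * a ^+ 2) in
  let v := d%:R / (2 * a ^+ 2) - s / (2 * a ^+ 3) in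
  (m ^+ 2 + v + (A + B - 2 * d%:R) * m + (A - d%:R) * (B - d%:R)) *
  (gint a (fun _ : 'cV[R]_d => 1) * expR (- (s / (4 * a)))).

Lemma gint_osc2 a y z : 0 < a ->
  gint a (fun t => osc 0 y t * osc 0 z t +
                   osc (- (pi / 2)) y t * osc (- (pi / 2)) z t) =
  kernel_formula a (dotv y y) (dotv z z) (dotv (y - z) (y - z)).
Proof.
move=> a0; set A := dotv y y; set B := dotv z z.
have tc : tempered (fun t : 'cV[R]_d => cos (dotv t (y - z) + 0)).
  by apply: tempered_cos; apply: temperedD; [exact: tempered_dotv|exact: tempered_cst].
have t2 : tempered (fun t => dotv t t * cos (dotv t (y - z) + 0)).
  by apply: temperedM => //; exact: tempered_dotvv.
have t4 : tempered (fun t => dotv t t ^+ 2 * cos (dotv t (y - z) + 0)).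
  by apply: temperedM => //; apply: temperedX; exact: tempered_dotvv.
rewrite (eq_gint a (q := fun t => (dotv t t ^+ 2 * cos (dotv t (y - z) + 0) +
    (A + B - 2 * d%:R) * (dotv t t * cos (dotv t (y - z) + 0))) +
    (A - d%:R) * (B - d%:R) * cos (dotv t (y - z) + 0))); last first.
  move=> t; rewrite /osc !cosBpihalf !addr0 -/A -/B dotvBr cosB; ring.
have tz2 : tempered (fun t => (A + B - 2 * d%:R) * (dotv t t * cos (dotv t (y - z) + 0))).
  by apply: temperedM => //; exact: tempered_cst.
rewrite gintD//; last 2 first.
- exact: temperedD.
- by apply: temperedM => //; exact: tempered_cst.
rewrite gintD// !gintZ// gint_dotvv2_cos// gint_dotvv_cos// gint_cos//.
by rewrite cos0 mul1r /kernel_formula; ring.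
Qed.

Lemma osc_energyE n a (r : 'I_n -> 'cV[R]_d) : 0 < a ->
  osc_energy a r = n%:R ^- 2 * \sum_(j < n) \sum_(k < n)
    kernel_formula a (dotv (r j) (r j)) (dotv (r k) (r k))
      (dotv (r j - r k) (r j - r k)).
Proof.
move=> a0; under eq_bigr do under eq_bigr do rewrite -gint_osc2//.
have tt j k : tempered (fun t => osc 0 (r j) t * osc 0 (r k) t +
    osc (- (pi / 2)) (r j) t * osc (- (pi / 2)) (r k) t).
  by apply: temperedD; apply: temperedM; exact: tempered_osc.
under eq_bigr do rewrite -gint_sum//.
rewrite -gint_sum//; last by move=> j; exact: tempered_sum.
rewrite -gintZ//; last by apply: tempered_sum => j; exact: tempered_sum.
apply: eq_gint => t; rewrite /osc_mean !exprMn -mulrDr -exprVn; congr (_ * _).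
rewrite !expr2 !mulr_suml -big_split/=; apply: eq_bigr => j _.
by rewrite !mulr_sumr -big_split.
Qed.

End statistic_formula.

(** * Affine invariance and measurability through the Gram matrix of the residuals *)

Section gram_matrix.
Context {R : realType} {d : nat}.
Implicit Types (A B S : 'M[R]_d).

Lemma measurable_inv : measurable_fun setT (fun x : R => x^-1).
Proof.
have -> : [set: R] = [set 0] `|` ~` [set 0] by rewrite setUv.
apply/measurable_funU => //; first exact: measurableC.
split; first exact: measurable_fun_set1.
apply: open_continuous_measurable_fun.
  by rewrite openC; apply: accessible_closed_set1; apply: hausdorff_accessible.
by move=> x /set_mem/= /eqP x0; apply: inv_continuous.
Qed.

Lemma measurable_fun_det {disp} {T : measurableType disp} n (M : T -> 'M[R]_n) :
  (forall i j, measurable_fun setT (fun w => M w i j)) ->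
  measurable_fun setT (fun w => \det (M w)).
Proof.
move=> mM; rewrite /determinant; apply: measurable_sum => s.
apply: measurable_funM => //.
by apply: measurable_prod => i _; exact: mM.
Qed.

Section gram.
Context {n : nat}.
Implicit Types (x y : 'I_n -> 'cV[R]_d).

(* The inner products of the scaled residuals; the inverse of the determinant
   is 0 when S is singular, and so are the residuals then. *)
Definition gram x j k : R :=
  (\det (sample_cov x))^-1 *
  dotv (x j - sample_mean x) (\adj (sample_cov x) *m (x k - sample_mean x)).

Lemma sample_covE x v : sample_cov x *m v =
  n%:R^-1 *: \sum_(j < n) dotv (x j - sample_mean x) v *: (x j - sample_mean x).
Proof.
rewrite /sample_cov -scalemxAl mulmx_suml; congr (_ *: _).
apply: eq_bigr => j _; rewrite -mulmxA [_^T *m v]mx11_scalar.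
by rewrite mul_mx_scalar.
Qed.

Lemma tr_sample_cov x : (sample_cov x)^T = sample_cov x.
Proof.
rewrite /sample_cov linearZ/= linear_sum; congr (_ *: _).
by apply: eq_bigr => j _; rewrite /= trmx_mul trmxK.
Qed.

(** The quadratic form is a mean of squares. If it vanishes at v, then v is orthogonal to all
    centered observations, hence in the kernel of the matrix. *)
Lemma posdef_sample_cov x : sample_cov x \in unitmx -> posdefmx (sample_cov x).
Proof.
move=> Su; split=> [|v v0]; first exact: tr_sample_cov.
have E : dotv v (sample_cov x *m v) =
    n%:R^-1 * \sum_(j < n) dotv (x j - sample_mean x) v ^+ 2.
  rewrite sample_covE dotvZr dotv_sumr; congr (_ * _); apply: eq_bigr => j _.
  by rewrite dotvZr (dotvC v) expr2.
rewrite lt_neqAle E mulr_ge0 ?invr_ge0 ?sumr_ge0// => [|j _]; last exact: sqr_ge0.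
rewrite andbT; apply: contra v0; rewrite eq_sym mulf_eq0 => E0.
suff S0 : sample_cov x *m v = 0 by rewrite -[v](mulKmx Su) S0 mulmx0.
rewrite sample_covE; case/orP: E0 => [/eqP -> |]; first by rewrite scale0r.
rewrite psumr_eq0 => [/allP h|j _]; last exact: sqr_ge0.
rewrite big1 ?scaler0// => j _; have := h j (mem_index_enum _).
by rewrite /= sqrf_eq0 => /eqP ->; rewrite scale0r.
Qed.

Lemma inv_sqrtmxP S : posdefmx S ->
  posdefmx (inv_sqrtmx S) /\ inv_sqrtmx S *m inv_sqrtmx S = invmx S.
Proof.
move=> /posdefmx_inv/posdefmx_sqrt[B BP BB].
exact: (@xgetPex _ 0 [set B | posdefmx B /\ B *m B = invmx S] (ex_intro _ B (conj BP BB))).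
Qed.

(** For a singular S, [invmx S] is S itself, and an invertible B cannot satisfy B B = S; so the
    default value 0 is taken. *)
Lemma inv_sqrtmx_singular S : S \notin unitmx -> inv_sqrtmx S = 0.
Proof.
move=> Su; apply: xgetPN => B [BP]; rewrite (invmx_out Su) => BB.
by move: Su; rewrite -BB unitmx_mul (posdefmx_unit BP).
Qed.

(** Only B^T B = B B = S^-1 enters the inner products, so the chosen root disappears. *)
Lemma dotv_scaled_residual x j k :
  dotv (scaled_residual x j) (scaled_residual x k) = gram x j k.
Proof.
rewrite /scaled_residual /gram; have [Su|Su] := boolP (sample_cov x \in unitmx).
  have [[Bt _] BB] := inv_sqrtmxP (posdef_sample_cov Su).
  by rewrite dotv_mulmx Bt mulmxA BB /invmx Su -scalemxAl dotvZr.
rewrite (inv_sqrtmx_singular Su) mul0mx dotv0l.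
by move: Su; rewrite unitmxE unitfE negbK => /eqP ->; rewrite invr0 mul0r.
Qed.

Lemma U_stat_gram a x : 0 < a -> U_stat a x =
  n%:R * (n%:R ^- 2 * \sum_(j < n) \sum_(k < n)
    kernel_formula (d := d) a (gram x j j) (gram x k k)
      (gram x j j - 2 * gram x j k + gram x k k)).
Proof.
move=> a0; rewrite U_statE osc_energyE//; congr (_ * (_ * _)).
apply: eq_bigr => j _; apply: eq_bigr => k _.
rewrite !dotvL !dotv_scaled_residual; congr (kernel_formula _ _ _ _).
by rewrite -(dotv_scaled_residual x k j) dotvC dotv_scaled_residual; ring.
Qed.

(** The sample covariance becomes A S A^T, whose inverse A^-T S^-1 A^-1 cancels the factors A of the
    centered observations. *)
Lemma gram_affine A b x j k : A \in unitmx ->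
  gram (fun j => A *m x j + b) j k = gram x j k.
Proof.
move=> Au; have n0 : n%:R != 0 :> R.
  by rewrite pnatr_eq0 -lt0n; exact: leq_ltn_trans (ltn_ord j).
have mE : sample_mean (fun j => A *m x j + b) = A *m sample_mean x + b.
  rewrite /sample_mean big_split/= sumr_const card_ord scalerDr.
  by rewrite -mulmx_sumr scalemxAr -(scaler_nat n b) scalerA mulVf// scale1r.
have cE i : A *m x i + b - (A *m sample_mean x + b) = A *m (x i - sample_mean x).
  by rewrite opprD addrACA subrr addr0 mulmxBr.
have SE : sample_cov (fun j => A *m x j + b) = A *m sample_cov x *m A^T.
  rewrite /sample_cov -scalemxAr -scalemxAl mE; congr (_ *: _).
  rewrite mulmx_sumr mulmx_suml; apply: eq_bigr => i _.
  by rewrite cE trmx_mul !mulmxA.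
rewrite -!dotv_scaled_residual /scaled_residual mE !cE SE.
(* For a singular S all residuals vanish on both sides, since A S A^T is singular too. *)
have [Su|Su] := boolP (sample_cov x \in unitmx); last first.
  rewrite (inv_sqrtmx_singular Su) inv_sqrtmx_singular ?mul0mx//.
  by rewrite !unitmx_mul unitmx_tr Au (negbTE Su).
have Su' : A *m sample_cov x *m A^T \in unitmx.
  by rewrite !unitmx_mul unitmx_tr Au Su.
have [[Bt _] BB] := inv_sqrtmxP (posdef_sample_cov Su).
have := @posdef_sample_cov (fun j => A *m x j + b); rewrite SE => /(_ Su').
move=> /inv_sqrtmxP[[Ct _] CC].
rewrite !dotv_mulmx Bt Ct (mulmxA (inv_sqrtmx (sample_cov x))) BB.
rewrite (mulmxA (inv_sqrtmx (A *m _ *m _))) CC.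
have Atu : A^T \in unitmx by rewrite unitmx_tr.
have -> : invmx (A *m sample_cov x *m A^T) =
    invmx A^T *m invmx (sample_cov x) *m invmx A.
  apply: (can_inj (mulKmx Su')); rewrite mulmxV//.
  by rewrite !mulmxA mulmxK// mulmxK// mulmxV.
by congr dotv; rewrite !mulmxA mulmxV// mul1mx mulmxKV.
Qed.

Lemma U_stat_affine a A b x : 0 < a -> A \in unitmx ->
  U_stat a (fun j => A *m x j + b) = U_stat a x.
Proof.
move=> a0 Au; rewrite (U_stat_gram x a0) (U_stat_gram _ a0).
suff -> : gram (fun j => A *m x j + b) = gram x by [].
by apply/funext => j; apply/funext => k; exact: gram_affine.
Qed.

Context {disp : measure_display} {T : measurableType disp}.

(** In the form [U_stat_gram] the statistic is built from sums, products, exponentials,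
    determinants, cofactors and one inverse, with no square root of a matrix. *)
Lemma measurable_U_stat a (X : 'I_n -> T -> 'cV[R]_d) : 0 < a ->
  (forall j, measurable_fun setT (X j)) ->
  measurable_fun setT (fun w => U_stat a (fun j => X j w)).
Proof.
move=> a0 mX; under eq_fun do rewrite U_stat_gram//.
have mm : measurable_fun setT (fun w => sample_mean (fun j => X j w)).
  apply: measurable_fun_cV => i; under eq_fun do rewrite mxE summxE.
  apply: measurable_funM => //; apply: measurable_sum => j.
  exact: measurable_fun_coord.
have mc j : measurable_fun setT (fun w => X j w - sample_mean (fun j => X j w)).
  exact: measurable_fun_subv.
have mS i j : measurable_fun setT (fun w => sample_cov (fun j => X j w) i j).
  under eq_fun do rewrite mxE summxE.
  apply: measurable_funM => //; apply: measurable_sum => k.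
  under eq_fun do rewrite mxE big_ord1 [X in _ * X]mxE.
  apply: measurable_funM.
    exact: (measurable_fun_coord i (mc k)).
  exact: (measurable_fun_coord j (mc k)).
have mg j k : measurable_fun setT (fun w => gram (fun j => X j w) j k).
  apply: measurable_funM.
    by apply: (measurableT_comp measurable_inv); exact: measurable_fun_det.
  apply: measurable_fun_dotv => //; apply: measurable_fun_cV => i.
  under eq_fun do rewrite mxE; apply: measurable_sum => l.
  apply: measurable_funM; last exact: measurable_fun_coord.
  under eq_fun do rewrite mxE /cofactor.
  apply: measurable_funM => //; apply: measurable_fun_det => p q.
  by under eq_fun do rewrite mxE mxE; exact: mS.
apply: measurable_funM => //; apply: measurable_funM => //.
apply: measurable_sum => j; apply: measurable_sum => k.
have ms : measurable_fun setT (fun w => gram (fun j => X j w) j j -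
    2 * gram (fun j => X j w) j k + gram (fun j => X j w) k k).
  apply: measurable_funD => //; apply: measurable_funB => //.
  exact: measurable_funM.
apply: measurable_funM; last first.
  apply: measurable_funM => //; apply: measurableT_comp => //.
  by apply: measurable_funN; exact: measurable_funM.
have mm2 : measurable_fun setT (fun w => d%:R / (2 * a) -
    (gram (fun j => X j w) j j - 2 * gram (fun j => X j w) j k +
     gram (fun j => X j w) k k) / (4 * a ^+ 2)).
  by apply: measurable_funB => //; exact: measurable_funM.
apply: measurable_funD; last first.
  by apply: measurable_funM; apply: measurable_funB.
apply: measurable_funD.
  apply: measurable_funD; first exact: measurable_funX.
  by apply: measurable_funB => //; exact: measurable_funM.
apply: measurable_funM => //; apply: measurable_funB => //.
exact: measurable_funD.
Qed.

End gram.

End gram_matrix.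

(** * Convergence of the energy *)

Section residual_perturbation.
Context {R : realType} {d : nat}.
Implicit Types (t y z : 'cV[R]_d) (theta : R).

Lemma normr_cosB (u v : R) : `|cos u - cos v| <= `|u - v|.
Proof.
wlog uv : u v / u < v => [hwlog|].
  have [/hwlog//|/hwlog|->] := ltgtP u v; last by rewrite !subrr.
  by rewrite distrC (distrC u).
have dc x : x \in `]u, v[ -> is_derive x 1 cos (- sin x) by move=> _; exact: is_derive_cos.
have cc : {within `[u, v], continuous cos}.
  by apply: continuous_subspaceT => x; exact: continuous_cos.
have [c _] := MVT uv dc cc.
rewrite distrC (distrC u) => ->; rewrite normrM ler_piMl// normrN ler_norml.
by rewrite sin_geN1 sin_le1.
Qed.

Section sample.
Context {n : nat}.
Variables (x : 'I_n -> 'cV[R]_d) (eta : R).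
Hypothesis eta0 : 0 <= eta.
Hypothesis eta_le : 2 * eta <= 1.
Hypothesis mean_le : enorm (sample_mean x) <= eta.
Hypothesis cov_le : forall v, enorm (sample_cov x *m v - v) <= eta * enorm v.

(** By the Cauchy-Schwarz inequality v.Sv >= (1 - eta) |v|^2, and eta <= 1/2. *)
Lemma posdef_sample_cov_near1 : posdefmx (sample_cov x).
Proof.
split=> [|v v0]; first exact: tr_sample_cov.
have vv := dotvv_gt0 v0.
have := enorm_dotv (- v) (sample_cov x *m v - v).
rewrite enormN dotvNl dotvBr => h.
have : enorm v * enorm (sample_cov x *m v - v) <= eta * dotv v v.
  by rewrite -enorm_sqr expr2 mulrCA ler_wpM2l ?enorm_ge0.
have : 0 <= (1 - 2 * eta) * dotv v v by rewrite mulr_ge0 ?subr_ge0// ltW.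
lra.
Qed.

Lemma scaled_residual_near j :
  enorm (scaled_residual x j - x j) <= 2 * eta * (1 + enorm (x j)).
Proof.
set m := sample_mean x.
have [Bp BB] := inv_sqrtmxP posdef_sample_cov_near1.
set B := inv_sqrtmx (sample_cov x) in Bp BB.
have Bu := posdefmx_unit Bp.
have Su := posdefmx_unit posdef_sample_cov_near1.
have QQ : invmx B *m invmx B = sample_cov x.
  apply: (can_inj (mulKmx Bu)); apply: (can_inj (mulKmx Bu)).
  by rewrite mulKVmx// mulmxV// mulmxA BB mulVmx.
(* With Q = B^-1 the root of S, [posdefmx_sqrt_near1] at B z gives |z - B z| <= |S B z - B z| <= eta
   |B z| <= eta (|B z - z| + |z|). As eta <= 1/2, the first summand is absorbed at the price of the
   factor 2. *)
have near1 z : enorm (B *m z - z) <= 2 * eta * enorm z.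
  have := posdefmx_sqrt_near1 (B *m z) (posdefmx_inv Bp).
  rewrite QQ => /le_trans/(_ (cov_le _)); rewrite mulKmx// => h.
  have h2 := enormD (B *m z - z) z; rewrite subrK in h2.
  rewrite -enormN opprB in h.
  have h3 := ler_wpM2l eta0 h2.
  have h4 : 0 <= (1 - 2 * eta) * enorm (B *m z - z).
    by rewrite mulr_ge0 ?subr_ge0// enorm_ge0.
  lra.
have -> : scaled_residual x j - x j = (B *m (x j - m) - (x j - m)) - m.
  by rewrite /scaled_residual -/B -/m opprB [m - x j]addrC addrA addrK.
have := enormB (B *m (x j - m) - (x j - m)) m.
have h1 := near1 (x j - m); have h2 := ler_wpM2l eta0 (enormB (x j) m).
have h3 : 0 <= (1 - 2 * eta) * enorm m by rewrite mulr_ge0 ?subr_ge0// enorm_ge0.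
move: mean_le; rewrite -/m; lra.
Qed.

End sample.

(** The change of the quadratic factor costs at most 6 eta (1 + |y|)^2, that of the cosine at most 2
    eta (1 + d) (1 + |y|)^3 (1 + |t|)^3. The powers of 1 + |y| are raised to the fourth, the moment
    at hand, and 6 + 2 (1 + d) is the constant. *)
Lemma osc_perturbation theta y z t (eta : R) : 0 <= eta -> 2 * eta <= 1 ->
  enorm (z - y) <= 2 * eta * (1 + enorm y) ->
  `|osc theta z t - osc theta y t| <=
    eta * (8 + 2 * d%:R) * (1 + enorm y) ^+ 4 * (1 + enorm t) ^+ 3.
Proof.
move=> eta0 eta1 zy.
set Y := enorm y in zy *; set T := enorm t; set D := enorm (z - y) in zy.
have Y0 : 0 <= Y by exact: enorm_ge0.
have T0 : 0 <= T by exact: enorm_ge0.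
have D0 : 0 <= D by exact: enorm_ge0.
have d0 : 0 <= d%:R :> R by exact: ler0n.
have zz : `|dotv z z - dotv y y| <= D * (D + 2 * Y).
  have -> : dotv z z - dotv y y = dotv (z - y) (z - y) + 2 * dotv (z - y) y.
    by rewrite !dotvL (dotvC y z); ring.
  rewrite (le_trans (ler_normD _ _))// mulrDr lerD//.
    by rewrite (le_trans (dotv_cauchy_schwarz _ _)).
  rewrite normrM ger0_norm// mulrCA ler_wpM2l//.
  exact: dotv_cauchy_schwarz.
have -> : osc theta z t - osc theta y t =
    (dotv z z - dotv y y) * cos (dotv t z + theta) +
    (dotv y y + dotv t t - d%:R) * (cos (dotv t z + theta) - cos (dotv t y + theta)).
  rewrite /osc; ring.
have c1 : `|(dotv z z - dotv y y) * cos (dotv t z + theta)| <= 6 * eta * (1 + Y) ^+ 2.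
  rewrite normrM; apply: (@le_trans _ _ (D * (D + 2 * Y))).
    rewrite -[leRHS]mulr1; apply: ler_pM => //.
    by rewrite ler_norml cos_geN1 cos_le1.
  have DY : D + 2 * Y <= 3 * (1 + Y) by nra.
  apply: (@le_trans _ _ ((2 * eta * (1 + Y)) * (3 * (1 + Y)))); last by nra.
  by apply: ler_pM => //; nra.
have c2 : `|dotv y y + dotv t t - d%:R| <= (1 + d%:R) * ((1 + Y) ^+ 2 * (1 + T) ^+ 2).
  rewrite -!enorm_sqr -/Y -/T ler_norml; apply/andP; split.
    have : 1 <= (1 + Y) ^+ 2 * (1 + T) ^+ 2.
      by rewrite -exprMn exprn_ege1// -[leLHS]mulr1 ler_pM// lerDl.
    move=> h; have := ler_wpM2l (addr_ge0 ler01 d0) h; have := sqr_ge0 Y; have := sqr_ge0 T; nra.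
  have h : Y ^+ 2 + T ^+ 2 <= (1 + Y) ^+ 2 * (1 + T) ^+ 2.
    have : 0 <= Y * T by rewrite mulr_ge0.
    have : 0 <= Y * T ^+ 2 by rewrite mulr_ge0 ?sqr_ge0.
    have : 0 <= T * Y ^+ 2 by rewrite mulr_ge0 ?sqr_ge0.
    have : 0 <= Y ^+ 2 * T ^+ 2 by rewrite mulr_ge0 ?sqr_ge0.
    nra.
  have := mulr_ge0 d0 (mulr_ge0 (sqr_ge0 (1 + Y)) (sqr_ge0 (1 + T))).
  lra.
have c3 : `|cos (dotv t z + theta) - cos (dotv t y + theta)| <= T * (2 * eta * (1 + Y)).
  rewrite (le_trans (normr_cosB _ _))// opprD addrACA subrr addr0 -dotvBr.
  by rewrite (le_trans (dotv_cauchy_schwarz _ _))// ler_wpM2l.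
rewrite (le_trans (ler_normD _ _))//.
have p1 : 1 <= 1 + Y by rewrite lerDl.
have p2 : 1 <= 1 + T by rewrite lerDl.
have p : 0 <= (1 + Y) ^+ 4 * (1 + T) ^+ 3 by rewrite mulr_ge0 ?exprn_ge0 ?addr_ge0.
apply: (@le_trans _ _ (6 * eta * ((1 + Y) ^+ 4 * (1 + T) ^+ 3) +
    2 * eta * (1 + d%:R) * ((1 + Y) ^+ 4 * (1 + T) ^+ 3))); last first.
  by rewrite le_eqVlt; apply/orP; left; apply/eqP; ring.
apply: lerD.
  rewrite (le_trans c1)// ler_wpM2l ?mulr_ge0//.
  rewrite -[leLHS]mulr1; apply: ler_pM; rewrite ?exprn_ge0 ?addr_ge0 ?exprn_ege1//.
  exact: ler_weXn2l.
rewrite normrM (le_trans (ler_pM _ _ c2 c3))//.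
apply: (@le_trans _ _ (2 * eta * (1 + d%:R) * ((1 + Y) ^+ 3 * ((1 + T) ^+ 2 * T)))).
  by rewrite le_eqVlt; apply/orP; left; apply/eqP; ring.
rewrite ler_wpM2l ?mulr_ge0 ?addr_ge0//; apply: ler_pM.
- by rewrite exprn_ge0 ?addr_ge0.
- by rewrite mulr_ge0 ?exprn_ge0 ?addr_ge0.
- exact: ler_weXn2l.
- by rewrite (exprSr _ 2) ler_wpM2l ?exprn_ge0 ?addr_ge0// lerDr.
Qed.

Variables (a : R) (g0 g1 : 'cV[R]_d -> R).
Hypothesis a0 : 0 < a.
Hypotheses (tg0 : tempered g0) (tg1 : tempered g1).

(** Squared weighted L^2 distance of the empirical oscillator functions to a target, later taken to
    be their expectation. *)
Definition osc_error n (r : 'I_n -> 'cV[R]_d) : R :=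
  gint a (fun t => (osc_mean 0 r t - g0 t) ^+ 2 +
                   (osc_mean (- (pi / 2)) r t - g1 t) ^+ 2).

Lemma le_gint b (p q : 'cV[R]_d -> R) : 0 < b -> tempered p -> tempered q ->
  (forall t, p t <= q t) -> gint b p <= gint b q.
Proof.
move=> b0 tp tq pq; apply: le_Rintegral => //; try exact: integrable_gint.
by move=> t _; rewrite ler_wpM2r// ltW// gauss_gt0.
Qed.

Lemma tempered_enorm1 k : tempered (fun t : 'cV[R]_d => (1 + enorm t) ^+ k).
Proof.
apply: temperedX; apply: temperedD; first exact: tempered_cst.
by split; [exact: measurable_fun_enorm|exact: poly_growth_enorm].
Qed.

Lemma tempered_osc_error n (r : 'I_n -> 'cV[R]_d) :
  tempered (fun t => (osc_mean 0 r t - g0 t) ^+ 2 +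
                   (osc_mean (- (pi / 2)) r t - g1 t) ^+ 2).
Proof.
by apply: temperedD; apply: temperedX; apply: temperedB => //;
  exact: tempered_osc_mean.
Qed.

Definition moment4 n (x : 'I_n -> 'cV[R]_d) : R :=
  n%:R^-1 * \sum_(j < n) (1 + enorm (x j)) ^+ 4.

(** The two empirical means differ at t by at most K (1 + |t|)^3, and (u - w)^2 <= 2 (v - w)^2 + 2
    (u - v)^2. The two phases together give the factor 4, the square the exponent 6. *)
Lemma osc_error_perturbation n (x : 'I_n -> 'cV[R]_d) (eta : R) :
  0 <= eta -> 2 * eta <= 1 -> enorm (sample_mean x) <= eta ->
  (forall v, enorm (sample_cov x *m v - v) <= eta * enorm v) ->
  osc_error (scaled_residual x) <= 2 * osc_error x +
    4 * (eta * (8 + 2 * d%:R) * moment4 x) ^+ 2 *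
    gint a (fun t : 'cV[R]_d => (1 + enorm t) ^+ 6).
Proof.
move=> eta0 eta1 hm hS; set K := eta * (8 + 2 * d%:R) * moment4 x.
have diff theta t : `|osc_mean theta (scaled_residual x) t - osc_mean theta x t| <=
    K * (1 + enorm t) ^+ 3.
  rewrite /osc_mean -mulrBr -sumrB normrM ger0_norm ?invr_ge0//.
  have -> : K * (1 + enorm t) ^+ 3 = n%:R^-1 * (eta * (8 + 2 * d%:R) *
      (\sum_(j < n) (1 + enorm (x j)) ^+ 4) * (1 + enorm t) ^+ 3).
    by rewrite /K /moment4; ring.
  rewrite ler_wpM2l ?invr_ge0// mulr_sumr mulr_suml (le_trans (ler_norm_sum _ _ _))//.
  apply: ler_sum => j _; apply: osc_perturbation => //.
  exact: scaled_residual_near.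
have sq (u v w k : R) : `|u - v| <= k -> (u - w) ^+ 2 <= 2 * (v - w) ^+ 2 + 2 * k ^+ 2.
  move=> uvk; have : (u - v) ^+ 2 <= k ^+ 2.
    by rewrite -[leLHS]real_normK ?num_real// lerXn2r ?nnegrE// (le_trans _ uvk).
  have := sqr_ge0 (u - v - (v - w)); nra.
rewrite /osc_error -!gintZ//; last 2 first.
- exact: tempered_enorm1.
- exact: tempered_osc_error.
have te := tempered_osc_error.
rewrite -gintD//; last 2 first.
- by apply: temperedM => //; exact: tempered_cst.
- by apply: temperedM; [exact: tempered_cst|exact: tempered_enorm1].
apply: le_gint => //.
- apply: temperedD; apply: temperedM => //; try exact: tempered_cst.
  exact: tempered_enorm1.
move=> t.
have := sq _ _ (g0 t) _ (diff 0 t).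
have := sq _ _ (g1 t) _ (diff (- (pi / 2)) t).
rewrite exprMn -exprM; lra.
Qed.

(** Distance of the empirical first and second moments from 0 and the identity, taken as a sum of
    squares so that its expectation is a sum of mean square errors. *)
Definition moment_error n (x : 'I_n -> 'cV[R]_d) : R :=
  \sum_i (n%:R^-1 * \sum_(j < n) x j i ord0) ^+ 2 +
  \sum_i \sum_k (n%:R^-1 * \sum_(j < n) x j i ord0 * x j k ord0 - (i == k)%:R) ^+ 2.

Lemma moment_errorP n (x : 'I_n -> 'cV[R]_d) (eta : R) :
  (0 < n)%N -> 0 <= eta -> eta <= 1 ->
  moment_error x <= (eta / (1 + d%:R + d%:R ^+ 2)) ^+ 2 ->
  enorm (sample_mean x) <= eta /\
  (forall v, enorm (sample_cov x *m v - v) <= eta * enorm v).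
Proof.
move=> n0 eta0 eta1 hQ.
have n0' : n%:R != 0 :> R by rewrite pnatr_eq0 -lt0n.
(* Every empirical moment is within k = eta / D of its target. The covariance also subtracts the
   product of the means; with s the sum of the |m_i|, s <= d k <= 1, the entries of S - I add up to
   at most d^2 k + s^2 <= d^2 k + d k <= eta. *)
set D := 1 + d%:R + d%:R ^+ 2 in hQ.
have d0 : 0 <= d%:R :> R by exact: ler0n.
have D0 : 0 < D by rewrite /D; have := sqr_ge0 (d%:R : R); lra.
set k := eta / D in hQ; have k0 : 0 <= k by rewrite divr_ge0// ltW.
have kD : k * D = eta by rewrite divfK// gt_eqF.
have sqrt_le (u : R) : u ^+ 2 <= k ^+ 2 -> `|u| <= k.
  by move=> h; rewrite -(@ler_pXn2r _ 2)// ?nnegrE// real_normK ?num_real.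
pose m := sample_mean x.
have mE i : m i ord0 = n%:R^-1 * \sum_(j < n) x j i ord0.
  by rewrite /m mxE summxE.
have A0 : 0 <= \sum_i (n%:R^-1 * \sum_(j < n) x j i ord0) ^+ 2.
  by apply: sumr_ge0 => i _; exact: sqr_ge0.
have B0 : 0 <= \sum_i \sum_k (n%:R^-1 * \sum_(j < n) x j i ord0 * x j k ord0 - (i == k)%:R) ^+ 2.
  by apply: sumr_ge0 => i _; apply: sumr_ge0 => l _; exact: sqr_ge0.
have mk i : `|m i ord0| <= k.
  apply: sqrt_le; apply: le_trans hQ; rewrite mE.
  apply: le_trans (_ : \sum_i (n%:R^-1 * \sum_(j < n) x j i ord0) ^+ 2 <= _).
    by rewrite [leRHS](bigD1 i)//= lerDl sumr_ge0// => j _; exact: sqr_ge0.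
  by rewrite lerDl.
have ck i l : `|n%:R^-1 * \sum_(j < n) x j i ord0 * x j l ord0 - (i == l)%:R| <= k.
  apply: sqrt_le; apply: le_trans hQ.
  apply: (@le_trans _ _ (\sum_i \sum_k
    (n%:R^-1 * \sum_(j < n) x j i ord0 * x j k ord0 - (i == k)%:R) ^+ 2)); last first.
    by rewrite lerDr.
  rewrite [leRHS](bigD1 i)//= [X in _ <= X + _](bigD1 l)//= -addrA lerDl addr_ge0//.
    by apply: sumr_ge0 => j _; exact: sqr_ge0.
  by apply: sumr_ge0 => j _; apply: sumr_ge0 => j' _; exact: sqr_ge0.
have m_sum : \sum_i `|m i ord0| <= d%:R * k.
  by rewrite -[d in d%:R]card_ord mulr_natl -sumr_const ler_sum.
split.
  rewrite (le_trans (enorm_le_sum _))// (le_trans m_sum)// -kD mulrC ler_wpM2l//.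
  by rewrite /D; have := sqr_ge0 (d%:R : R); lra.
move=> v.
have SE i l : sample_cov x i l =
    n%:R^-1 * (\sum_(j < n) x j i ord0 * x j l ord0) - m i ord0 * m l ord0.
  rewrite mxE summxE.
  have E j : ((x j - m) *m (x j - m)^T) i l = x j i ord0 * x j l ord0 -
      m i ord0 * x j l ord0 - x j i ord0 * m l ord0 + m i ord0 * m l ord0.
    have B i' : (x j - m) i' ord0 = x j i' ord0 - m i' ord0.
      by rewrite mxE [X in _ + X]mxE.
    by rewrite mxE big_ord1 [X in _ * X]mxE !B; ring.
  rewrite -/m; under eq_bigr do rewrite E.
  rewrite big_split/= sumrB sumrB sumr_const card_ord -mulr_sumr -mulr_suml.
  have sE p : \sum_(j < n) x j p ord0 = n%:R * m p ord0 by rewrite mE mulVKf.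
  by rewrite !sE -mulr_natl; field.
have entry i l : `|(sample_cov x - 1%:M) i l| <= k + `|m i ord0| * `|m l ord0|.
  rewrite mxE SE !mxE -mulr_natl mulr1 -addrA (addrC (- _)) addrA.
  rewrite (le_trans (ler_normB _ _))// lerD ?normrM//.
have -> : sample_cov x *m v - v = (sample_cov x - 1%:M) *m v.
  by rewrite mulmxBl mul1mx.
rewrite (le_trans (enorm_le_sum _))//.
apply: (@le_trans _ _ (\sum_i \sum_l (k + `|m i ord0| * `|m l ord0|) * enorm v)).
  apply: ler_sum => i _; rewrite [X in `|X|]mxE (le_trans (ler_norm_sum _ _ _))//.
  apply: ler_sum => l _; rewrite normrM; apply: ler_pM => //.
  exact: normr_coord_le.
under eq_bigr do rewrite -mulr_suml; rewrite -mulr_suml ler_wpM2r ?enorm_ge0//.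
under eq_bigr do rewrite big_split/= sumr_const card_ord -mulr_sumr.
rewrite big_split/= sumr_const card_ord -mulr_suml.
set s := \sum_i `|m i ord0| in m_sum *.
have s0 : 0 <= s by apply: sumr_ge0.
have s1 : s <= 1.
  apply: (le_trans m_sum); apply: le_trans eta1; rewrite -kD mulrC ler_wpM2l//.
  by rewrite /D; have := sqr_ge0 (d%:R : R); lra.
rewrite -mulrnA -mulr_natl natrM -kD.
have ss : s * s <= s by rewrite -[leRHS]mulr1 ler_wpM2l.
apply: (@le_trans _ _ (d%:R * d%:R * k + d%:R * k)).
  by rewrite lerD2l (le_trans ss).
by rewrite /D expr2; nra.
Qed.

(** Isolates what has to be proved in probability: three averages of the observations themselves, in
    which no residual occurs. *)
Lemma osc_error_small (eps K : R) : 0 < eps -> 0 <= K ->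
  exists2 k : R, 0 < k & forall n (x : 'I_n -> 'cV[R]_d), (0 < n)%N ->
    moment_error x <= k -> osc_error x <= k -> moment4 x <= K ->
    osc_error (scaled_residual x) <= eps.
Proof.
move=> eps0 K0; set J := gint a (fun t : 'cV[R]_d => (1 + enorm t) ^+ 6).
have J0 : 0 <= J.
  apply: Rintegral_ge0 => t _; rewrite mulr_ge0 ?exprn_ge0 ?addr_ge0 ?enorm_ge0//.
  exact/ltW/gauss_gt0.
set C : R := 8 + 2 * d%:R.
have C0 : 0 <= C by rewrite addr_ge0// mulr_ge0.
have W0 : 0 < 8 * ((C * K) ^+ 2 * J + 1).
  by rewrite mulr_gt0// ltr_wpDl// mulr_ge0 ?sqr_ge0.
(* The perturbation term is at most 4 eta (C K)^2 J <= eps / 2, using eta^2 <= eta; the bound eps /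
   4 on [osc_error x] contributes the other eps / 2. *)
pose eta := Num.min (1 / 2) (eps / (8 * ((C * K) ^+ 2 * J + 1))).
have eta_gt0 : 0 < eta by rewrite lt_min divr_gt0//= divr_gt0.
have eta1 : eta <= 1 / 2 by rewrite ge_min lexx.
have eta2 : eta * (8 * ((C * K) ^+ 2 * J + 1)) <= eps.
  by rewrite -ler_pdivlMr// ge_min lexx orbT.
pose k := Num.min (eps / 4) ((eta / (1 + d%:R + d%:R ^+ 2)) ^+ 2).
have D0 : 0 < 1 + d%:R + d%:R ^+ 2 :> R.
  by rewrite -addrA ltr_pwDl// addr_ge0// sqr_ge0.
exists k => [|n x n0 hQ hE hM]; first by rewrite lt_min divr_gt0//= exprn_gt0// divr_gt0.
have [hm hS] : enorm (sample_mean x) <= eta /\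
    (forall v, enorm (sample_cov x *m v - v) <= eta * enorm v).
  apply: moment_errorP => //; [exact: ltW|lra|].
  by rewrite (le_trans hQ)// ge_min lexx orbT.
apply: (le_trans (osc_error_perturbation _ _ hm hS)); [exact: ltW|lra|].
rewrite -/J -/C.
have hE' : osc_error x <= eps / 4 by rewrite (le_trans hE)// ge_min lexx.
have M0 : 0 <= moment4 x.
  rewrite mulr_ge0 ?invr_ge0// sumr_ge0// => j _.
  by rewrite exprn_ge0// addr_ge0 ?enorm_ge0.
have h1 : (eta * C * moment4 x) ^+ 2 <= eta * (C * K) ^+ 2.
  apply: (@le_trans _ _ ((eta * C * K) ^+ 2)).
    have h0 : 0 <= eta * C by rewrite mulr_ge0// ltW.
    apply: lerXn2r; [by rewrite nnegrE; exact: mulr_ge0| |exact: ler_wpM2l].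
    by rewrite nnegrE; exact: mulr_ge0.
  rewrite -mulrA exprMn ler_wpM2r ?sqr_ge0// expr2 ler_piMl ?ltW//; lra.
have h2 := ler_wpM2r J0 h1.
lra.
Qed.

End residual_perturbation.

(** * Transfer of integrals along an i.i.d. sequence *)

Section iid_sample.
Context {R : realType} {disp : measure_display} {T : measurableType disp}
  {P : probability T R} {disp' : measure_display} {T' : measurableType disp'}.
Variables (X : {RV P >-> T'}) (Xs : nat -> {RV P >-> T'}).
Hypothesis Xs_iid : iid_copies P X Xs.
Implicit Types (f h : T' -> R).

Lemma distribution_iid j (A : set T') : measurable A ->
  P (Xs j @^-1` A) = P (X @^-1` A).
Proof. by case: Xs_iid => _ h mA; exact: (h j A mA). Qed.

Lemma ge0_integral_iid j (f : T' -> \bar R) : measurable_fun setT f ->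
  (forall y, (0 <= f y)%E) -> (\int[P]_w f (Xs j w) = \int[P]_w f (X w))%E.
Proof.
move=> mf f0.
rewrite -[RHS](ge0_integral_distribution X)// -(ge0_integral_distribution (Xs j))//.
apply: eq_measure_integral => A mA _; exact: distribution_iid.
Qed.

Lemma integral_iid j (f : T' -> \bar R) : measurable_fun setT f ->
  (\int[P]_w f (Xs j w) = \int[P]_w f (X w))%E.
Proof.
move=> mf; rewrite integralE [RHS]integralE; congr (_ - _)%E.
  under eq_integral do rewrite (funepos_comp f).
  under [RHS]eq_integral do rewrite (funepos_comp f).
  by apply: (ge0_integral_iid j (f := f^\+)%E) => //; exact: measurable_funepos.
under eq_integral do rewrite (funeneg_comp f).
under [RHS]eq_integral do rewrite (funeneg_comp f).
by apply: (ge0_integral_iid j (f := f^\-)%E) => //; exact: measurable_funeneg.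
Qed.

Lemma Rintegral_iid j f : measurable_fun setT f ->
  \int[P]_w f (Xs j w) = \int[P]_w f (X w).
Proof.
move=> mf; rewrite /Rintegral; congr fine.
by apply: (integral_iid j (f := EFin \o f)); exact/measurable_EFinP.
Qed.

Lemma integrable_iid j f : measurable_fun setT f ->
  P.-integrable setT (EFin \o (f \o X)) -> P.-integrable setT (EFin \o (f \o Xs j)).
Proof.
move=> mf /integrableP[_ fX]; apply/integrableP; split.
  by apply/measurable_EFinP; exact: measurableT_comp.
have mf' : measurable_fun setT (abse \o (EFin \o f)).
  by apply: measurableT_comp => //; exact/measurable_EFinP.
have E := ge0_integral_iid j mf' (fun y => abse_ge0 (f y)%:E).
rewrite -[ltLHS]/(\int[P]_w (abse \o (EFin \o f)) (Xs j w))%E E.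
exact: fX.
Qed.

Lemma independent_pair j k (A B : set T') : j != k -> measurable A -> measurable B ->
  P (Xs j @^-1` A `&` Xs k @^-1` B) = (P (Xs j @^-1` A) * P (Xs k @^-1` B))%E.
Proof.
move=> jk mA mB; have [ind _] := Xs_iid.
have := ind [fset j; k]%fset (fun i => if i == j then A else B).
rewrite big_fsetU1 ?inE//= big_seq_fset1 eqxx eq_sym (negbTE jk) => <-; last first.
  by move=> i; case: ifP.
congr (P _); apply/seteqP; split => w /=.
  move=> [wA wB] i /=; rewrite !inE => /orP[|]/eqP ->; first by rewrite eqxx.
  by rewrite eq_sym (negbTE jk).
move=> h; split.
  by have := h j; rewrite /= !inE eqxx; exact.
by have := h k; rewrite /= !inE eqxx orbT eq_sym (negbTE jk); exact.
Qed.

Lemma measurable_Xpair j k : measurable_fun setT (fun w => (Xs j w, Xs k w)).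
Proof. by apply: measurable_fun_pair. Qed.

Lemma joint_distribution j k (D : set (T' * T')) : j != k -> measurable D ->
  (distribution P X \x distribution P X)%E D =
  pushforward_measure P (measurable_Xpair j k) D.
Proof.
move=> jk; apply: product_measure_unique => A B mA mB.
rewrite -[LHS]/(P (Xs j @^-1` A `&` Xs k @^-1` B)) independent_pair//.
by rewrite !distribution_iid.
Qed.

(** The joint law of two members of the sequence is the product of their laws, so Fubini's theorem
    on the product yields both integrability and the value. *)
Lemma integral_independent_product j k f : j != k -> measurable_fun setT f ->
  P.-integrable setT (EFin \o (f \o X)) ->
  P.-integrable setT (EFin \o (fun w => f (Xs j w) * f (Xs k w))) /\
  \int[P]_w (f (Xs j w) * f (Xs k w)) = (\int[P]_w f (X w)) ^+ 2.
Proof.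
move=> jk mf fX.
pose mu := distribution P X.
have fmu : mu.-integrable setT (EFin \o f).
  apply: integrable_pushforward => //.
  exact/measurable_EFinP.
pose F (p : T' * T') := (f p.1 * f p.2)%:E.
have mF : measurable_fun setT F.
  apply/measurable_EFinP; apply: measurable_funM.
    by apply: (measurableT_comp mf).
  by apply: (measurableT_comp mf).
pose c := \int[mu]_y f y.
have cE : (\int[mu]_y (f y)%:E = c%:E)%E.
  by rewrite /c /Rintegral fineK//; exact: integrable_fin_num.
have inner (x : T') : (\int[mu]_y F (x, y) = (f x)%:E * c%:E)%E.
  rewrite /F /=; under eq_integral do rewrite EFinM.
  by rewrite integralZl// cE.
have iF : (mu \x mu)%E.-integrable setT F.
  apply/(integrable12ltyP _ _ mF).
  have /integrableP[_ fa] := fmu.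
  rewrite [ltLHS](_ : _ = \int[mu]_x (`|(f x)%:E| * \int[mu]_y `|(f y)%:E|))%E; last first.
    apply: eq_integral => x _; rewrite -ge0_integralZl//; last first.
      by apply: measurableT_comp => //; exact/measurable_EFinP.
    by apply: eq_integral => y _; rewrite /F EFinM abseM.
  rewrite ge0_integralZr//; last 2 first.
  - by apply: measurableT_comp => //; exact/measurable_EFinP.
  - exact: integral_ge0.
  by rewrite lte_mul_pinfty// ?integral_ge0// ge0_fin_numE// integral_ge0.
have pE : forall D, measurable D -> (mu \x mu)%E D =
    pushforward_measure P (measurable_Xpair j k) D.
  by move=> D; exact: joint_distribution.
have iF' : P.-integrable setT (F \o (fun w => (Xs j w, Xs k w))).
  have /integrableP[_ Fa] := iF.
  apply/integrableP; split; first exact: (measurableT_comp mF (measurable_Xpair j k)).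
  apply: le_lt_trans Fa.
  rewrite (eq_measure_integral (pushforward_measure P (measurable_Xpair j k))); last first.
    by move=> D mD _; exact: pE.
  have mF' : measurable_fun setT (abse \o F) by exact: measurableT_comp.
  rewrite -[leRHS]/(\int[pushforward P (fun w => (Xs j w, Xs k w))]_x (abse \o F) x)%E.
  rewrite (ge0_integral_pushforward (measurable_Xpair j k))//.
  by move=> y _; exact: abse_ge0.
split=> //.
have : (\int[mu \x mu]_z F z = (c ^+ 2)%:E)%E.
  rewrite -integral12_prod_meas1//.
  rewrite [LHS](_ : _ = \int[mu]_x ((f x)%:E * c%:E))%E; last first.
    by apply: eq_integral => x _; exact: inner.
  by rewrite integralZr// cE -EFinM expr2.
rewrite (eq_measure_integral (pushforward_measure P (measurable_Xpair j k))); last first.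
  by move=> D mD _; exact: pE.
rewrite integral_pushforward//; last exact: measurable_Xpair.
rewrite preimage_setT => h.
rewrite /Rintegral [X in fine X]h /=; congr (_ ^+ 2).
rewrite /c /Rintegral; congr fine.
apply: (integral_distribution (f := EFin \o f)) => //.
exact/measurable_EFinP.
Qed.

End iid_sample.

Lemma Rintegral_sum {d} {T : measurableType d} {R : realType}
    (mu : {measure set T -> \bar R}) (I : Type) (s : seq I) (f : I -> T -> R) :
  (forall i, mu.-integrable setT (EFin \o f i)) ->
  mu.-integrable setT (EFin \o (fun x => \sum_(i <- s) f i x)) /\
  \int[mu]_x (\sum_(i <- s) f i x) = \sum_(i <- s) \int[mu]_x f i x.
Proof.
move=> fi; elim: s => [|i s [IHi IH]].
  have -> : (fun x => \sum_(i <- [::]) f i x) = cst 0 by apply/funext => x; rewrite big_nil.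
  split; first exact: integrable0.
  by rewrite big_nil /Rintegral integral0.
have -> : (fun x => \sum_(i <- i :: s) f i x) = (fun x => f i x + \sum_(i <- s) f i x).
  by apply/funext => x; rewrite big_cons.
split; last by rewrite RintegralD// IH big_cons.
exact: (integrableD _ (fi i) IHi).
Qed.

Lemma EFin_Rintegral {d} {T : measurableType d} {R : realType}
    (mu : {measure set T -> \bar R}) (f : T -> R) :
  mu.-integrable setT (EFin \o f) -> (\int[mu]_x f x)%:E = (\int[mu]_x (f x)%:E)%E.
Proof. by move=> fi; rewrite /Rintegral fineK//; exact: integrable_fin_num. Qed.

Lemma integrable_sqr_integrable {d} {T : measurableType d} {R : realType}
    (P : probability T R) (f : T -> R) : measurable_fun setT f ->
  P.-integrable setT (EFin \o (fun w => f w ^+ 2)) -> P.-integrable setT (EFin \o f).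
Proof.
move=> mf f2.
have h : P.-integrable setT (EFin \o (fun w => 1 + f w ^+ 2)).
  have h1 : P.-integrable setT (EFin \o (fun=> 1)) by exact: finite_measure_integrable_cst.
  exact: (integrableD measurableT h1 f2).
apply: le_integrable h => //; first exact/measurable_EFinP.
move=> w _ /=; rewrite lee_fin ler_norml; apply/andP; split.
  rewrite lerNl (le_trans _ (ler_norm _))//.
  have := sqr_ge0 (f w + 1); nra.
rewrite (le_trans _ (ler_norm _))//.
have := sqr_ge0 (f w - 1); nra.
Qed.

(** * The law of large numbers in mean square *)

Section mean_square.
Context {R : realType} {disp : measure_display} {T : measurableType disp}
  {P : probability T R} {disp' : measure_display} {T' : measurableType disp'}.
Variables (X : {RV P >-> T'}) (Xs : nat -> {RV P >-> T'}).
Hypothesis Xs_iid : iid_copies P X Xs.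
Implicit Types (f : T' -> R).

(** In the expanded square the off-diagonal terms vanish by independence and centering, so n of the
    n^2 terms remain. *)
Lemma mean_square_centered n f : (0 < n)%N -> measurable_fun setT f ->
  P.-integrable setT (EFin \o (fun w => f (X w) ^+ 2)) ->
  \int[P]_w f (X w) = 0 ->
  P.-integrable setT (EFin \o (fun w => (n%:R^-1 * \sum_(j < n) f (Xs j w)) ^+ 2)) /\
  \int[P]_w ((n%:R^-1 * \sum_(j < n) f (Xs j w)) ^+ 2) =
    n%:R^-1 * \int[P]_w (f (X w) ^+ 2).
Proof.
move=> n0 mf f2 f0.
have n0' : n%:R != 0 :> R by rewrite pnatr_eq0 -lt0n.
have mfX : measurable_fun setT (f \o X) by exact: measurableT_comp.
have f1 : P.-integrable setT (EFin \o (f \o X)) by exact: integrable_sqr_integrable.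
have mf2 : measurable_fun setT (fun y => f y ^+ 2) by exact: measurable_funX.
have cross (j k : 'I_n) :
    P.-integrable setT (EFin \o (fun w => f (Xs j w) * f (Xs k w))) /\
    \int[P]_w (f (Xs j w) * f (Xs k w)) =
      (if j == k then \int[P]_w (f (X w) ^+ 2) else 0).
  have [->|jk] := eqVneq j k.
    under [X in X = _]eq_Rintegral do rewrite -expr2.
    split; last exact: (Rintegral_iid Xs_iid k mf2).
    have := integrable_iid Xs_iid k mf2 f2; apply: eq_integrable => //.
  have := integral_independent_product Xs_iid jk mf f1.
  by rewrite f0 expr0n.
have E w : (n%:R^-1 * \sum_(j < n) f (Xs j w)) ^+ 2 =
    n%:R ^- 2 * \sum_(j < n) \sum_(k < n) f (Xs j w) * f (Xs k w).
  rewrite exprMn exprVn; congr (_ * _); rewrite expr2 mulr_suml.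
  by apply: eq_bigr => j _; rewrite mulr_sumr.
have row j := Rintegral_sum (index_enum 'I_n) (fun k => (cross j k).1).
have [di dE] := Rintegral_sum (index_enum 'I_n) (fun j => (row j).1).
have -> : (fun w => (n%:R^-1 * \sum_(j < n) f (Xs j w)) ^+ 2) =
    (fun w => n%:R ^- 2 * \sum_(j < n) \sum_(k < n) f (Xs j w) * f (Xs k w)).
  by apply/funext => w; exact: E.
split; first exact: (integrableZl measurableT (n%:R ^- 2) di).
rewrite RintegralZl// dE.
under eq_bigr do rewrite (row _).2.
under eq_bigr => j _.
  under eq_bigr do rewrite (cross _ _).2.
  rewrite -big_mkcond/= (big_pred1 j); last by move=> k; rewrite /= eq_sym.
  over.
by rewrite sumr_const card_ord -(mulr_natl _ n); field.
Qed.

Lemma mean_square_error n f (c : R) : (0 < n)%N -> measurable_fun setT f ->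
  P.-integrable setT (EFin \o (fun w => f (X w) ^+ 2)) ->
  c = \int[P]_w f (X w) ->
  (\int[P]_w ((n%:R^-1 * \sum_(j < n) f (Xs j w) - c) ^+ 2)%:E <=
    (n%:R^-1 * \int[P]_w (f (X w) ^+ 2))%:E)%E.
Proof.
move=> n0 mf f2 cE.
have n0' : n%:R != 0 :> R by rewrite pnatr_eq0 -lt0n.
have mfX : measurable_fun setT (f \o X) by exact: measurableT_comp.
have f1 : P.-integrable setT (EFin \o (f \o X)) by exact: integrable_sqr_integrable.
have ic k : P.-integrable setT (EFin \o (fun _ : T => k)).
  exact: finite_measure_integrable_cst.
have P1 k : \int[P]_w k = k.
  rewrite /Rintegral integral_cst//; transitivity (fine (k%:E * 1)%E).
    by congr (fine (_ * _)%E); exact: probability_setT.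
  by rewrite mule1.
pose h y := f y - c.
have mh : measurable_fun setT h by exact: measurable_funB.
have hE y : h y ^+ 2 = f y ^+ 2 - (2 * c) * f y + c ^+ 2.
  by rewrite /h; ring.
have icf : P.-integrable setT (EFin \o (fun w => (2 * c) * f (X w))).
  exact: (integrableZl measurableT (2 * c) f1).
have if2 : P.-integrable setT (EFin \o (fun w => f (X w) ^+ 2 - (2 * c) * f (X w))).
  exact: (integrableB measurableT f2 icf).
have h2 : P.-integrable setT (EFin \o (fun w => h (X w) ^+ 2)).
  have := integrableD measurableT if2 (ic (c ^+ 2)).
  by apply: eq_integrable => // w _ /=; rewrite -EFinD -hE.
have h0 : \int[P]_w h (X w) = 0 by rewrite RintegralB// P1 -cE subrr.
have [hi hiE] := mean_square_centered n0 mh h2 h0.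
have E w : (n%:R^-1 * \sum_(j < n) f (Xs j w) - c) =
    n%:R^-1 * \sum_(j < n) h (Xs j w).
  rewrite /h sumrB sumr_const card_ord -mulr_natl; by field.
under eq_integral do rewrite E.
rewrite -EFin_Rintegral// hiE lee_fin ler_wpM2l ?invr_ge0//.
under eq_Rintegral do rewrite hE.
rewrite RintegralD// RintegralB// RintegralZl// P1 -cE.
have := sqr_ge0 c; nra.
Qed.

End mean_square.

Lemma ge0_integral_sum_le {d} {T : measurableType d} {R : realType}
    (mu : {measure set T -> \bar R}) (I : Type) (s : seq I) (F : I -> T -> R)
    (c : I -> R) :
  (forall i, measurable_fun setT (F i)) -> (forall i x, 0 <= F i x) ->
  (forall i, (\int[mu]_x (F i x)%:E <= (c i)%:E)%E) ->
  (\int[mu]_x (\sum_(i <- s) F i x)%:E <= (\sum_(i <- s) c i)%:E)%E.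
Proof.
move=> mF F0 Fc; elim: s => [|i s IH].
  by rewrite big_nil; under eq_integral do rewrite big_nil; rewrite integral0.
rewrite big_cons; under eq_integral do rewrite big_cons EFinD.
rewrite ge0_integralD//; last 4 first.
- by move=> x _; rewrite lee_fin.
- exact/measurable_EFinP.
- by move=> x _; rewrite lee_fin sumr_ge0.
- by apply/measurable_EFinP; apply: measurable_sum => j.
by rewrite EFinD leeD.
Qed.

Lemma markov_le {d} {T : measurableType d} {R : realType} (P : probability T R)
    (Q : T -> R) (c k : R) : measurable_fun setT Q -> (forall w, 0 <= Q w) ->
  (\int[P]_w (Q w)%:E <= c%:E)%E -> 0 < k ->
  (P [set w | (k < Q w)%R] <= (c / k)%:E)%E.
Proof.
move=> mQ Q0 Qc k0; set A := [set w | k < Q w].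
have mA : measurable A.
  rewrite /A -[X in measurable X]setTI.
  rewrite (_ : [set w | k < Q w] = Q @^-1` `]k, +oo[); first exact: mQ.
  by apply/seteqP; split => w /=; rewrite in_itv/= andbT.
have h : (k%:E * P A <= c%:E)%E.
  rewrite -(integral_cst P mA k%:E); apply: le_trans Qc.
  apply: (@le_trans _ _ (\int[P]_(w in A) (Q w)%:E)%E).
    apply: ge0_le_integral => //.
    - by move=> w _; rewrite lee_fin ltW.
    - by apply/measurable_EFinP; exact: measurable_funTS.
    - by move=> w /ltW; rewrite lee_fin.
  apply: ge0_subset_integral => //; first exact/measurable_EFinP.
  by move=> w _; rewrite lee_fin.
by rewrite EFinM lee_pdivlMr// muleC.
Qed.

(** * Expectations of the three error terms *)

Section empirical_error.
Context {R : realType} {d : nat} {disp : measure_display} {T : measurableType disp}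
  {P : probability T R}.
Variables (X : {RV P >-> 'cV[R]_d}) (Xs : nat -> {RV P >-> 'cV[R]_d}).
Hypothesis Xs_iid : iid_copies P X Xs.
Hypothesis X4 : P.-integrable setT (EFin \o (fun w => (1 + enorm (X w)) ^+ 4)).
Variable a : R.
Hypothesis a0 : 0 < a.
Local Notation lambda := (@lebesgue_cV R d).
Let M4 := \int[P]_w ((1 + enorm (X w)) ^+ 4).

Let mX : measurable_fun setT X. Proof. by []. Qed.

Lemma moment4_ge0 : 0 <= M4.
Proof. by apply: Rintegral_ge0 => w _; rewrite exprn_ge0// addr_ge0// enorm_ge0. Qed.

(** Quadratic growth is what a fourth moment allows for a function whose square must be integrable.
    Coordinates, products of two coordinates and [osc] at a fixed t all have it. *)
Lemma sqr_integrable_growth (f : 'cV[R]_d -> R) (C : R) : 0 <= C ->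
  measurable_fun setT f ->
  (forall y, `|f y| <= C * (1 + enorm y) ^+ 2) ->
  P.-integrable setT (EFin \o (fun w => f (X w) ^+ 2)) /\
  \int[P]_w (f (X w) ^+ 2) <= C ^+ 2 * M4.
Proof.
move=> C0 mf fC.
have bnd w : f (X w) ^+ 2 <= C ^+ 2 * (1 + enorm (X w)) ^+ 4.
  rewrite -real_normK ?num_real// (exprM _ 2 2) -exprMn lerXn2r ?nnegrE//.
  by rewrite mulr_ge0// sqr_ge0.
have iC := integrableZl measurableT (C ^+ 2) X4.
have fi : P.-integrable setT (EFin \o (fun w => f (X w) ^+ 2)).
  apply: le_integrable iC => //.
    by apply/measurable_EFinP; apply: measurable_funX; exact: measurableT_comp.
  move=> w _ /=; rewrite lee_fin ger0_norm ?sqr_ge0//.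
  by rewrite (le_trans (bnd w))// ler_norm.
by split=> //; rewrite /M4 -RintegralZl//; apply: le_Rintegral.
Qed.

Lemma coord_le_growth (y : 'cV[R]_d) i : `|y i ord0| <= (1 + enorm y) ^+ 2.
Proof.
have := normr_coord_le y i; have := enorm_ge0 y; nra.
Qed.

Lemma coord2_le_growth (y : 'cV[R]_d) i k : `|y i ord0 * y k ord0| <= (1 + enorm y) ^+ 2.
Proof.
rewrite normrM expr2; apply: ler_pM => //.
  by rewrite (le_trans (normr_coord_le y i))// lerDr.
by rewrite (le_trans (normr_coord_le y k))// lerDr.
Qed.

Lemma osc_le_growth theta (y t : 'cV[R]_d) :
  `|osc theta y t| <= (1 + d%:R) * (1 + enorm t) ^+ 2 * (1 + enorm y) ^+ 2.
Proof.
rewrite /osc normrM; set Y := enorm y; set S := enorm t.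
have Y0 : 0 <= Y by exact: enorm_ge0.
have S0 : 0 <= S by exact: enorm_ge0.
have d0 : 0 <= d%:R :> R by exact: ler0n.
apply: (@le_trans _ _ (`|dotv y y + dotv t t - d%:R| * 1)).
  by rewrite ler_wpM2l// ler_norml cos_geN1 cos_le1.
rewrite mulr1 -!enorm_sqr -/Y -/S.
have h : 1 + Y ^+ 2 + S ^+ 2 <= (1 + S) ^+ 2 * (1 + Y) ^+ 2.
  have h1 : 0 <= Y * S by rewrite mulr_ge0.
  have h2 : 0 <= Y * S ^+ 2 by rewrite mulr_ge0 ?sqr_ge0.
  have h3 : 0 <= S * Y ^+ 2 by rewrite mulr_ge0 ?sqr_ge0.
  have h4 : 0 <= Y ^+ 2 * S ^+ 2 by rewrite mulr_ge0 ?sqr_ge0.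
  nra.
have Y2 := sqr_ge0 Y; have S2 := sqr_ge0 S.
have h5 := ler_wpM2l d0 h.
have h6 : 0 <= d%:R * (Y ^+ 2 + S ^+ 2) by rewrite mulr_ge0 ?addr_ge0.
rewrite ler_norml -mulrA mulrDl mul1r; apply/andP; split; nra.
Qed.

Lemma measurable_osc theta : measurable_fun setT
  (fun p : 'cV[R]_d * 'cV[R]_d => osc theta p.1 p.2).
Proof.
apply: measurable_funM.
  apply: measurable_funB => //; apply: measurable_funD.
    by apply: measurable_fun_dotv; exact: measurable_fst.
  by apply: measurable_fun_dotv; exact: measurable_snd.
apply: (measurableT_comp (f := @cos R)).
  by apply: continuous_measurable_fun; exact: continuous_cos.
apply: measurable_funD => //.
by apply: measurable_fun_dotv; [exact: measurable_snd|exact: measurable_fst].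
Qed.

Lemma measurable_osc1 theta (t : 'cV[R]_d) :
  measurable_fun setT (fun y : 'cV[R]_d => osc theta y t).
Proof.
apply: (measurableT_comp (measurable_osc theta) (g := fun y => (y, t))).
by apply: measurable_fun_pair.
Qed.

(** Real and imaginary part, for theta = 0 and theta = - pi / 2, of minus the harmonic oscillator
    applied to the characteristic function of X, with the derivatives already taken inside the
    expectation. *)
Definition osc_expect theta t : R := \int[P]_w osc theta (X w) t.

Lemma integrable_osc theta t : P.-integrable setT (EFin \o (fun w => osc theta (X w) t)).
Proof.
apply: integrable_sqr_integrable.
  exact: (measurableT_comp (measurable_osc1 theta t) mX).
have [] // := @sqr_integrable_growth (fun y => osc theta y t)
  ((1 + d%:R) * (1 + enorm t) ^+ 2).
- by rewrite mulr_ge0 ?sqr_ge0 ?addr_ge0.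
- exact: measurable_osc1.
- by move=> y; exact: osc_le_growth.
Qed.

(** Measurability in t comes from Tonelli's theorem applied to the positive and negative parts; the
    growth is quadratic by [osc_le_growth]. *)
Lemma tempered_osc_expect theta : tempered (osc_expect theta).
Proof.
split.
  pose F (p : T * 'cV[R]_d) := (osc theta (X p.1) p.2)%:E.
  have mF : measurable_fun setT F.
    apply/measurable_EFinP.
    apply: (measurableT_comp (measurable_osc theta) (g := fun p : T * 'cV[R]_d => (X p.1, p.2))).
    apply: measurable_fun_pair; last exact: measurable_snd.
    by apply: measurableT_comp.
  rewrite /osc_expect /Rintegral.
  apply: (measurableT_comp (fine_measurable measurableT)).
  rewrite (_ : (fun t => _) = (fun t => \int[P]_w F^\+ (w, t) - \int[P]_w F^\- (w, t))%E); last first.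
    apply/funext => t; rewrite integralE; congr (_ - _)%E; apply: eq_integral => w _.
      by rewrite /= !funeposE.
    by rewrite /= !funenegE.
  apply: emeasurable_funB.
    by apply: (@measurable_fun_fubini_tonelli_G _ _ _ _ _ P F^\+)%E => //; exact: measurable_funepos.
  by apply: (@measurable_fun_fubini_tonelli_G _ _ _ _ _ P F^\-)%E => //; exact: measurable_funeneg.
exists ((1 + d%:R) * M4), 2%N; split=> [|t].
  by rewrite mulr_ge0 ?addr_ge0// moment4_ge0.
rewrite /osc_expect (le_trans (le_normr_Rintegral _ (integrable_osc theta t)))//.
have -> : (1 + d%:R) * M4 * (1 + enorm t) ^+ 2 = ((1 + d%:R) * (1 + enorm t) ^+ 2) * M4 by ring.
rewrite /M4 -RintegralZl//; apply: le_Rintegral => //.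
- by have := integrable_abse (integrable_osc theta t).
- exact: (integrableZl measurableT ((1 + d%:R) * (1 + enorm t) ^+ 2) X4).
- move=> w _; rewrite (le_trans (osc_le_growth _ _ _))// ler_wpM2l//.
    by rewrite mulr_ge0 ?sqr_ge0 ?addr_ge0.
  by rewrite ler_weXn2l// lerDl enorm_ge0.
Qed.

Local Notation sample n w := (fun j : 'I_n => Xs j w).

Lemma measurable_average n (f : 'cV[R]_d -> R) : measurable_fun setT f ->
  measurable_fun setT (fun w => n%:R^-1 * \sum_(j < n) f (Xs j w)).
Proof.
move=> mf; apply: measurable_funM => //; apply: measurable_sum => j.
exact: measurableT_comp.
Qed.

Lemma measurable_coord2 i k :
  measurable_fun setT (fun y : 'cV[R]_d => y i ord0 * y k ord0).
Proof. by apply: measurable_funM; exact: measurable_coord. Qed.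

Lemma moment_error_expect n : (0 < n)%N ->
  (forall i, \int[P]_w X w i ord0 = 0) ->
  (forall i k, \int[P]_w (X w i ord0 * X w k ord0) = (i == k)%:R) ->
  (\int[P]_w (moment_error (sample n w))%:E <= (n%:R^-1 * ((d%:R + d%:R ^+ 2) * M4))%:E)%E.
Proof.
move=> n0 hm hc.
have -> : n%:R^-1 * ((d%:R + d%:R ^+ 2) * M4) =
    \sum_(i < d) (n%:R^-1 * M4) + \sum_(i < d) \sum_(k < d) (n%:R^-1 * M4).
  by rewrite !sumr_const !card_ord -mulrnA -!(mulr_natl (_ * _)) natrM; ring.
have b1 (f : 'cV[R]_d -> R) c : measurable_fun setT f ->
    (forall y, `|f y| <= (1 + enorm y) ^+ 2) -> \int[P]_w f (X w) = c ->
    (\int[P]_w ((n%:R^-1 * \sum_(j < n) f (Xs j w) - c) ^+ 2)%:E <=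
     (n%:R^-1 * M4)%:E)%E.
  move=> mf fb fc.
  have [|f2 fM] := @sqr_integrable_growth f 1 ler01 mf; first by move=> y; rewrite mul1r.
  apply: (le_trans (mean_square_error Xs_iid n0 mf f2 (esym fc))).
  by rewrite lee_fin ler_wpM2l ?invr_ge0// (le_trans fM)// expr1n mul1r.
have mav (f : 'cV[R]_d -> R) (c : R) : measurable_fun setT f ->
    measurable_fun setT (fun w => (n%:R^-1 * \sum_(j < n) f (Xs j w) - c) ^+ 2).
  by move=> mf; apply: measurable_funX; apply: measurable_funB => //; exact: measurable_average.
have mc := @measurable_coord R d.
rewrite /moment_error; under eq_integral do rewrite EFinD.
rewrite ge0_integralD//; last 4 first.
- by move=> w _; rewrite lee_fin sumr_ge0// => i _; exact: sqr_ge0.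
- apply/measurable_EFinP; apply: measurable_sum => i.
  have := mav (fun y => y i ord0) 0 (mc i); under eq_fun do rewrite subr0.
  exact.
- move=> w _; rewrite lee_fin sumr_ge0// => i _; rewrite sumr_ge0// => k _; exact: sqr_ge0.
- apply/measurable_EFinP; apply: measurable_sum => i; apply: measurable_sum => k.
  exact: (mav (fun y => y i ord0 * y k ord0)) (measurable_coord2 i k).
rewrite EFinD; apply: leeD.
  apply: ge0_integral_sum_le => i.
  - have := mav (fun y => y i ord0) 0 (mc i); under eq_fun do rewrite subr0.
    exact.
  - by move=> w; exact: sqr_ge0.
  - have := b1 (fun y => y i ord0) 0 (mc i) (fun y => coord_le_growth y i) (hm i).
    by under [X in (X <= _)%E -> _]eq_integral do rewrite subr0.
apply: ge0_integral_sum_le => i.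
- apply: measurable_sum => k; exact: (mav (fun y => y i ord0 * y k ord0)) (measurable_coord2 i k).
- by move=> w; apply: sumr_ge0 => k _; exact: sqr_ge0.
apply: ge0_integral_sum_le => k.
- exact: (mav (fun y => y i ord0 * y k ord0)) (measurable_coord2 i k).
- by move=> w; exact: sqr_ge0.
- exact: (b1 (fun y => y i ord0 * y k ord0) _ (measurable_coord2 i k)
    (fun y => coord2_le_growth y i k) (hc i k)).
Qed.

Lemma moment4_expect n : (\int[P]_w (moment4 (sample n w))%:E <= M4%:E)%E.
Proof.
have mf : measurable_fun setT (fun y : 'cV[R]_d => (1 + enorm y) ^+ 4).
  by apply: measurable_funX; apply: measurable_funD => //; exact: measurable_fun_enorm.
(* For the empty sample the average is 0, as the inverse of 0 is 0. *)
case: n => [|n].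
  rewrite /moment4; under eq_integral do rewrite invr0 mul0r.
  by rewrite integral0 lee_fin moment4_ge0.
have fi j := integrable_iid Xs_iid j mf X4.
have [si sE] := Rintegral_sum (index_enum 'I_n.+1) (fun j => fi j).
rewrite -EFin_Rintegral; last exact: (integrableZl measurableT n.+1%:R^-1 si).
rewrite lee_fin /moment4 RintegralZl// sE.
under eq_bigr do rewrite (Rintegral_iid Xs_iid _ mf).
by rewrite sumr_const card_ord -[X in _ * X]mulr_natl mulKf// pnatr_eq0.
Qed.

Let g theta := osc_expect theta.
Let sq_error n theta (w : T) t := (osc_mean theta (sample n w) t - g theta t) ^+ 2.

Lemma measurable_sq_error n theta : measurable_fun setT
  (fun p : T * 'cV[R]_d => sq_error n theta p.1 p.2).
Proof.
apply: measurable_funX; apply: measurable_funB.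
  apply: measurable_funM => //; apply: measurable_sum => j.
  apply: (measurableT_comp (measurable_osc theta)
    (g := fun p : T * 'cV[R]_d => (Xs j p.1, p.2))).
  apply: measurable_fun_pair; last exact: measurable_snd.
  exact: (measurableT_comp (f := Xs j)).
by apply: (measurableT_comp (tempered_osc_expect theta).1); exact: measurable_snd.
Qed.

Let integrand n (p : T * 'cV[R]_d) :=
  (((sq_error n 0 p.1 p.2) + (sq_error n (- (pi / 2)) p.1 p.2)) * gauss a p.2)%:E.

Let mintegrand n : measurable_fun setT (integrand n).
Proof.
apply/measurable_EFinP; apply: measurable_funM.
  by apply: measurable_funD; exact: measurable_sq_error.
by apply: (measurableT_comp (@measurable_gauss R d a)); exact: measurable_snd.
Qed.

Let integrand_ge0 n p : (0 <= integrand n p)%E.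
Proof.
rewrite lee_fin mulr_ge0 ?addr_ge0 ?sqr_ge0//; exact/ltW/gauss_gt0.
Qed.

Let err n w := osc_error a (g 0) (g (- (pi / 2))) (sample n w).

Let errE n w : ((err n w)%:E = \int[lambda]_t integrand n (w, t))%E.
Proof.
rewrite /err /osc_error /gint EFin_Rintegral//.
by apply: integrable_gint => //; apply: tempered_osc_error; exact: tempered_osc_expect.
Qed.

Lemma measurable_osc_error n : measurable_fun setT (err n).
Proof.
apply/measurable_EFinP; rewrite (_ : _ \o _ = fubini_F lambda (integrand n)); last first.
  by apply/funext => w /=; rewrite errE.
exact: measurable_fun_fubini_tonelli_F.
Qed.

(** Tonelli's theorem moves the expectation inside the weighted integral, where the real-valued mean
    square bound applies at each t separately. The quadratic growth in t is squared, hence the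
    fourth power. *)
Lemma osc_error_expect n : (0 < n)%N ->
  (\int[P]_w (err n w)%:E <= (n%:R^-1 * (2 * (1 + d%:R) ^+ 2 * M4 *
    gint a (fun t : 'cV[R]_d => (1 + enorm t) ^+ 4)))%:E)%E.
Proof.
move=> n0; under eq_integral do rewrite errE.
rewrite -[leLHS]/(\int[P]_w fubini_F lambda (integrand n) w)%E.
rewrite (fubini_tonelli (integrand n))//.
set C := n%:R^-1 * (1 + d%:R) ^+ 2 * M4.
have C0 : 0 <= C by rewrite /C !mulr_ge0 ?invr_ge0 ?sqr_ge0 ?moment4_ge0.
have -> : n%:R^-1 * (2 * (1 + d%:R) ^+ 2 * M4 *
    gint a (fun t : 'cV[R]_d => (1 + enorm t) ^+ 4)) =
    (2 * C) * gint a (fun t : 'cV[R]_d => (1 + enorm t) ^+ 4) by rewrite /C; ring.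
have te := @tempered_enorm1 R d 4.
rewrite -gintZ// /gint EFin_Rintegral; last first.
  by apply: integrable_gint => //; apply: temperedM => //; exact: tempered_cst.
have mse theta t : measurable_fun setT (fun w => sq_error n theta w t).
  apply: (measurableT_comp (measurable_sq_error n theta) (g := fun w => (w, t))).
  by apply: measurable_fun_pair.
have bound theta t : (\int[P]_w (sq_error n theta w t)%:E <=
    (C * (1 + enorm t) ^+ 4)%:E)%E.
  have k0 : 0 <= (1 + d%:R) * (1 + enorm t) ^+ 2 by rewrite mulr_ge0 ?sqr_ge0 ?addr_ge0.
  have [f2 fM] := sqr_integrable_growth k0 (measurable_osc1 theta t)
    (fun y => osc_le_growth theta y t).
  apply: (le_trans (mean_square_error Xs_iid n0 (measurable_osc1 theta t) f2 erefl)).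
  rewrite lee_fin /C -!mulrA ler_wpM2l ?invr_ge0// (le_trans fM)//.
  by rewrite le_eqVlt; apply/orP; left; apply/eqP; ring.
apply: ge0_le_integral => //.
- by move=> t _; apply: integral_ge0 => w _; exact: integrand_ge0.
- exact: measurable_fun_fubini_tonelli_G.
- apply/measurable_EFinP; apply: measurable_funM; last exact: measurable_gauss.
  by apply: measurable_funM => //; exact: te.1.
move=> t _; rewrite /fubini_G /integrand/=.
under eq_integral do rewrite mulrC EFinM.
rewrite ge0_integralZl//; last 3 first.
- by apply/measurable_EFinP; apply: measurable_funD; exact: mse.
- by move=> w _; rewrite lee_fin addr_ge0 ?sqr_ge0.
- by rewrite lee_fin ltW// gauss_gt0.
rewrite [X in (_ <= X%:E)%E]mulrC EFinM; apply: lee_wpmul2l; first by rewrite lee_fin ltW// gauss_gt0.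
under eq_integral do rewrite EFinD.
rewrite ge0_integralD//; last 4 first.
- by move=> w _; rewrite lee_fin sqr_ge0.
- by apply/measurable_EFinP; exact: mse.
- by move=> w _; rewrite lee_fin sqr_ge0.
- by apply/measurable_EFinP; exact: mse.
rewrite (_ : 2 * C * (1 + enorm t) ^+ 4 = C * (1 + enorm t) ^+ 4 + C * (1 + enorm t) ^+ 4);
  last by ring.
by rewrite EFinD leeD.
Qed.

End empirical_error.

(** * Convergence of the residual energy in probability *)

Section good_event.
Context {R : realType} {d : nat} {disp : measure_display} {T : measurableType disp}
  {P : probability T R}.
Variables (X : {RV P >-> 'cV[R]_d}) (Xs : nat -> {RV P >-> 'cV[R]_d}).
Hypothesis Xs_iid : iid_copies P X Xs.
Hypothesis X4 : P.-integrable setT (EFin \o (fun w => (1 + enorm (X w)) ^+ 4)).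
Hypothesis X_mean : forall i, \int[P]_w X w i ord0 = 0.
Hypothesis X_cov : forall i k, \int[P]_w (X w i ord0 * X w k ord0) = (i == k)%:R.
Variable a : R.
Hypothesis a0 : 0 < a.
Local Notation sample n w := (fun j : 'I_n => Xs j w).

(** Markov's inequality for the three averages of [osc_error_small], each failing with probability
    at most delta / 3. The event G is defined by these averages, so no measurability of the residual
    error is involved. *)
Lemma osc_error_residual_to0 (eps delta : R) : 0 < eps -> 0 < delta ->
  exists N : nat, forall n : nat, (N <= n)%N -> exists G : set T,
    [/\ measurable G, (P (~` G) <= delta%:E)%E & forall w, G w ->
     osc_error a (osc_expect X 0) (osc_expect X (- (pi / 2)))
       (scaled_residual (sample n w)) <= eps].
Proof.
move=> eps0 delta0; set g0 := osc_expect X 0; set g1 := osc_expect X (- (pi / 2)).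
have tg theta : tempered (osc_expect X theta) by exact: tempered_osc_expect.
set M4 := \int[P]_w ((1 + enorm (X w)) ^+ 4).
have M40 : 0 <= M4 by exact: moment4_ge0.
(* Markov's inequality at level K leaves probability at most delta / 3; the added 1 keeps K
   positive. *)
pose K := 3 * (M4 + 1) / delta.
have K0 : 0 < K by rewrite divr_gt0// mulr_gt0// ltr_wpDl.
have [k k0 hk] := osc_error_small a0 (tg 0) (tg (- (pi / 2))) eps0 (ltW K0).
pose C1 := (d%:R + d%:R ^+ 2) * M4.
pose C2 := 2 * (1 + d%:R) ^+ 2 * M4 * gint a (fun t : 'cV[R]_d => (1 + enorm t) ^+ 4).
have C10 : 0 <= C1 by rewrite mulr_ge0 ?addr_ge0 ?sqr_ge0.
have C20 : 0 <= C2.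
  rewrite !mulr_ge0 ?sqr_ge0//; apply: Rintegral_ge0 => t _.
  by rewrite mulr_ge0 ?exprn_ge0 ?addr_ge0 ?enorm_ge0//; exact/ltW/gauss_gt0.
(* Beyond this N the expectations C1 / n and C2 / n, divided by the level k, are at most delta /
   3. *)
have [N hN] : exists N : nat, 3 * (C1 + C2) / (k * delta) <= N%:R.
  have := archi_boundP (divr_ge0 (mulr_ge0 (ler0n R 3) (addr_ge0 C10 C20))
    (mulr_ge0 (ltW k0) (ltW delta0))).
  by move=> /ltW h; eexists; exact: h.
exists N.+1 => n Nn.
have n0 : (0 < n)%N by exact: leq_ltn_trans Nn.
have nR0 : 0 < n%:R :> R by rewrite ltr0n.
have nbound (C : R) : 0 <= C -> C <= C1 + C2 -> n%:R^-1 * C / k <= delta / 3.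
  move=> C0 CC; rewrite ler_pdivrMr// mulrC ler_pdivrMr//.
  rewrite ler_pdivrMr ?mulr_gt0// in hN.
  have : N%:R * (k * delta) <= n%:R * (k * delta).
    by rewrite ler_pM2r ?mulr_gt0// ler_nat ltnW.
  lra.
pose Q1 w := moment_error (sample n w).
pose Q2 w := osc_error a g0 g1 (sample n w).
pose Q3 w := moment4 (sample n w).
have mQ1 : measurable_fun setT Q1.
  apply: measurable_funD.
    apply: measurable_sum => i; apply: measurable_funX.
    by apply: (measurable_average Xs n (f := fun y => y i ord0)); exact: measurable_coord.
  apply: measurable_sum => i; apply: measurable_sum => l; apply: measurable_funX.
  apply: measurable_funB => //.
  by apply: (measurable_average Xs n (f := fun y => y i ord0 * y l ord0)); exact: measurable_coord2.
have mQ2 : measurable_fun setT Q2 by exact: measurable_osc_error.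
have mQ3 : measurable_fun setT Q3.
  apply: (measurable_average Xs n (f := fun y => (1 + enorm y) ^+ 4)).
  by apply: measurable_funX; apply: measurable_funD => //; exact: measurable_fun_enorm.
have Q10 w : 0 <= Q1 w.
  apply: addr_ge0; apply: sumr_ge0 => i _; first exact: sqr_ge0.
  by apply: sumr_ge0 => l _; exact: sqr_ge0.
have Q20 w : 0 <= Q2 w.
  apply: Rintegral_ge0 => t _; rewrite mulr_ge0 ?addr_ge0 ?sqr_ge0//.
  exact/ltW/gauss_gt0.
have Q30 w : 0 <= Q3 w.
  rewrite mulr_ge0 ?invr_ge0// sumr_ge0// => j _.
  by rewrite exprn_ge0// addr_ge0// enorm_ge0.
have p1 := markov_le mQ1 Q10 (moment_error_expect Xs_iid X4 n0 X_mean X_cov) k0.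
have p2 := markov_le mQ2 Q20 (osc_error_expect Xs_iid X4 a0 n0) k0.
have p3 := markov_le mQ3 Q30 (moment4_expect Xs_iid X4 n) K0.
have mset (Q : T -> R) c : measurable_fun setT Q -> measurable [set w | c < Q w].
  move=> mQ; rewrite -[X in measurable X]setTI.
  rewrite (_ : [set w | c < Q w] = Q @^-1` `]c, +oo[); first exact: mQ.
  by apply/seteqP; split => w /=; rewrite in_itv/= andbT.
set A1 := [set w | k < Q1 w] in p1; set A2 := [set w | k < Q2 w] in p2.
set A3 := [set w | K < Q3 w] in p3.
have mA1 : measurable A1 by exact: mset.
have mA2 : measurable A2 by exact: mset.
have mA3 : measurable A3 by exact: mset.
exists (~` (A1 `|` A2 `|` A3)); split.
- by apply: measurableC; apply: measurableU => //; exact: measurableU.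
- rewrite setCK.
  have p3' : (P A3 <= (delta / 3)%:E)%E.
    apply: (le_trans p3); rewrite lee_fin /K -/M4.
    rewrite invf_div mulrA ler_pdivrMr ?mulr_gt0 ?ltr_wpDl//; nra.
  have p1' : (P A1 <= (delta / 3)%:E)%E.
    by apply: (le_trans p1); rewrite lee_fin; apply: nbound => //; rewrite lerDl.
  have p2' : (P A2 <= (delta / 3)%:E)%E.
    by apply: (le_trans p2); rewrite lee_fin; apply: nbound => //; rewrite lerDr.
  apply: (@le_trans _ _ ((P A1 + P A2) + P A3)%E).
    apply: (le_trans (measureU2 P _ mA3)); first exact: measurableU.
    by rewrite leeD2r// measureU2.
  have -> : (delta%:E = ((delta / 3)%:E + (delta / 3)%:E) + (delta / 3)%:E)%E.
    by rewrite -!EFinD; congr EFin; field.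
  by rewrite leeD// leeD.
move=> w; rewrite /A1 /A2 /A3 !setCU /= => -[[/negP h1 /negP h2] /negP h3].
by apply: hk => //; rewrite leNgt.
Qed.

End good_event.

(** * The normal law is the only one with zero energy *)

Section zero_energy.
Context {R : realType} {d : nat}.
Local Notation lambda := (@lebesgue_cV R d).

Lemma gauss_ge0 b (t : 'cV[R]_d) : 0 <= gauss b t.
Proof. exact/ltW/gauss_gt0. Qed.

(** On the unit cube, of measure 1, the weight is at least exp(- b d). *)
Lemma gint1_gt0 b : 0 < b -> 0 < gint b (fun _ : 'cV[R]_d => 1).
Proof.
move=> b0.
pose box : set 'cV[R]_d := [set v | forall i, `[0, 1]%classic (v i ord0)].
have box1 : lambda box = 1%E.
  rewrite (@lebesgue_cV_box _ _ (fun _ => `[0%R, 1%R]%classic))//.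
  by rewrite big1// => i _; rewrite lebesgue_measure_itv/= lte_fin ltr01 sube0.
have mbox : measurable box.
  rewrite (_ : box = \bigcap_(i in [set: 'I_d]) ((fun v : 'cV[R]_d => v i ord0) @^-1` `[0, 1])).
    apply: fin_bigcap_measurable => // i _; rewrite -[X in measurable X]setTI.
    exact: measurable_coord.
  by apply/seteqP; split => v /= h i; [move=> _; exact: h|exact: h].
have i1 := integrable_gint b0 (tempered_cst 1) (d := d).
rewrite -lte_fin EFin_Rintegral//.
apply: (@lt_le_trans _ _ (expR (- (b * d%:R)))%:E).
  by rewrite lte_fin expR_gt0.
rewrite -[leLHS]mule1 -box1 -(integral_cst _ mbox).
apply: (@le_trans _ _ (\int[lambda]_(t in box) (1 * gauss b t)%:E)%E); last first.
  apply: ge0_subset_integral => //; first exact: (measurable_int _ i1).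
  by move=> t _; rewrite lee_fin mul1r ltW// gauss_gt0.
apply: ge0_le_integral => //.
- by move=> t _; rewrite lee_fin expR_ge0.
- exact: (measurable_funTS (measurable_int _ i1)).
move=> t tbox /=; rewrite lee_fin mul1r ler_expR lerN2 ler_wpM2l ?(ltW b0)//.
rewrite dotvE -[d in d%:R]card_ord -sumr_const ler_sum// => i _.
have := tbox i; rewrite /= in_itv/= => /andP[t0 t1].
by rewrite -[leRHS]mulr1 ler_pM.
Qed.

Section expectation.
Context {disp : measure_display} {T : measurableType disp} {P : probability T R}.
Variable Y : {RV P >-> 'cV[R]_d}.
Hypothesis Y4 : P.-integrable setT (EFin \o (fun w => (1 + enorm (Y w)) ^+ 4)).
Variable a : R.
Hypothesis a0 : 0 < a.
Hypothesis energy0 : gint a (fun t => osc_expect Y 0 t ^+ 2 +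
  osc_expect Y (- (pi / 2)) t ^+ 2) = 0.

Let mY : measurable_fun setT Y. Proof. by []. Qed.

Let tg theta : tempered (osc_expect Y theta).
Proof. exact: tempered_osc_expect. Qed.

Lemma osc_expect_ae0 : {ae lambda, forall t,
  osc_expect Y 0 t = 0 /\ osc_expect Y (- (pi / 2)) t = 0}.
Proof.
pose q t := osc_expect Y 0 t ^+ 2 + osc_expect Y (- (pi / 2)) t ^+ 2.
have tq : tempered q by apply: temperedD; apply: temperedX; exact: tg.
have q0 t : 0 <= q t by rewrite addr_ge0 ?sqr_ge0.
have iq := integrable_gint a0 tq.
have mq := measurable_int _ iq.
have : (\int[lambda]_t `|(q t * gauss a t)%:E| = 0)%E.
  rewrite -[RHS]/(0%:E) -energy0 /gint EFin_Rintegral//.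
  apply: eq_integral => t _; rewrite /= ger0_norm// mulr_ge0//.
  exact/ltW/gauss_gt0.
move/(ae_eq_integral_abs _ measurableT mq); apply: filterS => t /= /(_ I) [].
move/eqP; rewrite mulf_eq0 (gt_eqF (gauss_gt0 a t)) orbF paddr_eq0 ?sqr_ge0//.
by rewrite !sqrf_eq0 => /andP[/eqP -> /eqP ->].
Qed.

(** Real part of exp(- i t.c) times the oscillator function at y. By [shiftedE] its expectation
    vanishes wherever both [osc_expect] do, for every c. *)
Let shifted (c : 'cV[R]_d) (y t : 'cV[R]_d) : R :=
  (dotv y y + dotv t t - d%:R) * cos (dotv t (y - c) + 0).

Let shiftedE c y t : shifted c y t =
  cos (dotv t c) * osc 0 y t + sin (dotv t c) * osc (- (pi / 2)) y t.
Proof.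
rewrite /shifted /osc cosBpihalf !addr0 dotvBr cosB; ring.
Qed.

Let measurable_shifted c : measurable_fun setT
  (fun p : 'cV[R]_d * 'cV[R]_d => shifted c p.1 p.2).
Proof.
under eq_fun do rewrite shiftedE.
have m2 : measurable_fun setT (fun p : 'cV[R]_d * 'cV[R]_d => dotv p.2 c).
  by apply: measurable_fun_dotv; [exact: measurable_snd|exact: measurable_cst].
apply: measurable_funD; apply: measurable_funM; try exact: measurable_osc.
  by apply: (measurableT_comp (f := @cos R)) => //;
    apply: continuous_measurable_fun; exact: continuous_cos.
by apply: (measurableT_comp (f := @sin R)) => //;
  apply: continuous_measurable_fun; exact: continuous_sin.
Qed.

Let shifted_le c y t : `|shifted c y t| <=
  (1 + d%:R) * (1 + enorm t) ^+ 2 * (1 + enorm y) ^+ 2.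
Proof.
have := osc_le_growth (- dotv t c) y t.
by rewrite /osc /shifted dotvBr addr0.
Qed.

Let Y2 : P.-integrable setT (EFin \o (fun w => (1 + enorm (Y w)) ^+ 2)).
Proof.
apply: integrable_sqr_integrable.
  by apply: measurable_funX; apply: measurable_funD => //; exact: measurable_fun_enorm.
by apply: eq_integrable Y4 => // w _ /=; rewrite -exprM.
Qed.

(** The almost everywhere vanishing function is tested against exp(- i t.c) times a Gaussian weight.
    Exchanging the integrals leaves, inside the expectation, the Fourier transforms computed above
    at z = Y - c. The free parameters b and c are what the next step needs. *)
Lemma gaussian_moment0 b c : 0 < b ->
  \int[P]_w ((dotv (Y w) (Y w) - d%:R + d%:R / (2 * b) -
      dotv (Y w - c) (Y w - c) / (4 * b ^+ 2)) *
    expR (- (dotv (Y w - c) (Y w - c) / (4 * b)))) = 0.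
Proof.
move=> b0.
pose F (p : T * 'cV[R]_d) := (shifted c (Y p.1) p.2 * gauss b p.2)%:E.
have mF : measurable_fun setT F.
  apply/measurable_EFinP; apply: measurable_funM.
    apply: (measurableT_comp (measurable_shifted c) (g := fun p : T * 'cV[R]_d => (Y p.1, p.2))).
    apply: measurable_fun_pair; last exact: measurable_snd.
    exact: (measurableT_comp mY).
  by apply: (measurableT_comp (@measurable_gauss R d b)); exact: measurable_snd.
have te2 := @tempered_enorm1 R d 2.
have d10 : 0 <= 1 + d%:R :> R by rewrite addr_ge0.
have iF : (P \x lambda)%E.-integrable setT F.
  apply/(integrable12ltyP _ _ mF).
  (* The majorant is a function of t times a function of Y, so the double integral is bounded by a
     product of two finite integrals. *)
  pose J := gint b (fun t : 'cV[R]_d => (1 + d%:R) * (1 + enorm t) ^+ 2).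
  have tJ : tempered (fun t : 'cV[R]_d => (1 + d%:R) * (1 + enorm t) ^+ 2).
    by apply: temperedM => //; exact: tempered_cst.
  have iJ := integrable_gint b0 tJ.
  apply: (@le_lt_trans _ _ (\int[P]_w (J * (1 + enorm (Y w)) ^+ 2)%:E)%E).
    apply: ge0_le_integral => //.
    - by move=> w _; exact: integral_ge0.
    - apply: (@measurable_fun_fubini_tonelli_F _ _ _ _ _ lambda (abse \o F)) => [|x].
        exact: measurableT_comp.
      exact: abse_ge0.
    - apply/measurable_EFinP; apply: measurable_funM => //; apply: measurable_funX.
      by apply: measurable_funD => //; exact: measurable_fun_enorm.
    move=> w _; rewrite mulrC EFinM /J /gint EFin_Rintegral//.
    have mJ : measurable_fun setT
        (fun t : 'cV[R]_d => ((1 + d%:R) * (1 + enorm t) ^+ 2 * gauss b t)%:E).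
      by apply/measurable_EFinP; apply: measurable_funM;
        [exact: tJ.1|exact: measurable_gauss].
    have J0 (t : 'cV[R]_d) : setT t -> (0 <= ((1 + d%:R) * (1 + enorm t) ^+ 2 * gauss b t)%:E)%E.
      move=> _; rewrite lee_fin.
      exact: (mulr_ge0 (mulr_ge0 d10 (sqr_ge0 (1 + enorm t))) (gauss_ge0 b t)).
    have W0 : (0 <= ((1 + enorm (Y w)) ^+ 2)%:E)%E by rewrite lee_fin sqr_ge0.
    rewrite -(ge0_integralZl lambda measurableT mJ J0 W0).
    apply: ge0_le_integral => //.
    - apply: measurableT_comp => //.
      apply: (measurableT_comp mF (g := fun t => (w, t))).
      by apply: measurable_fun_pair.
    - exact: measurable_funeM.
    move=> t _; rewrite /F /= lee_fin normrM mulrA.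
    rewrite [X in _ * X]ger0_norm ?(ltW (gauss_gt0 _ _))//.
    by rewrite ler_wpM2r ?(ltW (gauss_gt0 _ _))// [leRHS]mulrC; exact: shifted_le.
  have := integrableZl measurableT J Y2.
  move=> /integrableP[_]; apply: le_lt_trans.
  apply: ge0_le_integral => //.
  - move=> w _; rewrite lee_fin mulr_ge0 ?sqr_ge0//.
    apply: Rintegral_ge0 => t _.
    exact: (mulr_ge0 (mulr_ge0 d10 (sqr_ge0 (1 + enorm t))) (gauss_ge0 b t)).
  - apply/measurable_EFinP; apply: measurable_funM => //; apply: measurable_funX.
    by apply: measurable_funD => //; exact: measurable_fun_enorm.
  - apply: measurableT_comp => //; apply/measurable_EFinP; apply: measurable_funM => //.
    apply: measurable_funX.
    by apply: measurable_funD => //; exact: measurable_fun_enorm.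
  by move=> w _; rewrite /= lee_fin ler_norm.
have := Fubini iF.
(* With the expectation taken first, the inner integral vanishes for almost every t; the other
   order, treated next, gives the explicit formula. *)
have -> : (\int[lambda]_t \int[P]_w F (w, t) = 0)%E.
  transitivity (\int[lambda]_t (cst 0%E t))%E; last by rewrite integral0.
  apply: ae_eq_integral => //.
    by apply: (@measurable_fubini_G _ _ _ _ _ P lambda).
  apply: filterS osc_expect_ae0 => t [g0 g1] _ /=.
  have is0 := integrable_osc Y4 0 t; have is1 := integrable_osc Y4 (- (pi / 2)) t.
  have ic : P.-integrable setT (EFin \o (fun w => cos (dotv t c) * osc 0 (Y w) t)).
    exact: (integrableZl measurableT _ is0).
  have iS : P.-integrable setT (EFin \o (fun w => sin (dotv t c) * osc (- (pi / 2)) (Y w) t)).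
    exact: (integrableZl measurableT _ is1).
  have isum : P.-integrable setT (EFin \o (fun w => cos (dotv t c) * osc 0 (Y w) t +
      sin (dotv t c) * osc (- (pi / 2)) (Y w) t)).
    exact: (integrableD measurableT ic iS).
  rewrite /F /=; under eq_integral do rewrite mulrC EFinM shiftedE.
  rewrite integralZl// -EFin_Rintegral//.
  rewrite RintegralD// !RintegralZl// -![\int[P]_w osc _ _ _]/(osc_expect Y _ t).
  by rewrite g0 g1 !mulr0 addr0 mule0.
pose I := gint b (fun _ : 'cV[R]_d => 1).
have innerE w : (\int[lambda]_t F (w, t) = (I *
   ((dotv (Y w) (Y w) - d%:R + d%:R / (2 * b) -
      dotv (Y w - c) (Y w - c) / (4 * b ^+ 2)) *
    expR (- (dotv (Y w - c) (Y w - c) / (4 * b)))))%:E)%E.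
  set z := Y w - c; set A := dotv (Y w) (Y w).
  have tc : tempered (fun t : 'cV[R]_d => cos (dotv t z + 0)).
    by apply: tempered_cos; apply: temperedD; [exact: tempered_dotv|exact: tempered_cst].
  have tc2 : tempered (fun t : 'cV[R]_d => dotv t t * cos (dotv t z + 0)).
    by apply: temperedM => //; exact: tempered_dotvv.
  have tc0 : tempered (fun t : 'cV[R]_d => (A - d%:R) * cos (dotv t z + 0)).
    by apply: temperedM => //; exact: tempered_cst.
  have -> : (\int[lambda]_t F (w, t) = (gint b (fun t => dotv t t * cos (dotv t z + 0) +
      (A - d%:R) * cos (dotv t z + 0)))%:E)%E.
    rewrite /gint EFin_Rintegral; last by apply: integrable_gint => //; exact: temperedD.
    by apply: eq_integral => t _; rewrite /F /shifted -/z -/A; congr EFin => /=; ring.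
  rewrite gintD// gintZ// gint_dotvv_cos// gint_cos// cos0 mul1r -/I.
  congr EFin; ring.
under eq_integral do rewrite innerE.
move=> E.
have I0 : I != 0 by rewrite gt_eqF// gint1_gt0.
set h := (fun w => _) in E *.
pose H w := (dotv (Y w) (Y w) - d%:R + d%:R / (2 * b) -
      dotv (Y w - c) (Y w - c) / (4 * b ^+ 2)) *
    expR (- (dotv (Y w - c) (Y w - c) / (4 * b))).
rewrite -[LHS]/(\int[P]_w H w).
have iH : P.-integrable setT (EFin \o (fun w => I * H w)).
  have := integrable_fubini_F iF; apply: eq_integrable => // w _.
  by rewrite /fubini_F innerE.
have iH' : P.-integrable setT (EFin \o H).
  have := integrableZl measurableT I^-1 iH; apply: eq_integrable => // w _.
  by rewrite /= -EFinM mulKf.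
have : I * \int[P]_w H w = 0 by rewrite -RintegralZl// /Rintegral E.
by move/eqP; rewrite mulf_eq0 (negbTE I0) => /eqP.
Qed.

Implicit Types (u : R) (k y : 'cV[R]_d).

(* Mehler's kernel: the solution operator at time s of the heat equation of the
   harmonic oscillator, up to normalization and with u = coth s. *)
Definition mehler (k : 'cV[R]_d) (u : R) (y : 'cV[R]_d) : R :=
  expR (- (u / 4 * dotv (y - k) (y - k) + dotv (y + k) (y + k) / (4 * u))).

Definition mehler_expect k u : R := \int[P]_w mehler k u (Y w).

Lemma mehler_gt0 k u y : 0 < mehler k u y.
Proof. exact: expR_gt0. Qed.

Lemma mehler_le1 k u y : 0 < u -> mehler k u y <= 1.
Proof.
move=> u0; rewrite -expR0 ler_expR oppr_le0 addr_ge0//.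
  by rewrite mulr_ge0 ?dotvv_ge0// divr_ge0// ltW.
by rewrite divr_ge0 ?dotvv_ge0// mulr_ge0// ltW.
Qed.

Lemma measurable_mehler_pair u : measurable_fun setT
  (fun p : 'cV[R]_d * 'cV[R]_d => mehler p.2 u p.1).
Proof.
have ms : measurable_fun setT (fun p : 'cV[R]_d * 'cV[R]_d => p.1 - p.2).
  by apply: measurable_fun_subv; [exact: measurable_fst|exact: measurable_snd].
have ma : measurable_fun setT (fun p : 'cV[R]_d * 'cV[R]_d => p.1 + p.2).
  by apply: measurable_fun_addv; [exact: measurable_fst|exact: measurable_snd].
apply: measurableT_comp => //; apply: measurable_funN; apply: measurable_funD.
  by apply: measurable_funM => //; exact: measurable_fun_dotv.
by apply: measurable_funM => //; exact: measurable_fun_dotv.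
Qed.

Lemma measurable_mehler k u : measurable_fun setT (mehler k u).
Proof.
apply: (measurableT_comp (measurable_mehler_pair u) (g := fun y => (y, k))).
by apply: measurable_fun_pair.
Qed.

Lemma integrable_mehler k u : 0 < u -> P.-integrable setT (EFin \o (mehler k u \o Y)).
Proof.
move=> u0.
have h1 : P.-integrable setT (EFin \o (fun=> 1)) by exact: finite_measure_integrable_cst.
apply: le_integrable h1 => //.
  by apply/measurable_EFinP; exact: (measurableT_comp (measurable_mehler k u)).
move=> w _ /=; rewrite lee_fin normr1 ger0_norm ?mehler_le1//.
exact/ltW/mehler_gt0.
Qed.

Let mehler' k u y : R := (- (dotv (y - k) (y - k) / 4) +
   dotv (y + k) (y + k) / (4 * u ^+ 2)) * mehler k u y.

Let is_derive_mehler k u y : 0 < u ->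
  is_derive u 1 (fun u => mehler k u y) (mehler' k u y).
Proof.
move=> u0; have un : u != 0 by rewrite gt_eqF.
have -> : (fun u => mehler k u y) = (fun u =>
    expR (- (u * (dotv (y - k) (y - k) / 4) + dotv (y + k) (y + k) / 4 * u^-1))).
  apply/funext => v; rewrite /mehler invfM; apply: (congr1 (expR (R := R))).
  move: (dotv (y - k) _) (dotv (y + k) _) => A B; ring.
have h := rderiv_expR (rderivN (rderivD (rderivM (rderiv_id u)
  (rderiv_cst u (dotv (y - k) (y - k) / 4)))
  (rderivZ (dotv (y + k) (y + k) / 4) (rderiv_inv un (rderiv_id u))))).
apply: (is_derive_eq h); rewrite /mehler' /mehler.
have -> : u / 4 * dotv (y - k) (y - k) + dotv (y + k) (y + k) / (4 * u) =
  u * (dotv (y - k) (y - k) / 4) + dotv (y + k) (y + k) / 4 / u by field.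
by field.
Qed.

(** Writing the kernel as exp(- g), its derivative is at most u^-1 g exp(- g), where g exp(- g) <= 1
    and u^-1 <= 2. So a constant dominates on u > 1/2, a neighbourhood of the value u = 1 at which
    the comparison starts. *)
Let mehler'_le k u y : 1 / 2 < u -> `|mehler' k u y| <= 4.
Proof.
move=> u2; have u0 : 0 < u by lra.
rewrite /mehler'; set A := dotv (y - k) (y - k); set B := dotv (y + k) (y + k).
have A0 : 0 <= A by exact: dotvv_ge0.
have B0 : 0 <= B by exact: dotvv_ge0.
pose g := u / 4 * A + B / (4 * u).
have un : u != 0 by rewrite gt_eqF.
have e1 : g * expR (- g) <= 1.
  rewrite -ler_pdivlMr ?expR_gt0// div1r -expRN opprK.
  by rewrite (le_trans _ (expR_ge1Dx g))// lerDr.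
have h : `|- (A / 4) + B / (4 * u ^+ 2)| <= u^-1 * g.
  have -> : u^-1 * g = A / 4 + B / (4 * u ^+ 2) by rewrite /g; field.
  have Bu : 0 <= B / (4 * u ^+ 2) by rewrite divr_ge0// mulr_ge0// sqr_ge0.
  rewrite ler_norml; apply/andP; split; lra.
rewrite -[mehler k u y]/(expR (- g)) normrM [X in _ * X]ger0_norm ?expR_ge0//.
apply: (@le_trans _ _ (u^-1 * (g * expR (- g)))).
  by rewrite (mulrA u^-1); apply: ler_wpM2r => //; exact: expR_ge0.
have ui : u^-1 <= 2 by rewrite -[2]invrK lef_pV2 ?posrE//; lra.
have g0 : 0 <= g.
  apply: addr_ge0; first by apply: mulr_ge0 => //; apply: divr_ge0 => //; exact: ltW.
  by apply: divr_ge0 => //; apply: mulr_ge0 => //; exact: ltW.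
apply: (@le_trans _ _ (2 * 1)); last by rewrite mulr1 ler_nat.
apply: ler_pM => //; first by rewrite invr_ge0 ltW.
by apply: mulr_ge0 => //; exact: expR_ge0.
Qed.

Let is_derive_mehler_expect0 k u : 1 / 2 < u ->
  is_derive u 1 (mehler_expect k) (\int[P]_w mehler' k u (Y w)).
Proof.
move=> u2.
apply: (@is_derive_under_Rintegral R _ _ P (fun u w => mehler k u (Y w))
  (fun u w => mehler' k u (Y w)) u (1 / 2) (u + 1) (fun=> 4)).
- by rewrite in_itv/= u2 ltrDl ltr01.
- move=> x; rewrite in_itv/= => /andP[x1 _]; apply: integrable_mehler; lra.
- move=> x w; rewrite in_itv/= => /andP[x1 _]; apply: is_derive_mehler; lra.
- exact: finite_measure_integrable_cst.
- by move=> x w; rewrite in_itv/= => /andP[x1 _]; exact: mehler'_le.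
Qed.

Lemma derivable_mehler_expect k u : 1 / 2 < u -> derivable (mehler_expect k) u 1.
Proof. by move=> /(is_derive_mehler_expect0 k) []. Qed.

(** After completing the square in y, [gaussian_moment0] says that (u^2 - 1) F' + d (u - 1)^2 / (2
    u) F = 0. Dividing by u^2 - 1 requires u > 1. Neither k nor the law of Y is left in the
    coefficient. *)
Lemma derive_mehler_expect k u : 1 < u ->
  is_derive u 1 (mehler_expect k)
    (- (d%:R * (u - 1) / (2 * u * (u + 1))) * mehler_expect k u).
Proof.
move=> u1; have u0 : 0 < u by lra.
have un : u != 0 by rewrite gt_eqF.
have u1n : u + 1 != 0 by rewrite gt_eqF//; lra.
have u1m : u - 1 != 0 by rewrite gt_eqF// subr_gt0.
have uu : u ^+ 2 + 1 != 0 by rewrite gt_eqF// ltr_wpDl// sqr_ge0.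
have h2 : 1 / 2 < u by lra.
apply: (is_derive_eq (is_derive_mehler_expect0 k h2)).
(* These values complete the square: u/4 |y - k|^2 + |y + k|^2 / (4 u) = |y - e k|^2 / (4 b) + |k|^2
   u / (u^2 + 1), and C is the exponential of minus the last term. *)
pose b := u / (u ^+ 2 + 1).
have b0 : 0 < b by rewrite divr_gt0// ltr_wpDl// sqr_ge0.
pose e := (u ^+ 2 - 1) / (u ^+ 2 + 1).
pose C := expR (- (dotv k k * (u / (u ^+ 2 + 1)))).
have H := gaussian_moment0 (e *: k) b0.
have im : P.-integrable setT (EFin \o (mehler k u \o Y)) by exact: integrable_mehler.
have mm' : measurable_fun setT (fun w => mehler' k u (Y w)).
  apply: measurable_funM; last exact: (measurableT_comp (measurable_mehler k u)).
  have mD (v : 'cV[R]_d) : measurable_fun setT (fun w => dotv (Y w + v) (Y w + v)).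
    by apply: measurable_fun_dotv; apply: measurable_fun_addv => //; exact: measurable_cst.
  apply: measurable_funD; first by apply: measurable_funN; apply: measurable_funM => //.
  exact: measurable_funM.
have im' : P.-integrable setT (EFin \o (fun w => mehler' k u (Y w))).
  have h1 : P.-integrable setT (EFin \o (fun=> 4)) by exact: finite_measure_integrable_cst.
  apply: le_integrable h1 => //; first exact/measurable_EFinP.
  by move=> w _ /=; rewrite lee_fin (le_trans (mehler'_le _ _ h2))// ler_norm.
have E w : (dotv (Y w) (Y w) - d%:R + d%:R / (2 * b) -
      dotv (Y w - e *: k) (Y w - e *: k) / (4 * b ^+ 2)) *
    expR (- (dotv (Y w - e *: k) (Y w - e *: k) / (4 * b))) =
    C^-1 * (((u ^+ 2 - 1) * mehler' k u (Y w)) +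
      d%:R * (u - 1) ^+ 2 / (2 * u) * mehler k u (Y w)).
  rewrite /mehler'; set y := Y w.
  have -> : expR (- (dotv (y - e *: k) (y - e *: k) / (4 * b))) = C^-1 * mehler k u y.
    rewrite /C -expRN -expRD; congr expR; rewrite !dotvL (dotvC k y) /b /e.
    by field; rewrite un.
  suff -> : dotv y y - d%:R + d%:R / (2 * b) -
      dotv (y - e *: k) (y - e *: k) / (4 * b ^+ 2) =
      (u ^+ 2 - 1) * (- (dotv (y - k) (y - k) / 4) +
        dotv (y + k) (y + k) / (4 * u ^+ 2)) + d%:R * (u - 1) ^+ 2 / (2 * u).
    by rewrite mulrCA; congr (_ * _); rewrite mulrDl -!mulrA.
  rewrite !dotvL (dotvC k y) /b /e; field.
  by rewrite un uu.
move: H; under eq_Rintegral do rewrite E.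
have i1 : P.-integrable setT (EFin \o (fun w => (u ^+ 2 - 1) * mehler' k u (Y w))).
  exact: (integrableZl measurableT (u ^+ 2 - 1) im').
have i2 : P.-integrable setT (EFin \o (fun w => d%:R * (u - 1) ^+ 2 / (2 * u) * mehler k u (Y w))).
  exact: (integrableZl measurableT _ im).
have i3 : P.-integrable setT (EFin \o (fun w => (u ^+ 2 - 1) * mehler' k u (Y w) +
   d%:R * (u - 1) ^+ 2 / (2 * u) * mehler k u (Y w))).
  exact: (integrableD measurableT i1 i2).
rewrite RintegralZl// RintegralD// !RintegralZl//.
rewrite -/(mehler_expect k u).
move/eqP; rewrite mulf_eq0 invr_eq0 gt_eqF ?expR_gt0//= addr_eq0 => /eqP h.
have uu1 : u ^+ 2 - 1 != 0 by rewrite subr_sqr_1 mulf_neq0.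
apply: (mulfI uu1); rewrite h; field.
by rewrite un u1n.
Qed.

Lemma mehler_expect_gt0 k u : 0 < u -> 0 < mehler_expect k u.
Proof.
move=> u0; have i := integrable_mehler k u0.
have m0 w : 0 <= mehler k u (Y w) by exact/ltW/mehler_gt0.
rewrite lt_neqAle Rintegral_ge0// andbT eq_sym; apply/eqP => F0.
have mm : measurable_fun setT (EFin \o (mehler k u \o Y)) by exact: measurable_int i.
have : (\int[P]_w `|(mehler k u (Y w))%:E| = 0)%E.
  rewrite -[RHS]/(0%:E) -F0 /mehler_expect EFin_Rintegral//.
  by apply: eq_integral => w _; rewrite gee0_abs// lee_fin.
move/(ae_eq_integral_abs _ measurableT mm) => [Z [mZ Z0 ZT]].
have ZE : Z = setT.
  apply/seteqP; split=> // w _; apply: ZT => /= /(_ I) [].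
  by apply/eqP; rewrite gt_eqF// mehler_gt0.
have : P setT = 0%E by rewrite -ZE.
have -> : P setT = 1%E by exact: probability_setT.
by move=> /eqP; rewrite eqe oner_eq0.
Qed.

End expectation.

End zero_energy.

(** * Recovering a law from its Mehler expectations as u tends to infinity *)

Section mollification.
Context {R : realType} {d : nat}.
Local Notation V := 'cV[R]_d.
Local Notation lambda := (@lebesgue_cV R d).

(** The square makes the displacement [lam n *: s] eventually smaller than the margin 1 / (n + 1) by
    which orthants are enlarged below. *)
Definition lam (n : nat) : R := n.+1%:R ^- 2.

Lemma lam_gt0 n : 0 < lam n.
Proof. by rewrite invr_gt0 exprn_gt0. Qed.

Lemma lam_le1 n : lam n <= 1.
Proof. by rewrite invf_le1 ?exprn_gt0// exprn_ege1// ler1n. Qed.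

Lemma cvg_lam : lam n @[n --> \oo] --> (0 : R).
Proof.
have h := @cvg_harmonic R.
have : harmonic n * harmonic n @[n --> \oo] --> (0 * 0 : R) by exact: cvgM.
rewrite mul0r; apply: cvg_trans; apply: near_eq_cvg; near=> n.
by rewrite /lam /harmonic/= expr2 invfM.
Unshelve. all: by end_near. Qed.

(* Substituting k = y + lam n *: s and u = 4 / lam n ^+ 2 in Mehler's kernel. *)
Definition smear_weight n (y s : V) : R :=
  expR (- (dotv s s + lam n ^+ 2 / 16 *
    dotv (2 *: y + lam n *: s) (2 *: y + lam n *: s))).

(** Up to the factor [lam n ^+ d], the integral of Mehler's kernel over k in A: a mollified
    indicator of A, whose width [lam n] tends to 0. *)
Definition smear (A : set V) n (y : V) : \bar R :=
  (\int[lambda]_s (\1_A (y + lam n *: s) * smear_weight n y s)%:E)%E.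

Lemma smear_weight_ge0 n y s : 0 <= smear_weight n y s.
Proof. exact: expR_ge0. Qed.

Lemma smear_weight_le n y s : smear_weight n y s <= gauss 1 s.
Proof.
rewrite ler_expR mul1r lerN2 lerDl mulr_ge0 ?dotvv_ge0//.
by rewrite divr_ge0// sqr_ge0.
Qed.

Lemma mehler_smear n (y s : V) :
  mehler (y + lam n *: s) (4 / lam n ^+ 2) y = smear_weight n y s.
Proof.
have l0 : lam n != 0 by rewrite gt_eqF// lam_gt0.
rewrite /mehler /smear_weight; congr (expR (- _)).
by rewrite !dotvL (dotvC s y); field.
Qed.

Lemma measurable_indic_smear A n : measurable A -> measurable_fun setT
  (fun p : V * V => \1_A (p.1 + lam n *: p.2) * smear_weight n p.1 p.2).
Proof.
move=> mA.
have ms : measurable_fun setT (fun p : V * V => lam n *: p.2).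
  by apply: measurable_fun_scalev; [exact: measurable_cst|exact: measurable_snd].
apply: measurable_funM.
  apply: (measurableT_comp (measurable_indic mA)).
  by apply: measurable_fun_addv => //; exact: measurable_fst.
apply: measurableT_comp => //; apply: measurable_funN; apply: measurable_funD.
  by apply: measurable_fun_dotv; exact: measurable_snd.
apply: measurable_funM => //.
have m2 : measurable_fun setT (fun p : V * V => 2 *: p.1 + lam n *: p.2).
  apply: measurable_fun_addv => //.
  by apply: measurable_fun_scalev; [exact: measurable_cst|exact: measurable_fst].
exact: measurable_fun_dotv.
Qed.

Lemma measurable_smear A n : measurable A -> measurable_fun setT (smear A n).
Proof.
move=> mA; apply: (@measurable_fun_fubini_tonelli_F _ _ _ _ _ lambda
  (fun p : V * V => (\1_A (p.1 + lam n *: p.2) * smear_weight n p.1 p.2)%:E)).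
  by apply/measurable_EFinP; exact: measurable_indic_smear.
by move=> p; rewrite lee_fin mulr_ge0// smear_weight_ge0.
Qed.

Lemma mehler_integral_smear A n (y : V) : measurable A ->
  (\int[lambda]_k (\1_A k * mehler k (4 / lam n ^+ 2) y)%:E =
   (lam n ^+ d)%:E * smear A n y)%E.
Proof.
move=> mA; rewrite (ge0_integral_cV_scale y (lam_gt0 n)); last 2 first.
- apply/measurable_EFinP; apply: measurable_funM => //.
  apply: (measurableT_comp (measurable_mehler_pair (4 / lam n ^+ 2)) (g := fun k => (y, k))).
  by apply: measurable_fun_pair.
- by move=> k; rewrite lee_fin mulr_ge0// ltW// mehler_gt0.
congr (_ * _)%E; apply: eq_integral => s _.
by rewrite mehler_smear.
Qed.

Lemma measurable_smear_row A n (y : V) : measurable A ->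
  measurable_fun setT (fun s : V => (\1_A (y + lam n *: s) * smear_weight n y s)%:E).
Proof.
move=> mA; apply/measurable_EFinP.
apply: (measurableT_comp (measurable_indic_smear n mA) (g := fun s => (y, s))).
by apply: measurable_fun_pair.
Qed.

Let I1 : R := gint 1 (fun _ : V => 1).

Let I1E : (\int[lambda]_s (gauss 1 s)%:E = I1%:E)%E.
Proof.
rewrite /I1 /gint EFin_Rintegral; last exact: (integrable_gint _ (tempered_cst 1)).
by apply: eq_integral => s _; rewrite mul1r.
Qed.

Lemma smear_le A n (y : V) : measurable A -> (smear A n y <= I1%:E)%E.
Proof.
move=> mA; rewrite -I1E; apply: ge0_le_integral => //.
- by move=> s _; rewrite lee_fin mulr_ge0// smear_weight_ge0.
- exact: measurable_smear_row.
- by apply/measurable_EFinP; exact: measurable_gauss.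
move=> s _; rewrite lee_fin -[leRHS]mul1r; apply: ler_pM => //.
- exact: smear_weight_ge0.
- exact: smear_weight_le.
Qed.

Lemma smear_ge0 A n (y : V) : (0 <= smear A n y)%E.
Proof. by apply: integral_ge0 => s _; rewrite lee_fin mulr_ge0// smear_weight_ge0. Qed.

Lemma cvg_smear_weight (y s : V) :
  smear_weight n y s @[n --> \oo] --> gauss 1 s.
Proof.
have l := cvg_lam.
pose q n := lam n * (lam n * ((4 * dotv y y + lam n * (4 * dotv y s)
  + lam n * (lam n * dotv s s)) / 16)).
have c0 (c : R) : (fun _ : nat => c) n @[n --> \oo] --> c by exact: cvg_cst.
have cM (f g : nat -> R) (u v : R) : f n @[n --> \oo] --> u ->
    g n @[n --> \oo] --> v -> f n * g n @[n --> \oo] --> u * v.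
  by move=> fu gv; exact: cvgM.
have cD (f g : nat -> R) (u v : R) : f n @[n --> \oo] --> u ->
    g n @[n --> \oo] --> v -> f n + g n @[n --> \oo] --> u + v.
  by move=> fu gv; exact: cvgD.
have q0 : q n @[n --> \oo] --> (0 : R).
  have c2 := cM _ _ _ _ l (cM _ _ _ _ l (c0 (dotv s s))).
  have c1 := cD _ _ _ _ (cD _ _ _ _ (c0 (4 * dotv y y))
    (cM _ _ _ _ l (c0 (4 * dotv y s)))) c2.
  have := cM _ _ _ _ l (cM _ _ _ _ l (cM _ _ _ _ c1 (c0 16^-1))).
  by rewrite mul0r.
have e : (dotv s s + q n) @[n --> \oo] --> dotv s s.
  by have := cD _ _ _ _ (c0 (dotv s s)) q0; rewrite addr0.
have eN : - (dotv s s + q n) @[n --> \oo] --> - dotv s s by exact: cvgN.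
have : expR (- (dotv s s + q n)) @[n --> \oo] --> expR (- dotv s s).
  by apply: continuous_cvg => //; exact: continuous_expR.
rewrite /gauss mul1r; apply: cvg_trans; apply: near_eq_cvg; near=> n.
rewrite /smear_weight /q; congr (expR (- (_ + _))).
by rewrite !dotvL (dotvC s y); field.
Unshelve. all: by end_near. Qed.

Section limit.
Variables (A : set V) (An : nat -> set V).
Hypothesis mA : measurable A.
Hypothesis mAn : forall n, measurable (An n).
Hypothesis An_cvg : forall y s : V,
  \1_(An n) (y + lam n *: s) @[n --> \oo] --> (\1_A y : R).

(** Dominated convergence, with [gauss 1] as majorant. With A itself in place of [An n], the
    indicator at y + lam n s need not converge to that at y when y is on the boundary; this is why
    the sets vary with n. *)
Lemma cvg_smear (y : V) :
  smear (An n) n y @[n --> \oo] --> (I1 * \1_A y)%:E.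
Proof.
have -> : (I1 * \1_A y)%:E = (\int[lambda]_s (\1_A y * gauss 1 s)%:E)%E.
  under eq_integral do rewrite EFinM.
  rewrite ge0_integralZl//; last 2 first.
  - by apply/measurable_EFinP; exact: measurable_gauss.
  - by move=> s _; rewrite lee_fin gauss_ge0.
  by rewrite I1E -EFinM mulrC.
apply: (@dominated_cvg _ _ _ lambda setT measurableT _ _ (EFin \o gauss 1)) => //.
- by move=> n; exact: measurable_smear_row.
- move=> s _; apply: cvg_EFin; first exact: nearW.
  by apply: cvgM => //; exact: cvg_smear_weight.
- exact: integrable_gauss.
- move=> n s _; rewrite lee_fin ger0_norm ?mulr_ge0 ?smear_weight_ge0//.
  rewrite -[leRHS]mul1r; apply: ler_pM => //.
  + exact: smear_weight_ge0.
  + exact: smear_weight_le.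
Qed.

Lemma cvg_expect_smear {disp} {T : measurableType disp} (P : probability T R)
    (Y : {RV P >-> V}) :
  (\int[P]_w smear (An n) n (Y w))%E @[n --> \oo] -->
  (I1%:E * P (Y @^-1` A))%E.
Proof.
have mY : measurable (Y @^-1` A) by rewrite -[X in measurable X]setTI; exact: measurable_funPT.
have -> : (I1%:E * P (Y @^-1` A) = \int[P]_w (I1 * \1_A (Y w))%:E)%E.
  rewrite -[X in (_ * P X)%E]setIT -integral_indic// -ge0_integralZl//.
  - by apply/measurable_EFinP.
  - by rewrite lee_fin ltW// gint1_gt0.
apply: (@dominated_cvg _ _ _ P setT measurableT _ _ (EFin \o (fun=> I1))) => //.
- move=> n; apply: (measurableT_comp (measurable_smear n (mAn n))) => //.
- by move=> w _; exact: cvg_smear.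
- exact: finite_measure_integrable_cst.
- by move=> n w _; rewrite gee0_abs ?smear_ge0// smear_le.
Qed.

End limit.

Lemma expect_mehler_smear {disp} {T : measurableType disp} (P : probability T R)
    (Y : {RV P >-> V}) A n : measurable A ->
  (\int[lambda]_k (\1_A k * mehler_expect Y k (4 / lam n ^+ 2))%:E =
   (lam n ^+ d)%:E * \int[P]_w smear A n (Y w))%E.
Proof.
move=> mA; set u := 4 / lam n ^+ 2.
have u0 : 0 < u by rewrite divr_gt0// exprn_gt0// lam_gt0.
pose F (p : T * V) := (\1_A p.2 * mehler p.2 u (Y p.1))%:E.
have mF : measurable_fun setT F.
  apply/measurable_EFinP; apply: measurable_funM.
    by apply: (measurableT_comp (measurable_indic mA)); exact: measurable_snd.
  apply: (measurableT_comp (measurable_mehler_pair u) (g := fun p : T * V => (Y p.1, p.2))).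
  apply: measurable_fun_pair; last exact: measurable_snd.
  exact: (measurableT_comp (f := Y)).
have F0 p : (0 <= F p)%E by rewrite lee_fin mulr_ge0// ltW// mehler_gt0.
rewrite -ge0_integralZl//; last 3 first.
- by apply: (measurableT_comp (measurable_smear n mA)).
- by move=> w _; exact: smear_ge0.
- by rewrite lee_fin exprn_ge0// ltW// lam_gt0.
transitivity (\int[P]_w fubini_F lambda F w)%E; last first.
  by apply: eq_integral => w _; rewrite -mehler_integral_smear.
rewrite fubini_tonelli//; apply: eq_integral => k _.
rewrite /fubini_G /F/=; under eq_integral do rewrite EFinM.
rewrite ge0_integralZl//.
- by rewrite EFinM /mehler_expect EFin_Rintegral//; exact: integrable_mehler.
- by apply: (measurable_int P); exact: integrable_mehler.
- by move=> w _; rewrite lee_fin ltW// mehler_gt0.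
Qed.

(** The bounds are extended reals so that the whole space is an orthant, as the uniqueness theorem
    for measures on a pi-system requires. *)
Definition orthant (b : 'I_d -> \bar R) : set V :=
  [set v : V | forall i, ((v i ord0)%:E <= b i)%E].

Lemma measurable_orthant b : measurable (orthant b).
Proof.
rewrite (_ : orthant b = \bigcap_(i in [set: 'I_d])
    ((fun v : V => v i ord0) @^-1` [set x | (x%:E <= b i)%E])).
  apply: fin_bigcap_measurable => // i _.
  rewrite -[X in measurable X]setTI; apply: measurable_coord => //.
  case: (b i) => [r| |].
  - rewrite (_ : [set x | _] = `]-oo, r]%classic); first exact: measurable_itv.
    by apply/seteqP; split => x /=; rewrite lee_fin in_itv.
  - rewrite (_ : [set x | _] = setT)//.
    by apply/seteqP; split => // x _ /=; rewrite leey.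
  - rewrite (_ : [set x | _] = set0)//.
    by apply/seteqP; split.
by apply/seteqP; split => v /= h i; [move=> _; exact: h|exact: h].
Qed.

(** At a point of the closed orthant the margin 1 / (n + 1) eventually exceeds the displacement,
    which is of order 1 / (n + 1)^2. At any other point some coordinate exceeds its bound by a fixed
    gap, or the bound is -oo, and margin and displacement together become smaller than the gap. *)
Lemma cvg_indic_orthant (b : 'I_d -> \bar R) (y s : V) :
  \1_(orthant (fun i => b i + (n.+1%:R^-1)%:E)%E) (y + lam n *: s) @[n --> \oo] -->
  (\1_(orthant b) y : R).
Proof.
have lamE n : lam n = n.+1%:R^-1 * n.+1%:R^-1 by rewrite /lam expr2 invfM.
pose M := \sum_i `|s i ord0|.
have sM i : `|s i ord0| <= M by rewrite /M (bigD1 i)//= lerDl sumr_ge0.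
have M0 : 0 <= M by apply: sumr_ge0.
have coordE n i : (y + lam n *: s) i ord0 = y i ord0 + lam n * s i ord0.
  by rewrite !mxE.
apply: cvg_near_cst; have [yb|yb] := pselect (orthant b y).
  near=> n; rewrite !indicE !mem_set// => i; rewrite coordE.
  have n0 : 0 < n.+1%:R^-1 :> R by rewrite invr_gt0.
  have nM : M <= n.+1%:R.
    by rewrite (@le_trans _ _ n%:R) ?ler_nat//; near: n; exact: nbhs_infty_ger.
  have h : lam n * s i ord0 <= n.+1%:R^-1.
    rewrite lamE -mulrA ler_piMr ?(ltW n0)// mulrC ler_pdivrMr// mul1r.
    by rewrite (le_trans (ler_norm _))// (le_trans (sM i)).
  rewrite EFinD; apply: leeD; first exact: yb.
  by rewrite lee_fin.
have [i yi] : exists i, (b i < (y i ord0)%:E)%E.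
  apply/not_existsP => h; apply: yb => i.
  by rewrite leNgt; apply/negP; exact: h.
case E : (b i) yi => [r| |]//; last first.
  move=> _; near=> n; rewrite !indicE (memNset yb) memNset// => /(_ i).
  by rewrite coordE E.
rewrite lte_fin => ry; near=> n.
rewrite !indicE (memNset yb) memNset// => /(_ i).
have n0 : 0 < n.+1%:R^-1 :> R by rewrite invr_gt0.
rewrite coordE E -EFinD lee_fin => h.
(* From such n on, margin and displacement, together at most (1 + M) / (n + 1), are below the
   gap. *)
have : (1 + M) / (y i ord0 - r) < n.+1%:R.
  rewrite (@le_lt_trans _ _ n%:R) ?ltr_nat//.
  by near: n; exact: nbhs_infty_ger.
rewrite ltr_pdivrMr ?subr_gt0// => h2.
have h3 : - (lam n * s i ord0) <= n.+1%:R^-1 * M.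
  rewrite lamE -mulrN -mulrA ler_wpM2l ?(ltW n0)//.
  apply: (@le_trans _ _ `|s i ord0|) => //.
  rewrite (le_trans (ler_norm _))// normrM normrN ler_piMl// gtr0_norm//.
  by rewrite invf_le1// ler1n.
have h4 : y i ord0 - r <= n.+1%:R^-1 * (1 + M).
  rewrite mulrDr mulr1; move: h h3.
  by set q := n.+1%:R^-1; set p := lam n * _; set z := q * M; lra.
by move: h4; rewrite mulrC ler_pdivlMr// mulrC leNgt h2.
Unshelve. all: by end_near. Qed.

End mollification.

(** * Measures are determined by orthants *)

Section orthant_pi_system.
Context {R : realType} {d : nat}.
Local Notation V := 'cV[R]_d.

Let orthants : set (set V) := [set A | exists b, A = orthant b].

Let orthants_setI : setI_closed orthants.
Proof.
move=> _ _ [b ->] [c ->]; exists (fun i => mine (b i) (c i)).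
apply/seteqP; split => [v [/= vb vc] i|v h].
  by rewrite le_min vb vc.
by split => i; have := h i; rewrite le_min => /andP[].
Qed.

Let orthant_setT : orthant (fun=> +oo%E) = [set: V].
Proof. by apply/seteqP; split => // v _ i; rewrite leey. Qed.

Let orthants_generate : @measurable _ V = <<s orthants >>.
Proof.
apply/seteqP; split; last first.
  apply: smallest_sub; first exact: sigma_algebra_measurable.
  by move=> _ [b ->]; exact: measurable_orthant.
move=> A; apply: smallest_sub => //.
move=> _ [i [j [B mB ->]]]; rewrite (ord1 j).
pose TG := g_sigma_algebraType orthants.
have mc : measurable_fun [set: TG] (fun v : TG => (v : V) i ord0).
  apply: (measurability _ (RGenOInfty.measurableE R)) => _ [_ [x ->] <-].
  rewrite setTI.
  have -> : (fun v : TG => (v : V) i ord0) @^-1` `]x, +oo[ =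
      ~` (orthant (fun k => if k == i then x%:E else +oo%E)).
    apply/seteqP; split => v /=; rewrite in_itv/= andbT.
      by move=> xv /(_ i); rewrite eqxx lee_fin leNgt xv.
    move=> h; rewrite ltNge; apply/negP => vx; apply: h => k.
    by case: eqP => [->|_]; rewrite ?lee_fin ?leey.
  by apply: measurableC; apply: sub_sigma_algebra; eexists; reflexivity.
by have := mc measurableT _ mB; rewrite setTI.
Qed.

Lemma eq_measure_orthant (m1 m2 : {measure set V -> \bar R}) :
  (forall b, m1 (orthant b) = m2 (orthant b)) -> (m1 setT < +oo)%E ->
  forall A, measurable A -> m1 A = m2 A.
Proof.
move=> m12 m1T; apply: (measure_unique orthants (fun=> setT)) => //.
- by move=> _; exists (fun=> +oo%E); rewrite orthant_setT.
- by rewrite bigcup_const.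
- by move=> _ [b ->].
Qed.

End orthant_pi_system.

(** * Two laws with zero energy coincide *)

Section uniqueness.
Context {R : realType} {d : nat}.
Local Notation V := 'cV[R]_d.
Local Notation lambda := (@lebesgue_cV R d).
Context {disp : measure_display} {T : measurableType disp} {P : probability T R}.
Context {disp0 : measure_display} {T0 : measurableType disp0} {P0 : probability T0 R}.
Variables (Y : {RV P >-> V}) (N : {RV P0 >-> V}).
Hypothesis Y4 : P.-integrable setT (EFin \o (fun w => (1 + enorm (Y w)) ^+ 4)).
Hypothesis N4 : P0.-integrable setT (EFin \o (fun w => (1 + enorm (N w)) ^+ 4)).
Variable a : R.
Hypothesis a0 : 0 < a.
Hypothesis Y0 : gint a (fun t => osc_expect Y 0 t ^+ 2 +
  osc_expect Y (- (pi / 2)) t ^+ 2) = 0.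
Hypothesis N0 : gint a (fun t => osc_expect N 0 t ^+ 2 +
  osc_expect N (- (pi / 2)) t ^+ 2) = 0.

(* Both expectations solve the same linear first-order equation in u. *)
Lemma mehler_expect_ratio k u : 1 <= u ->
  mehler_expect Y k u * mehler_expect N k 1 = mehler_expect Y k 1 * mehler_expect N k u.
Proof.
move=> u1; pose r v := mehler_expect Y k v * (mehler_expect N k v)^-1.
have Fn v : 1 / 2 < v -> mehler_expect N k v != 0.
  by move=> v2; rewrite gt_eqF// mehler_expect_gt0//; lra.
have dr v : v \in `]1, u[ -> is_derive v 1 r 0.
  rewrite in_itv/= => /andP[v1 _].
  have v2 : 1 / 2 < v by lra.
  have h := rderivM (derive_mehler_expect Y4 a0 Y0 k v1)
    (rderiv_inv (Fn v v2) (derive_mehler_expect N4 a0 N0 k v1)).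
  apply: (is_derive_eq h); field.
  by rewrite Fn//= !gt_eqF//; lra.
(* The differential equation is known for u > 1 only; differentiability from 1/2 on gives continuity
   up to the endpoint 1. *)
have cr : {within `[1, u], continuous r}.
  apply: derivable_within_continuous => v; rewrite in_itv/= => /andP[v1 _].
  have v2 : 1 / 2 < v by lra.
  have dY : derivable (mehler_expect Y k) v 1 by exact: derivable_mehler_expect.
  have dN : derivable (mehler_expect N k) v 1 by exact: derivable_mehler_expect.
  by apply: derivableM; [exact: dY|apply: derivableV; [exact: Fn|exact: dN]].
have F1 : mehler_expect N k 1 != 0 by apply: Fn; lra.
have Fu : mehler_expect N k u != 0 by apply: Fn; lra.
move: F1 Fu (rderiv0_constant u1 cr dr); rewrite /r.
move: (mehler_expect N k 1) (mehler_expect N k u) => n1 nu n10 nu0.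
move: (mehler_expect Y k 1) (mehler_expect Y k u) => y1 yu h.
by apply/eqP; rewrite -eqr_div// h.
Qed.

(** At u = 1 the parallelogram law turns the exponent into - (|y|^2 + |k|^2) / 2, which separates k
    from y whatever the law of X. *)
Lemma mehler_expect1 {disp'} {T' : measurableType disp'} {Q : probability T' R}
    (X : {RV Q >-> V}) k :
  mehler_expect X k 1 = expR (- (dotv k k / 2)) * mehler_expect X 0 1.
Proof.
rewrite /mehler_expect -RintegralZl//; last exact: integrable_mehler.
apply: eq_Rintegral => w _; rewrite /mehler -expRD; congr expR.
by rewrite subr0 addr0 !dotvL (dotvC k (X w)); field.
Qed.

(** The ratio of the two expectations depends neither on u, by the differential equation, nor on k,
    by the factorization at u = 1. It can therefore be pulled out of integrals over k. *)
Lemma mehler_expect_proportional k u : 1 <= u ->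
  mehler_expect Y k u * mehler_expect N 0 1 = mehler_expect N k u * mehler_expect Y 0 1.
Proof.
move=> u1; have := mehler_expect_ratio k u1.
rewrite (mehler_expect1 N) (mehler_expect1 Y) mulrCA -mulrA.
by move=> /(mulfI (lt0r_neq0 (expR_gt0 _))) ->; rewrite mulrC.
Qed.

Let beta := mehler_expect N 0 1.
Let alpha := mehler_expect Y 0 1.

Lemma measurable_mehler_expect {disp'} {T' : measurableType disp'}
    {Q : probability T' R} (X : {RV Q >-> V}) u : 0 < u ->
  measurable_fun setT (fun k => mehler_expect X k u).
Proof.
move=> u0; apply/measurable_EFinP.
pose F (p : T' * V) := (mehler p.2 u (X p.1))%:E.
have mF : measurable_fun setT F.
  apply/measurable_EFinP.
  apply: (measurableT_comp (measurable_mehler_pair u) (g := fun p : T' * V => (X p.1, p.2))).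
  apply: measurable_fun_pair; last exact: measurable_snd.
  exact: (measurableT_comp (f := X)).
have F0 p : (0 <= F p)%E by rewrite lee_fin ltW// mehler_gt0.
have := @measurable_fun_fubini_tonelli_G _ _ T' V R Q F mF F0.
apply: eq_measurable_fun => k _.
by rewrite /fubini_G /= /mehler_expect EFin_Rintegral//; exact: integrable_mehler.
Qed.

Lemma smear_proportional A n : measurable A ->
  (beta%:E * \int[P]_w smear A n (Y w) = alpha%:E * \int[P0]_w smear A n (N w))%E.
Proof.
move=> mA; set u := 4 / (@lam R n) ^+ 2.
have l0 := @lam_gt0 R n; have l1 := @lam_le1 R n.
have u1 : 1 <= u.
  rewrite ler_pdivlMr ?exprn_gt0// mul1r (le_trans _ (_ : 1 <= 4))//.
    by rewrite exprn_ile1// ltW.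
  by rewrite ler1n.
have ld : (0 < (@lam R n) ^+ d)%R by rewrite exprn_gt0.
have ge0Y k : (0 <= (\1_A k * mehler_expect Y k u)%:E)%E.
  by rewrite lee_fin mulr_ge0// ltW// mehler_expect_gt0//; lra.
have ge0N k : (0 <= (\1_A k * mehler_expect N k u)%:E)%E.
  by rewrite lee_fin mulr_ge0// ltW// mehler_expect_gt0//; lra.
have mEY : measurable_fun setT (fun k : V => (\1_A k * mehler_expect Y k u)%:E).
  apply/measurable_EFinP; apply: measurable_funM; first exact: measurable_indic.
  by apply: measurable_mehler_expect; lra.
have mEN : measurable_fun setT (fun k : V => (\1_A k * mehler_expect N k u)%:E).
  apply/measurable_EFinP; apply: measurable_funM; first exact: measurable_indic.
  by apply: measurable_mehler_expect; lra.
have b0 : 0 <= beta by rewrite ltW// mehler_expect_gt0.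
have al0 : 0 <= alpha by rewrite ltW// mehler_expect_gt0.
have key : (beta%:E * \int[lambda]_k (\1_A k * mehler_expect Y k u)%:E =
    alpha%:E * \int[lambda]_k (\1_A k * mehler_expect N k u)%:E)%E.
  rewrite -!ge0_integralZl ?lee_fin//.
  apply: eq_integral => k _; rewrite -!EFinM; congr EFin.
  have := mehler_expect_proportional k u1; rewrite -/beta -/alpha => h.
  by rewrite mulrCA (mulrC beta) h; ring.
move: key; rewrite !expect_mehler_smear// !(muleCA _ ((@lam R n) ^+ d)%:E).
have lE : ((@lam R n) ^+ d)%:E != 0%E by rewrite eqe gt_eqF.
move=> /(congr1 (fun z => (((@lam R n) ^+ d)^-1)%:E * z)%E).
by rewrite !muleA -!EFinM mulVf ?gt_eqF// !mul1r.
Qed.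

Lemma probability_proportional A (An : nat -> set V) : measurable A ->
  (forall n, measurable (An n)) ->
  (forall y s : V, \1_(An n) (y + (@lam R n) *: s) @[n --> \oo] --> (\1_A y : R)) ->
  (beta%:E * P (Y @^-1` A) = alpha%:E * P0 (N @^-1` A))%E.
Proof.
move=> mA mAn An_cvg.
pose I1 := gint 1 (fun _ : V => 1).
have cY : (\int[P]_w smear (An n) n (Y w))%E @[n --> \oo] --> (I1%:E * P (Y @^-1` A))%E.
  exact: cvg_expect_smear.
have cN : (\int[P0]_w smear (An n) n (N w))%E @[n --> \oo] --> (I1%:E * P0 (N @^-1` A))%E.
  exact: cvg_expect_smear.
have I0 : I1 != 0 by rewrite gt_eqF// gint1_gt0.
have cY' := cvgeZl (erefl : beta%:E \is a fin_num) cY.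
have cN' := cvgeZl (erefl : alpha%:E \is a fin_num) cN.
have E : (fun n => beta%:E * \int[P]_w smear (An n) n (Y w))%E =
    (fun n => alpha%:E * \int[P0]_w smear (An n) n (N w))%E.
  by apply/funext => n; exact: smear_proportional.
rewrite E in cY'.
have h : (beta%:E * (I1%:E * P (Y @^-1` A)) = alpha%:E * (I1%:E * P0 (N @^-1` A)))%E.
  exact: (cvg_unique (@ereal_hausdorff R) cY' cN').
move: h; rewrite !(muleCA _ I1%:E) => /(congr1 (fun z => (I1^-1)%:E * z)%E).
by rewrite !muleA -!EFinM mulVf// !mul1r.
Qed.

Theorem eq_law A : measurable A -> P (Y @^-1` A) = P0 (N @^-1` A).
Proof.
(* The whole space, of probability 1 under both laws, fixes the constant of proportionality. *)
have ab : alpha = beta.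
  have := @probability_proportional setT (fun=> setT) measurableT (fun=> measurableT).
  rewrite !preimage_setT !probability_setT !mule1 => h.
  apply: EFin_inj; rewrite h// => y s.
  by rewrite !indicT; exact: cvg_cst.
have b0 : beta != 0 by rewrite gt_eqF// mehler_expect_gt0.
apply: (@eq_measure_orthant _ _ (distribution P Y) (distribution P0 N)) => [b|].
  have := @probability_proportional (orthant b)
    (fun n => orthant (fun i => b i + (n.+1%:R^-1)%:E)%E) (measurable_orthant b)
    (fun n => measurable_orthant _) (@cvg_indic_orthant R d b).
  rewrite ab => /(congr1 (fun z => (beta^-1)%:E * z)%E).
  by rewrite !muleA -!EFinM mulVf// !mul1e.
by rewrite (le_lt_trans (probability_le1 _ _))// ltry.
Qed.

End uniqueness.

(** * Standardization and consistency *)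

Section hyperplane.
Context {R : realType}.

Lemma measurable_hyperplane d (v : 'cV[R]_d) c : measurable [set x | dotv v x = c].
Proof.
have mv : measurable_fun setT (dotv v) by exact: measurable_fun_dotv.
by have := mv measurableT [set c] (measurable_set1 c); rewrite setTI.
Qed.

(** Induction on d by sections at a fixed first coordinate x. If the remaining part of v is nonzero,
    every section is a hyperplane; otherwise the sections are empty except at a single x. *)
Lemma lebesgue_cV_hyperplane d (v : 'cV[R]_d) c : v != 0 ->
  lebesgue_cV [set x | dotv v x = c] = 0%E.
Proof.
elim: d v c => [|d IH] v c v0; first by case/eqP: v0; apply/matrixP => -[].
pose v' : 'cV[R]_d := @dsubmx R 1 d 1 v.
have dotE x u : dotv v (cV_cons (x, u)) = v ord0 ord0 * x + dotv v' u.
  rewrite !dotvE big_ord_recl; congr (_ * _ + _).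
    have -> : (ord0 : 'I_d.+1) = lshift d (ord0 : 'I_1) by exact: val_inj.
    by rewrite (@col_mxEu _ 1 d) mxE eqxx.
  apply: eq_bigr => i _; have -> : lift ord0 i = @rshift 1 d i by exact: val_inj.
  by rewrite (@col_mxEd _ 1 d) mxE.
set H := [set x | dotv v x = c]; have mHv : measurable H by exact: measurable_hyperplane.
have m1 : measurable_fun setT (fun x => (\1_H x : R)%:E).
  by apply/measurable_EFinP; exact: measurable_indic.
have -> : lebesgue_cV H = (\int[@lebesgue_cV R d.+1]_x (\1_H x)%:E)%E.
  by rewrite integral_indic// setIT.
rewrite ge0_integral_cVS//.
have [v'0|v'0] := eqVneq v' 0; last first.
  apply: integral0_eq => x _.
  transitivity (\int[@lebesgue_cV R d]_u (\1_[set u | dotv v' u = c - v ord0 ord0 * x] u)%:E)%E.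
    apply: eq_integral => u _; rewrite !indicE; congr ((nat_of_bool _)%:R%:E).
    apply/idP/idP => /set_mem; rewrite ?/H /= ?dotE => h; apply/mem_set => /=.
      by rewrite -h addrAC subrr add0r.
    by rewrite /H /= dotE h addrC subrK.
  have mH' := measurable_hyperplane v' (c - v ord0 ord0 * x).
  by rewrite (integral_indic _ measurableT mH') setIT; exact: IH.
have v00 : v ord0 ord0 != 0.
  apply: contra_neq v0 => h; apply/matrixP => i j; rewrite (ord1 j) mxE.
  have [k ->|->//] := unliftP ord0 i.
  have -> : lift ord0 k = @rshift 1 d k by exact: val_inj.
  by have /matrixP/(_ k ord0) := v'0; rewrite !mxE.
transitivity (\int[@lebesgue_measure R]_x (cst 0 x))%E; last by rewrite integral0.
apply: ae_eq_integral => //.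
  apply: (@measurable_fun_fubini_tonelli_F _ _ _ _ _ (@lebesgue_cV R d)
    (fun p => (\1_H (cV_cons p))%:E)) => [|p]; last by rewrite lee_fin.
  exact: (measurableT_comp m1 (@measurable_cV_cons R d)).
exists [set c / v ord0 ord0]; split=> //; first exact: lebesgue_measure_set1.
move=> x /= h; apply: contrapT => xc; apply: h => _.
apply: integral0_eq => u _; rewrite indicE memNset// /H/= dotE v'0 dotv0l addr0 => h.
by apply: xc; rewrite -h mulrAC divff// mul1r.
Qed.

End hyperplane.

Lemma enorm_mulmx_le {R : realType} {d} (A : 'M[R]_d) (x : 'cV[R]_d) :
  enorm (A *m x) <= (\sum_i \sum_j `|A i j|) * enorm x.
Proof.
rewrite (le_trans (enorm_le_sum _))// mulr_suml ler_sum// => i _.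
rewrite mxE (le_trans (ler_norm_sum _ _ _))// mulr_suml ler_sum// => j _.
by rewrite normrM ler_wpM2l// normr_coord_le.
Qed.

(** * Affine images of random vectors and standardization *)

Section affine_rv.
Context {R : realType} {d : nat} {disp : measure_display}
  {T : measurableType disp} {P : probability T R}.
Implicit Types (A L S : 'M[R]_d) (b m u v x : 'cV[R]_d).

Definition affine_rv A b (X : {RV P >-> 'cV[R]_d}) (w : T) : 'cV[R]_d := A *m X w + b.

Lemma measurable_affine_rv A b X : measurable_fun setT (affine_rv A b X).
Proof. by apply: measurable_fun_addv => //; exact: measurable_fun_mulmxv. Qed.

HB.instance Definition _ A b X := isMeasurableFun.Build _ _ _ _ (affine_rv A b X)
  (measurable_affine_rv A b X).

Lemma integrable_affine_rv A b (X : {RV P >-> 'cV[R]_d}) :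
  P.-integrable setT (EFin \o (fun w => (1 + enorm (X w)) ^+ 4)) ->
  P.-integrable setT (EFin \o (fun w => (1 + enorm (affine_rv A b X w)) ^+ 4)).
Proof.
move=> X4; pose K := 1 + enorm b + \sum_i \sum_j `|A i j|.
have s0 : 0 <= \sum_i \sum_j `|A i j| by do 2 (apply: sumr_ge0 => ? _).
have b0 := enorm_ge0 b.
have iK := integrableZl measurableT (K ^+ 4) X4.
apply: le_integrable iK => //.
  apply/measurable_EFinP; apply: measurable_funX; apply: measurable_funD => //.
  exact: measurable_fun_enorm.
move=> w _ /=; rewrite lee_fin ger0_norm ?exprn_ge0 ?addr_ge0 ?enorm_ge0//.
rewrite (le_trans _ (ler_norm _))// -exprMn lerXn2r ?nnegrE ?addr_ge0 ?enorm_ge0//.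
  by rewrite mulr_ge0 ?addr_ge0 ?enorm_ge0.
have := enormD (A *m X w) b; have := enorm_mulmx_le A (X w); have := enorm_ge0 (X w).
rewrite /affine_rv /K; move: s0; set s := \sum_i _; nra.
Qed.

Lemma iid_affine_rv A b (X : {RV P >-> 'cV[R]_d}) (Xs : nat -> {RV P >-> 'cV[R]_d}) :
  iid_copies P X Xs ->
  iid_copies P (affine_rv A b X) (fun j => affine_rv A b (Xs j)).
Proof.
pose g x := A *m x + b.
have mg : measurable_fun setT g.
  by apply: measurable_fun_addv => //; apply: measurable_fun_mulmxv.
have mgB B : measurable B -> measurable (g @^-1` B).
  by move=> mB; rewrite -[X in measurable X]setTI; exact: mg.
move=> [ind dis]; split => [J B mB|j B mB]; last exact: (dis j _ (mgB _ mB)).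
exact: (ind J (fun j => g @^-1` B j) (fun j => mgB _ (mB j))).
Qed.

Section standardization.
Variable X : {RV P >-> 'cV[R]_d}.
Hypothesis X4 : P.-integrable setT (EFin \o (fun w => (1 + enorm (X w)) ^+ 4)).

Lemma integrable_growth2 (f : 'cV[R]_d -> R) (C : R) : 0 <= C ->
  measurable_fun setT f -> (forall y, `|f y| <= C * (1 + enorm y) ^+ 2) ->
  P.-integrable setT (EFin \o (f \o X)).
Proof.
move=> C0 mf fC; apply: integrable_sqr_integrable; first exact: measurableT_comp.
by have [] := sqr_integrable_growth X4 C0 mf fC.
Qed.

Definition rv_mean : 'cV[R]_d := \col_i \int[P]_w X w i ord0.

Definition rv_cov : 'M[R]_d :=
  \matrix_(i, k) \int[P]_w ((X w - rv_mean) i ord0 * (X w - rv_mean) k ord0).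

Let integrable_coord i : P.-integrable setT (EFin \o (fun w => X w i ord0)).
Proof.
apply: (integrable_growth2 (f := fun y => y i ord0) (C := 1)) => //.
  exact: measurable_coord.
by move=> y; rewrite mul1r; exact: coord_le_growth.
Qed.

Lemma integrable_dotv_centered u v : P.-integrable setT
  (EFin \o (fun w => dotv u (X w - rv_mean) * dotv v (X w - rv_mean))).
Proof.
set m := rv_mean.
apply: (integrable_growth2 (f := fun y => dotv u (y - m) * dotv v (y - m))
   (C := enorm u * enorm v * (1 + enorm m) ^+ 2)).
- by rewrite mulr_ge0 ?sqr_ge0// mulr_ge0// enorm_ge0.
- have md z : measurable_fun setT (fun y : 'cV[R]_d => dotv z (y - m)).
    by apply: measurable_fun_dotv => //; exact: measurable_fun_subv.
  exact: measurable_funM.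
move=> y; rewrite normrM.
have h z : `|dotv z (y - m)| <= enorm z * ((1 + enorm m) * (1 + enorm y)).
  rewrite (le_trans (dotv_cauchy_schwarz _ _))// ler_wpM2l ?enorm_ge0//.
  have := enormB y m; have := enorm_ge0 y; have := enorm_ge0 m; nra.
apply: (le_trans (ler_pM _ _ (h u) (h v))) => //.
by rewrite mulrACA -[leRHS]mulrA -exprMn expr2.
Qed.

Lemma rv_covE u v :
  \int[P]_w (dotv u (X w - rv_mean) * dotv v (X w - rv_mean)) = dotv u (rv_cov *m v).
Proof.
set m := rv_mean.
have ic i k : P.-integrable setT
    (EFin \o (fun w => (X w - m) i ord0 * (X w - m) k ord0)).
  have := integrable_dotv_centered (delta_mx i ord0) (delta_mx k ord0).
  by apply: eq_integrable => // w _ /=; rewrite !dotv_deltal.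
have iz i k : P.-integrable setT
    (EFin \o (fun w => u i ord0 * v k ord0 * ((X w - m) i ord0 * (X w - m) k ord0))).
  exact: (integrableZl measurableT _ (ic i k)).
transitivity (\int[P]_w \sum_i \sum_k
    (u i ord0 * v k ord0 * ((X w - m) i ord0 * (X w - m) k ord0))).
  apply: eq_Rintegral => w _; rewrite !dotvE mulr_suml; apply: eq_bigr => i _.
  by rewrite mulr_sumr; apply: eq_bigr => k _; rewrite mulrACA.
have inner i := Rintegral_sum (mu := P) (index_enum 'I_d) (iz i).
have [_ ->] := Rintegral_sum (mu := P) (index_enum 'I_d) (fun i => (inner i).1).
rewrite dotvE; apply: eq_bigr => i _; rewrite (inner i).2 mxE mulr_sumr.
by apply: eq_bigr => k _; rewrite RintegralZl// mxE mulrAC -mulrA.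
Qed.

Lemma rv_mean_centered u : \int[P]_w dotv u (X w - rv_mean) = 0.
Proof.
have i1 : P.-integrable setT (EFin \o (fun=> 1)) by exact: finite_measure_integrable_cst.
have icst c : P.-integrable setT (EFin \o (fun=> c)) by exact: finite_measure_integrable_cst.
have iB i : P.-integrable setT (EFin \o (fun w => X w i ord0 - rv_mean i ord0)).
  exact: (integrableB measurableT (integrable_coord i) (icst _)).
have iz i : P.-integrable setT (EFin \o (fun w => u i ord0 * (X w i ord0 - rv_mean i ord0))).
  exact: (integrableZl measurableT _ (iB i)).
transitivity (\int[P]_w \sum_i (u i ord0 * (X w i ord0 - rv_mean i ord0))).
  by apply: eq_Rintegral => w _; rewrite dotvE; apply: eq_bigr => i _; rewrite !mxE.
have [_ ->] := Rintegral_sum (mu := P) (index_enum 'I_d) iz.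
apply: big1 => i _; rewrite RintegralZl// RintegralB//.
have -> : \int[P]_w rv_mean i ord0 = rv_mean i ord0.
  transitivity (rv_mean i ord0 * fine (P setT)); first exact: Rintegral_cst.
  have -> : P setT = 1%E by exact: probability_setT.
  by rewrite mulr1.
by rewrite mxE subrr mulr0.
Qed.

Hypothesis X_hyperplane : forall v c, v != 0 -> P (X @^-1` [set x | dotv v x = c]) = 0%E.

(** If the variance of v.X vanished, X would lie almost surely in a hyperplane orthogonal to v,
    which has probability 0 by hypothesis. *)
Lemma posdef_rv_cov : posdefmx rv_cov.
Proof.
split.
  apply/matrixP => i k; rewrite !mxE; apply: eq_Rintegral => w _.
  by rewrite mulrC.
move=> v v0; rewrite -rv_covE.
pose q w := dotv v (X w - rv_mean) * dotv v (X w - rv_mean).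
have iq : P.-integrable setT (EFin \o q) by exact: integrable_dotv_centered.
have q0 w : 0 <= q w by rewrite /q -expr2 sqr_ge0.
have Qge0 : 0 <= \int[P]_w q w by apply: Rintegral_ge0.
rewrite lt_neqAle Qge0 andbT eq_sym; apply/eqP => Q0.
have mq := measurable_int _ iq.
have : (\int[P]_w `|(q w)%:E| = 0)%E.
  rewrite -[RHS]/(0%:E) -Q0 EFin_Rintegral//.
  by apply: eq_integral => w _; rewrite gee0_abs// lee_fin.
move/(ae_eq_integral_abs _ measurableT mq) => [Z [mZ Z0 ZT]].
have H0 := X_hyperplane (dotv v rv_mean) v0.
set H := X @^-1` _ in H0.
have mH : measurable H.
  rewrite -[X in measurable X]setTI; apply: measurable_funPT => //.
  exact: measurable_hyperplane.
have : P setT = 0%E.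
  rewrite (_ : setT = Z `|` H).
    by rewrite measureU0.
  apply/seteqP; split=> // w _; have [wH|wH] := pselect (H w); first by right.
  left; apply: ZT => /= /(_ I) [] /eqP; rewrite /q mulf_eq0 orbb dotvBr subr_eq0.
  by move/eqP.
have -> : P setT = 1%E by exact: probability_setT.
by move=> /eqP; rewrite eqe oner_eq0.
Qed.

(** The covariance of L^-1 (X - m) is L^-1 (L L^T) L^-T, the identity. The factor is kept triangular
    so that [ge0_integral_trig_mx] can return from the standard normal density to the general
    one. *)
Lemma standardization : exists L m, [/\ is_trig_mx L, 0 < \det L,
  (forall i, \int[P]_w affine_rv (invmx L) (- (invmx L *m m)) X w i ord0 = 0) &
  (forall i k, \int[P]_w (affine_rv (invmx L) (- (invmx L *m m)) X w i ord0 *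
     affine_rv (invmx L) (- (invmx L *m m)) X w k ord0) = (i == k)%:R)].
Proof.
have [L [Ltrig Ldet LS]] := cholesky posdef_rv_cov.
have Lu : L \in unitmx by rewrite unitmxE unitfE gt_eqF.
exists L, rv_mean.
have YE w i : affine_rv (invmx L) (- (invmx L *m rv_mean)) X w i ord0 =
    dotv ((invmx L)^T *m delta_mx i ord0) (X w - rv_mean).
  by rewrite /affine_rv -mulmxBr -dotv_deltal -[in LHS](trmxK (invmx L)) -dotv_mulmx.
split=> // [i|i k].
  under eq_Rintegral do rewrite YE.
  exact: rv_mean_centered.
under eq_Rintegral do rewrite !YE.
rewrite rv_covE dotv_mulmx trmxK -LS !mulmxA mulVmx// mul1mx.
by rewrite -trmx_mul mulVmx// trmx1 mul1mx dotv_deltar mxE eqxx andbT eq_sym.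
Qed.

End standardization.

End affine_rv.

(** The Radon-Nikodym derivative of nu has the same integral as g over every measurable set, hence
    equals g almost everywhere. *)
Lemma ge0_integral_density {d} {T : measurableType d} {R : realType}
    (nu : {finite_measure set T -> \bar R})
    (mu : {sigma_finite_measure set T -> \bar R}) (g : T -> R) (f : T -> \bar R) :
  measurable_fun setT g -> (forall x, 0 <= g x) ->
  (forall A, measurable A -> nu A = \int[mu]_(x in A) (g x)%:E)%E ->
  measurable_fun setT f -> (forall x, 0 <= f x)%E ->
  (\int[nu]_x f x = \int[mu]_x (f x * (g x)%:E))%E.
Proof.
move=> mg g0 nug mf f0.
have numu : nu `<< mu.
  apply/null_content_dominatesP => A mA A0; rewrite nug//.
  by apply: null_set_integral => //; apply/measurable_EFinP; exact: measurable_funTS.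
rewrite -(Radon_Nikodym_SigmaFinite.change_of_variables numu)//.
have mRN := measurable_int _ (Radon_Nikodym_SigmaFinite.f_integrable numu).
have mEg : measurable_fun setT (EFin \o g) by exact/measurable_EFinP.
apply: ae_eq_integral => //; [exact: emeasurable_funM|exact: emeasurable_funM|].
have : ae_eq mu setT (Radon_Nikodym_SigmaFinite.f nu mu) (EFin \o g).
  apply: integral_ae_eq => //; first exact: Radon_Nikodym_SigmaFinite.f_integrable.
  by move=> A _ mA; rewrite -Radon_Nikodym_SigmaFinite.f_integral// nug.
by apply: filterS => x h /h /= ->.
Qed.

(** * Moments and zero energy of the standard normal law *)

Section standard_normal.
Context {R : realType} {d : nat}.
Local Notation V := 'cV[R]_d.
Local Notation lambda := (@lebesgue_cV R d).

Definition std_normal_const : R := (Num.sqrt ((2 * pi) ^+ d))^-1.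

Definition std_normal_pdf (x : V) : R := std_normal_const * gauss (1 / 2) x.

(** The substitution x = L y + mu turns the quadratic form into |y|^2, and its Jacobian cancels the
    determinant in the normalization. *)
Lemma mvnormal_affine (L : 'M[R]_d) (mu : V) (A : set V) :
  is_trig_mx L -> 0 < \det L -> measurable A ->
  mvnormal mu (L *m L^T) ((fun x => invmx L *m x - invmx L *m mu) @^-1` A) =
  (\int[lambda]_(x in A) (std_normal_pdf x)%:E)%E.
Proof.
move=> Ltrig Ldet mA; rewrite /mvnormal.
have Lu : L \in unitmx by rewrite unitmxE unitfE gt_eqF.
have Su : L *m L^T \in unitmx by rewrite unitmx_mul unitmx_tr Lu.
set B := _ @^-1` A.
have mh : measurable_fun setT (fun x : V => invmx L *m x - invmx L *m mu).
  by apply: measurable_fun_subv => //; exact: measurable_fun_mulmxv.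
have mB : measurable B by rewrite -[X in measurable X]setTI; exact: mh.
have mpdf : measurable_fun setT (mvnormal_pdf mu (L *m L^T)).
  apply: measurable_funM => //; apply: (measurableT_comp (f := @expR R)) => //.
  apply: measurable_funN; apply: measurable_funM => //.
  have ms : measurable_fun setT (fun x : V => x - mu) by exact: measurable_fun_subv.
  by apply: measurable_fun_dotv => //; exact: measurable_fun_mulmxv.
have pdf0 x : 0 <= mvnormal_pdf mu (L *m L^T) x.
  by rewrite mulr_ge0 ?expR_ge0// invr_ge0 sqrtr_ge0.
rewrite integral_mkcond [RHS]integral_mkcond !epatch_indic.
have mF : measurable_fun setT
    ((fun x => (mvnormal_pdf mu (L *m L^T) x)%:E) \* (EFin \o \1_B))%E.
  by apply: emeasurable_funM; apply/measurable_EFinP => //; exact: measurable_indic.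
rewrite (ge0_integral_trig_mx mu Ltrig)//; last first.
- by move=> x; rewrite /= -EFinM lee_fin mulr_ge0.
- by rewrite gt_eqF.
have key y : mvnormal_pdf mu (L *m L^T) (L *m y + mu) =
    (\det L)^-1 * (std_normal_const * gauss (1 / 2) y).
  rewrite /mvnormal_pdf addrK; set w := invmx _ *m _.
  have Lw : L^T *m w = y.
    have : L *m (L^T *m w) = L *m y by rewrite mulmxA /w mulKVmx.
    by move/(congr1 (mulmx (invmx L))); rewrite !mulKmx.
  rewrite dotv_mulmx Lw det_mulmx det_tr -expr2.
  rewrite sqrtrM ?exprn_ge0 ?mulr_ge0 ?pi_ge0// sqrtr_sqr gtr0_norm// invfM.
  rewrite mulrAC mulrC /std_normal_const /gauss; congr (_ * (_ * expR _)).
  by ring.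
have BE y : \1_B (L *m y + mu) = \1_A y :> R.
  rewrite !indicE; congr ((nat_of_bool _)%:R).
  have E : invmx L *m (L *m y + mu) - invmx L *m mu = y.
    by rewrite mulmxDr addrK mulKmx.
  by apply/idP/idP => /set_mem; rewrite /B/= ?E => h; apply/mem_set; rewrite //= E.
rewrite -ge0_integralZl//.
- apply: eq_integral => y _; rewrite /= key BE -!EFinM; congr EFin.
  by rewrite gtr0_norm// mulrA mulVKf// gt_eqF.
- apply: (measurableT_comp mF).
  by apply: measurable_fun_addv => //; exact: measurable_fun_mulmxv.
- by move=> y _; rewrite /= -EFinM lee_fin mulr_ge0.
Qed.

Section law.
Context {disp : measure_display} {T : measurableType disp} {P : probability T R}.
Variable N : {RV P >-> V}.
Hypothesis N_law : forall A, measurable A -> (P (N @^-1` A) =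
  \int[lambda]_(x in A) (std_normal_pdf x)%:E)%E.

Let c := std_normal_const.

Let c0 : 0 <= c. Proof. by rewrite invr_ge0 sqrtr_ge0. Qed.

Let half0 : 0 < 1 / 2 :> R. Proof. lra. Qed.

Let ge0_std_normal_expect f : tempered f -> (forall x, 0 <= f x) ->
  P.-integrable setT (EFin \o (f \o N)) /\
  \int[P]_w f (N w) = c * gint (1 / 2) f.
Proof.
move=> tf f0.
have mf : measurable_fun setT (EFin \o f) by apply/measurable_EFinP; exact: tf.1.
have E : (\int[P]_w (f (N w))%:E = (c * gint (1 / 2) f)%:E)%E.
  rewrite -[LHS](ge0_integral_distribution N mf)//.
  rewrite (ge0_integral_density (mu := lambda) (g := std_normal_pdf))//.
  - rewrite EFinM /gint EFin_Rintegral; last exact: integrable_gint.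
    rewrite -ge0_integralZl//.
    + by apply: eq_integral => x _; rewrite /= -!EFinM mulrCA.
    + exact: (measurable_int _ (integrable_gint half0 tf)).
    + by move=> x _; rewrite lee_fin mulr_ge0// gauss_ge0.
  - by apply: measurable_funM => //; exact: measurable_gauss.
  - by move=> x; rewrite mulr_ge0// gauss_ge0.
split; last by rewrite /Rintegral E.
apply/integrableP; split; first exact: (measurableT_comp mf (g := N)).
under eq_integral do rewrite /= ger0_norm//.
by rewrite E ltry.
Qed.

Lemma std_normal_expect f : tempered f ->
  P.-integrable setT (EFin \o (f \o N)) /\
  \int[P]_w f (N w) = c * gint (1 / 2) f.
Proof.
(* A tempered f is the difference of the nonnegative tempered functions 1 + f^2 and 1 + f^2 - f. *)
move=> tf; pose p x := 1 + f x ^+ 2; pose q x := 1 + f x ^+ 2 - f x.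
have tp : tempered p by apply: temperedD; [exact: tempered_cst|exact: temperedX].
have tq : tempered q by exact: temperedB.
have p0 x : 0 <= p x by rewrite addr_ge0 ?sqr_ge0.
have q0 x : 0 <= q x by rewrite /q; have := sqr_ge0 (f x - 1); have := sqr_ge0 (f x); nra.
have [ip Ep] := ge0_std_normal_expect tp p0.
have [iq Eq] := ge0_std_normal_expect tq q0.
have fE : f = (fun x => p x - q x) by apply/funext => x; rewrite /p /q; ring.
split; first by rewrite fE; exact: (integrableB measurableT ip iq).
have -> : gint (1 / 2) f = gint (1 / 2) p - gint (1 / 2) q.
  by rewrite -gintB//; apply: eq_gint => x; rewrite [in LHS]fE.
rewrite mulrBr -Ep -Eq -RintegralB//.
by apply: eq_Rintegral => w _; rewrite [in LHS]fE.
Qed.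

(** The value of the Gaussian integral is never computed: the normalization follows from the total
    mass 1 of the law of N. *)
Lemma std_normal_mass : c * gint (1 / 2) (fun _ : V => 1) = 1.
Proof.
have [_ <-] := std_normal_expect (tempered_cst 1).
transitivity (1 * fine (P setT)); first exact: Rintegral_cst.
have -> : P setT = 1%E by exact: probability_setT.
by rewrite mulr1.
Qed.

Lemma std_normal_moment4 :
  P.-integrable setT (EFin \o (fun w => (1 + enorm (N w)) ^+ 4)).
Proof. by have [] := std_normal_expect (tempered_enorm1 (R := R) (d := d) 4). Qed.

Lemma std_normal_mean i : \int[P]_w N w i ord0 = 0.
Proof.
have [_ ->] := std_normal_expect (@tempered_coord R d i).
have h := @gint_by_parts R d (fun=> 1) (fun=> 0) (delta_mx i ord0) _ half0
  (tempered_cst 1) (tempered_cst 0) (fun t => rderiv_cst 0 1).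
rewrite [X in _ * X](_ : _ = gint (1 / 2) (fun t : V => dotv t (delta_mx i ord0) * 1)).
  by rewrite h gint0 !mulr0.
by apply: eq_gint => t; rewrite dotv_deltar mulr1.
Qed.

Lemma std_normal_cov i k : \int[P]_w (N w i ord0 * N w k ord0) = (i == k)%:R.
Proof.
have tik : tempered (fun t : V => t i ord0 * t k ord0).
  by apply: temperedM; exact: tempered_coord.
have [_ ->] := std_normal_expect tik.
have dk (t : V) : is_derive (0 : R) 1 (fun h => (t + h *: delta_mx i ord0) k ord0) (i == k)%:R.
  have -> : (fun h => (t + h *: delta_mx i ord0) k ord0) =
      (fun h => t k ord0 + h * (i == k)%:R).
    by apply/funext => s; rewrite !mxE eqxx andbT eq_sym.
  exact: rderiv_affine.
have h := @gint_by_parts R d (fun t => t k ord0) (fun=> (i == k)%:R)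
  (delta_mx i ord0) _ half0 (tempered_coord k) (tempered_cst _) dk.
rewrite [X in _ * X](_ : _ = gint (1 / 2) (fun t : V => dotv t (delta_mx i ord0) * t k ord0)).
  rewrite h.
  rewrite [X in _ * (_ * X)](_ : _ = (i == k)%:R * gint (1 / 2) (fun _ : V => 1)).
    have -> : (2 * (1 / 2))^-1 = 1 :> R by field.
    by rewrite mul1r mulrCA std_normal_mass mulr1.
  rewrite -gintZ//; last exact: tempered_cst.
  by apply: eq_gint => t; rewrite mulr1.
by apply: eq_gint => t; rewrite dotv_deltar.
Qed.

(** The density is a Gaussian weight with b = 1/2, now in the variable y with t as frequency. There
    |y|^2 acts as the factor d - |t|^2, which cancels |t|^2 - d. *)
Lemma std_normal_osc_expect theta t : osc_expect N theta t = 0.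
Proof.
have tc : tempered (fun y : V => cos (dotv y t + theta)).
  by apply: tempered_cos; apply: temperedD; [exact: tempered_dotv|exact: tempered_cst].
have t1 : tempered (fun y : V => dotv y y * cos (dotv y t + theta)).
  by apply: temperedM => //; exact: tempered_dotvv.
have t2 : tempered (fun y : V => (dotv t t - d%:R) * cos (dotv y t + theta)).
  by apply: temperedM => //; exact: tempered_cst.
have oscE y : osc theta y t = dotv y y * cos (dotv y t + theta) +
    (dotv t t - d%:R) * cos (dotv y t + theta).
  by rewrite /osc (dotvC t y); ring.
rewrite /osc_expect; under eq_Rintegral do rewrite oscE.
have [_ ->] := std_normal_expect (temperedD t1 t2).
rewrite gintD// gintZ// gint_dotvv_cos//.
have -> : d%:R / (2 * (1 / 2)) - dotv t t / (4 * (1 / 2) ^+ 2) = d%:R - dotv t t :> R.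
  by field.
by rewrite -mulrDl addrA subrK subrr mul0r mulr0.
Qed.

End law.

End standard_normal.

Section affine_normal.
Context {R : realType} {d : nat} {disp : measure_display}
  {T : measurableType disp} {P : probability T R}.
Local Notation V := 'cV[R]_d.
Local Notation lambda := (@lebesgue_cV R d).
Variable X : {RV P >-> V}.

Local Notation standardize L m := (affine_rv (invmx L) (- (invmx L *m m))).

Let measurable_preimage_affine (A : 'M[R]_d) (b : V) (B : set V) :
  measurable B -> measurable ((fun x => A *m x + b) @^-1` B).
Proof.
move=> mB; rewrite -[X in measurable X]setTI.
by apply: measurable_fun_addv => //; exact: measurable_fun_mulmxv.
Qed.

Lemma standardize_normal : nondegenerate_normal (distribution P X) ->
  exists L m, L \in unitmx /\ forall A, measurable A ->
    P (standardize L m X @^-1` A) =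
    (\int[lambda]_(x in A) (std_normal_pdf x)%:E)%E.
Proof.
move=> [mu [S /cholesky[L [Ltrig Ldet <-]] Xlaw]].
exists L, mu; split=> [|A mA]; first by rewrite unitmxE unitfE gt_eqF.
rewrite -(mvnormal_affine mu Ltrig Ldet mA) -Xlaw//.
exact: measurable_preimage_affine.
Qed.

Lemma normal_of_standardize L m : is_trig_mx L -> 0 < \det L ->
  (forall A, measurable A -> P (standardize L m X @^-1` A) =
    (\int[lambda]_(x in A) (std_normal_pdf x)%:E)%E) ->
  nondegenerate_normal (distribution P X).
Proof.
move=> Ltrig Ldet Ylaw.
have Lu : L \in unitmx by rewrite unitmxE unitfE gt_eqF.
exists m, (L *m L^T).
  split=> [|v v0]; first by rewrite trmx_mul trmxK.
  rewrite -mulmxA -[L in L *m _]trmxK -dotv_mulmx dotvv_gt0//.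
  apply: contra_neq v0 => h; have : invmx L^T *m (L^T *m v) = 0 by rewrite h mulmx0.
  by rewrite mulKmx// unitmx_tr.
move=> A mA; set A' := (fun y => L *m y + m) @^-1` A.
have mA' : measurable A' by exact: measurable_preimage_affine.
have E x : L *m (invmx L *m x - invmx L *m m) + m = x.
  by rewrite -mulmxBr mulKVmx// subrK.
have -> : A = (fun x => invmx L *m x - invmx L *m m) @^-1` A'.
  by apply/seteqP; split => x; rewrite /A' /= E.
by rewrite mvnormal_affine// -Ylaw.
Qed.

End affine_normal.

(** * Bounds for the statistic and for the critical value *)

Section consistency.
Context {R : realType} {d : nat}.
Local Notation V := 'cV[R]_d.
Variable a : R.
Hypothesis a0 : 0 < a.

Lemma U_stat_ge0 n (x : 'I_n -> V) : 0 <= U_stat a x.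
Proof.
rewrite U_statE mulr_ge0//; apply: Rintegral_ge0 => t _.
by rewrite mulr_ge0 ?gauss_ge0// addr_ge0 ?sqr_ge0.
Qed.

Lemma U_sample_affine {disp : measure_display} {T : measurableType disp}
    {P : probability T R} (Xs : nat -> {RV P >-> V}) (A : 'M[R]_d) (b : V) n w :
  A \in unitmx ->
  U_sample P Xs n a w = U_stat a (fun j : 'I_n => affine_rv A b (Xs j) w).
Proof. by move=> Au; rewrite /affine_rv U_stat_affine. Qed.

Lemma measurable_U_sample {disp : measure_display} {T : measurableType disp}
    {P : probability T R} (Xs : nat -> {RV P >-> V}) n :
  measurable_fun setT (U_sample P Xs n a).
Proof. by apply: measurable_U_stat => // j; exact: measurable_funPT. Qed.

Section alternative.
Context {disp : measure_display} {T : measurableType disp} {P : probability T R}.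
Variables (Y : {RV P >-> V}) (Ys : nat -> {RV P >-> V}).
Hypothesis Ys_iid : iid_copies P Y Ys.
Hypothesis Y4 : P.-integrable setT (EFin \o (fun w => (1 + enorm (Y w)) ^+ 4)).
Hypothesis Y_mean : forall i, \int[P]_w Y w i ord0 = 0.
Hypothesis Y_cov : forall i k, \int[P]_w (Y w i ord0 * Y w k ord0) = (i == k)%:R.

Let D := gint a (fun t => osc_expect Y 0 t ^+ 2 + osc_expect Y (- (pi / 2)) t ^+ 2).

(** By g^2 <= 2 f^2 + 2 (f - g)^2 the limit energy D is at most twice the empirical energy plus
    twice the error. An error of at most D / 4 leaves an energy of at least D / 4. *)
Lemma U_stat_lower (delta : R) : 0 < D -> 0 < delta ->
  exists N, forall n, (N <= n)%N -> exists G, [/\ measurable G,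
    (P (~` G) <= delta%:E)%E & forall w, G w ->
    n%:R * (D / 4) <= U_stat a (fun j : 'I_n => Ys j w)].
Proof.
move=> D0 delta0; have e0 : 0 < D / 4 by rewrite divr_gt0.
have [N HN] := osc_error_residual_to0 Ys_iid Y4 Y_mean Y_cov a0 e0 delta0.
exists N => n /HN[G [mG PG errG]]; exists G; split=> // w /errG.
set r := scaled_residual _ => err; rewrite U_statE ler_wpM2l//.
have tg theta := tempered_osc_expect Y4 theta.
have te : tempered (fun t : V => osc_mean 0 r t ^+ 2 + osc_mean (- (pi / 2)) r t ^+ 2).
  by apply: temperedD; apply: temperedX; exact: tempered_osc_mean.
have ter := tempered_osc_error (tg 0) (tg (- (pi / 2))) r.
have h : D <= 2 * osc_energy a r +
    2 * osc_error a (osc_expect Y 0) (osc_expect Y (- (pi / 2))) r.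
  rewrite /osc_energy /osc_error -!gintZ// -gintD//; try exact: temperedM (tempered_cst _) _.
  apply: le_gint => // [||t].
  - by apply: temperedD; apply: temperedX.
  - by apply: temperedD; apply: temperedM => //; exact: tempered_cst.
  set x := osc_mean 0 r t; set y := osc_mean _ r t.
  set u := osc_expect _ _ _; set v := osc_expect _ _ _.
  have := sqr_ge0 (2 * x - u); have := sqr_ge0 (2 * y - v); nra.
lra.
Qed.

End alternative.

Section null.
Context {disp : measure_display} {T : measurableType disp} {P : probability T R}.
Variables (N : {RV P >-> V}) (Ns : nat -> {RV P >-> V}).
Hypothesis Ns_iid : iid_copies P N Ns.
Hypothesis N_law : forall A, measurable A -> (P (N @^-1` A) =
  \int[@lebesgue_cV R d]_(x in A) (std_normal_pdf x)%:E)%E.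

(** For the standard normal law the target functions are 0, so the error is the energy itself. *)
Lemma U_stat_upper (eps delta : R) : 0 < eps -> 0 < delta ->
  exists M, forall n, (M <= n)%N -> exists G, [/\ measurable G,
    (P (~` G) <= delta%:E)%E & forall w, G w ->
    U_stat a (fun j : 'I_n => Ns j w) <= n%:R * eps].
Proof.
move=> eps0 delta0.
have [M HM] := osc_error_residual_to0 Ns_iid (std_normal_moment4 N_law)
  (std_normal_mean N_law) (std_normal_cov N_law) a0 eps0 delta0.
exists M => n /HM[G [mG PG errG]]; exists G; split=> // w /errG.
rewrite U_statE => err; rewrite ler_wpM2l// (le_trans _ err)//.
rewrite le_eqVlt; apply/orP; left; apply/eqP/eq_gint => t.
by rewrite !(std_normal_osc_expect N_law) !subr0.
Qed.

End null.

Lemma critical_value_upper {disp : measure_display} {T : measurableType disp}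
    {P : probability T R} (Zs : nat -> {RV P >-> V}) n (alpha c : R) (G : set T) :
  alpha < 1 -> measurable G -> (P (~` G) <= alpha%:E)%E ->
  (forall w, G w -> U_sample P Zs n a w <= c) ->
  critical_value P Zs n a alpha <= c.
Proof.
move=> alpha1 mG PG UG; apply: ge_inf.
  (* An infimum is bounded by a member only if the set is bounded below. Here 0 is a lower bound:
     the statistic is nonnegative, so its distribution function vanishes at negative y, where it is
     less than 1 - alpha. *)
  exists 0 => y /=; rewrite /pushforward => h; rewrite leNgt; apply/negP => y0.
  move: h; rewrite (_ : _ @^-1` _ = set0).
    by rewrite measure0 lee_fin leNgt subr_gt0 alpha1.
  apply/seteqP; split=> // w /=; rewrite in_itv/= => Uy.
  have := le_lt_trans Uy y0; rewrite ltNge; apply/negP/negPn.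
  exact: U_stat_ge0.
rewrite /= /pushforward; apply: (@le_trans _ _ (P G)).
  rewrite -[G]setCK probability_setC; last exact: measurableC.
  by rewrite EFinB leeB.
apply: le_measure; rewrite ?inE//.
by rewrite -[X in measurable X]setTI; exact: measurable_U_sample.
Qed.

End consistency.

(** * Translation of the hypotheses on X *)

Section reduction.
Context {R : realType} {d : nat} {disp : measure_display}
  {T : measurableType disp} {P : probability T R}.
Variable X : {RV P >-> 'cV[R]_d}.

Lemma integrable_growth4 : ('E_P[fun w => (enorm (X w) ^+ 4)%R] < +oo)%E ->
  P.-integrable setT (EFin \o (fun w => (1 + enorm (X w)) ^+ 4)).
Proof.
rewrite unlock => h.
have me : measurable_fun setT (fun w => enorm (X w)) by exact: measurable_fun_enorm.
have ie : P.-integrable setT (EFin \o (fun w => enorm (X w) ^+ 4)).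
  apply/integrableP; split; first by apply/measurable_EFinP; exact: measurable_funX.
  by under eq_integral do rewrite /= ger0_norm ?exprn_ge0 ?enorm_ge0//.
have i1 : P.-integrable setT (EFin \o (fun=> 1)) by exact: finite_measure_integrable_cst.
have iD : P.-integrable setT (EFin \o (fun w => 1 + enorm (X w) ^+ 4)).
  exact: (integrableD measurableT i1 ie).
have i8 := integrableZl measurableT 8 iD.
apply: le_integrable i8 => //.
  by apply/measurable_EFinP; apply: measurable_funX; apply: measurable_funD.
move=> w _ /=; rewrite lee_fin ger0_norm ?exprn_ge0 ?addr_ge0 ?enorm_ge0//.
rewrite (le_trans _ (ler_norm _))//; set e := enorm _.
(* The inequality (1 + x)^2 <= 2 (1 + x^2), applied at e and at e^2, produces the factor 8 = 2^2 *
   2. *)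
have h1 : (1 + e) ^+ 2 <= 2 * (1 + e ^+ 2) by have := sqr_ge0 (1 - e); nra.
have h2 : (1 + e ^+ 2) ^+ 2 <= 2 * (1 + e ^+ 4).
  by have := sqr_ge0 (1 - e ^+ 2); rewrite (exprM e 2 2); nra.
have -> : (1 + e) ^+ 4 = ((1 + e) ^+ 2) ^+ 2 by rewrite -exprM.
have := sqr_ge0 (1 + e); have := sqr_ge0 e; nra.
Qed.

Lemma preimage_hyperplane_eq0 : distribution P X `<< @lebesgue_cV R d ->
  forall v c, v != 0 -> P (X @^-1` [set x | dotv v x = c]) = 0%E.
Proof.
move=> /null_content_dominatesP ac v c v0; apply: (ac [set x | dotv v x = c]).
  exact: measurable_hyperplane.
exact: lebesgue_cV_hyperplane.
Qed.

End reduction.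

Theorem corollary4p2 (R : realType) (d : nat) (a : R)
  (d_gt0 : (0 < d)%N) (a_gt0 : 0 < a)
  (disp : measure_display) (T : measurableType disp) (P : probability T R)
  (X : {RV P >-> 'cV[R]_d}) (Xs : nat -> {RV P >-> 'cV[R]_d})
  (Xs_iid : iid_copies P X Xs)
  (X_ac : distribution P X `<< @lebesgue_cV R d)
  (X_not_normal : ~ nondegenerate_normal (distribution P X))
  (X_moment : ('E_P[fun w => (enorm (X w) ^+ 4)%R] < +oo)%E)
  (disp0 : measure_display) (T0 : measurableType disp0)
  (P0 : probability T0 R)
  (Z : {RV P0 >-> 'cV[R]_d}) (Zs : nat -> {RV P0 >-> 'cV[R]_d})
  (Zs_iid : iid_copies P0 Z Zs)
  (Z_normal : nondegenerate_normal (distribution P0 Z))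
  (alpha : R) (alpha_gt0 : 0 < alpha) (alpha_lt1 : alpha < 1) :
  P [set w | critical_value P0 Zs n a alpha < U_sample P Xs n a w] @[n --> \oo]
    --> 1%E.
Proof.
have [K [k [Ku N_law]]] := standardize_normal Z_normal.
set N := affine_rv _ _ Z in N_law; pose Ns j := affine_rv (invmx K) (- (invmx K *m k)) (Zs j).
have Ns_iid : iid_copies P0 N Ns by exact: iid_affine_rv.
have X4 := integrable_growth4 X_moment.
have [L [m [Ltrig Ldet Y_mean Y_cov]]] :=
  standardization X4 (preimage_hyperplane_eq0 X_ac).
have Lu : L \in unitmx by rewrite unitmxE unitfE gt_eqF.
have Y4 := integrable_affine_rv (invmx L) (- (invmx L *m m)) X4.
pose Y' : {RV P >-> 'cV[R]_d} := affine_rv (invmx L) (- (invmx L *m m)) X.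
pose Ys j : {RV P >-> 'cV[R]_d} := affine_rv (invmx L) (- (invmx L *m m)) (Xs j).
have Ys_iid : iid_copies P Y' Ys by exact: iid_affine_rv.
pose D := gint a (fun t => osc_expect Y' 0 t ^+ 2 + osc_expect Y' (- (pi / 2)) t ^+ 2).
have D0 : 0 < D.
  have Dge0 : 0 <= D.
    apply: Rintegral_ge0 => t _.
    by rewrite mulr_ge0 ?gauss_ge0// addr_ge0 ?sqr_ge0.
  (* If D = 0, the standardized X and the standardized Z both have zero energy, hence the same law.
     Thus Z also supplies the standard normal vector of the comparison, and X would be normal. *)
  rewrite lt_neqAle Dge0 andbT eq_sym; apply/eqP => D00.
  apply: X_not_normal; apply: (normal_of_standardize Ltrig Ldet) => A mA.
  rewrite -(N_law A mA).
  apply: (eq_law Y4 (std_normal_moment4 N_law) a_gt0 D00 _ mA).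
  transitivity (gint a (fun _ : 'cV[R]_d => 0)); last exact: gint0.
  by apply: eq_gint => t; rewrite !(std_normal_osc_expect N_law) expr0n addr0.
have D8 : 0 < D / 8 by rewrite divr_gt0.
have D84 : D / 8 < D / 4 by lra.
(* With probability at least 1 - alpha the null statistic is eventually at most n D / 8, which
   bounds its quantile c_n. The strict inequality with n D / 4 gives the strict inequality in the
   rejection event. *)
have [M HM] := U_stat_upper a_gt0 Ns_iid N_law D8 alpha_gt0.
have mU n : measurable [set w | critical_value P0 Zs n a alpha < U_sample P Xs n a w].
  rewrite (_ : [set w | _] = U_sample P Xs n a @^-1` `]critical_value P0 Zs n a alpha, +oo[).
    by rewrite -[X in measurable X]setTI; exact: measurable_U_sample.
  by apply/seteqP; split=> w /=; rewrite in_itv/= andbT.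
apply/fine_cvgP; split; first by apply: nearW => n; exact: fin_num_measure.
apply/cvgrPdist_le => eps eps0.
have [M' HM'] := U_stat_lower a_gt0 Ys_iid Y4 Y_mean Y_cov D0 eps0.
near=> n.
have n0 : (0 < n)%N by near: n; exact: nbhs_infty_gt.
have Mn : (M <= n)%N by near: n; exact: nbhs_infty_ge.
have Mn' : (M' <= n)%N by near: n; exact: nbhs_infty_ge.
have [G0 [mG0 PG0 UG0]] := HM n Mn.
have [G [mG PG UG]] := HM' n Mn'.
have cn : critical_value P0 Zs n a alpha <= n%:R * (D / 8).
  apply: (critical_value_upper a_gt0 alpha_lt1 mG0 PG0) => w /UG0.
  by rewrite (U_sample_affine a_gt0 _ (- (invmx K *m k)) (A := invmx K)) ?unitmx_inv.
pose E := [set w | critical_value P0 Zs n a alpha < U_sample P Xs n a w].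
have sGE : G `<=` E.
  move=> w /UG Uw; apply: (le_lt_trans cn).
  rewrite (U_sample_affine a_gt0 _ (- (invmx L *m m)) (A := invmx L)) ?unitmx_inv//.
  apply: lt_le_trans Uw; rewrite ltr_pM2l ?ltr0n//; exact: D84.
have mE : measurable E by exact: mU.
have GE : (P G <= P E)%E.
  by apply: (le_measure P _ _ sGE); rewrite inE.
have PE1 : (P E <= 1)%E by exact: probability_le1.
have PGe : ((1 - eps)%:E <= P G)%E.
  rewrite -[G]setCK probability_setC; last exact: measurableC.
  by rewrite EFinB leeB.
have PEf : P E \is a fin_num by exact: fin_num_measure.
have := le_trans PGe GE; move: PE1; rewrite -(fineK PEf) !lee_fin => h1 h2.
rewrite -[X in `|_ - fine X|]/(P E) ger0_norm ?subr_ge0//; lra.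
Unshelve. all: by end_near. Qed.
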